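(* Let $k$ be a field of characteristic $2$. Let $G=SG(2^8,i)$ and $H=SG(2^8,j)$, where $$(i,j)\in\{(1272,1273),\ (1274,1275),\ (1778,1781),\ (1779,1780)\}.$$ Then $D_5(G)=1$ and $G/D_4(G)\cong H/D_4(H)$, while $$I(kG)/I(kG)^9\cong I(kH)/I(kH)^9 \quad\text{and}\quad I(kG)/I(kG)^{10}\not\cong I(kH)/I(kH)^{10}.$$
   Context: $SG(2^8,i)$ denotes the $i$-th group of order $2^8$ as indexed in the Small Groups Library of the computer algebra system GAP. For a field $k$ and a finite group $G$, $kG$ denotes the group algebra of $G$ over $k$, and $I(kG)$ denotes its augmentation ideal, i.e. the set of elements of $kG$ whose coefficients sum to $0$. The quotients $I(kG)/I(kG)^m$ are regarded as (non-unital) $k$-algebras, and $\cong$ between them means isomorphism as $k$-algebras. For a finite $p$-group $G$ (here $p=2$), the Jennings-Zassenhaus series is $G=D_1(G)\ge D_2(G)\ge\cdots$ with $$D_m(G)=\prod_{ip^j\ge m}\gamma_i(G)^{p^j}\qquad (i\ge 1,\ j\ge 0),$$ where $\gamma_i(G)$ is the $i$-th term of the lower central series of $G$ (with $\gamma_1(G)=G$) and $N^{p^j}$ denotes the subgroup generated by the $p^j$-th powers of elements of $N$. *)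

(* Defs.v *)
From HB Require Import structures.
From mathcomp Require Import all_boot all_order all_algebra.
From mathcomp Require Import all_fingroup all_solvable all_field.
From mathcomp Require Import generic_quotient ring_quotient.

Set Implicit Arguments.
Unset Strict Implicit.
Unset Printing Implicit Defensive.

Import GRing.Theory.

(** * The Jennings-Zassenhaus series *)

Section Jennings.

Local Open Scope group_scope.

Variables (p : nat) (gT : finGroupType) (G : {group gT}).

(* The subgroup generated by the n-th powers of the elements of A. *)
Definition power_subgroup (n : nat) (A : {set gT}) : {group gT} :=
  <<[set x ^+ n | x in A]>>%G.

(* [\prod] in the scope %G is the join of subgroups; the factors being normal
   in G, it is their product. The terms with m < i or m < j are dropped because
   they do not contribute: see [sub_jennings]. *)
Definition jennings (m : nat) : {group gT} :=
  (\prod_(i < m.+1 | (0 < i)%N) \prod_(j < m.+1 | (m <= i * p ^ j)%N)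
     power_subgroup (p ^ j) 'L_i(G))%G.

Lemma power_subgroupS n (A B : {set gT}) :
  A \subset B -> power_subgroup n A \subset power_subgroup n B.
Proof. by move=> sAB; apply/genS/imsetS. Qed.

Lemma power_subgroup_sub n (H : {group gT}) : power_subgroup n H \subset H.
Proof.
by rewrite gen_subG; apply/subsetP=> _ /imsetP[x Hx ->]; apply: groupX.
Qed.

Lemma power_subgroupM a b (A : {set gT}) :
  power_subgroup (a * b) A \subset power_subgroup a A.
Proof.
rewrite gen_subG; apply/subsetP=> _ /imsetP[x Ax ->].
by rewrite expgM; apply/groupX/mem_gen/imsetP; exists x.
Qed.

Lemma sub_jennings m i j : (1 < p)%N -> (0 < m)%N -> (0 < i)%N ->
  (m <= i * p ^ j)%N -> power_subgroup (p ^ j) 'L_i(G) \subset jennings m.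
Proof.
move=> p_gt1 m_gt0 i_gt0 le_m.
have small (i' j' : 'I_m.+1) : (0 < i')%N -> (m <= i' * p ^ j')%N ->
    power_subgroup (p ^ j') 'L_i'(G) \subset jennings m.
  move=> i'_gt0 le_m'; rewrite /jennings (bigD1 i') //= (bigD1 j') //=.
  by rewrite -joingA joing_subl.
case: (leqP i m) => [le_im | lt_mi]; last first.
  apply: subset_trans (power_subgroup_sub _ _) _.
  apply: subset_trans (lcn_sub_leq _ (ltnW lt_mi)) _.
  apply: subset_trans (small ord_max ord0 m_gt0 _); last by rewrite /= muln1.
  apply/subsetP=> x Lx; rewrite mem_gen //; apply/imsetP.
  by exists x; rewrite // expg1.
case: (leqP j m) => [le_jm | lt_mj].
  by apply: (small (Ordinal (le_im : (i < m.+1)%N))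
                   (Ordinal (le_jm : (j < m.+1)%N))).
rewrite -(subnKC (ltnW lt_mj)) expnD.
apply: subset_trans (power_subgroupM _ _ _) _.
apply: (small (Ordinal (le_im : (i < m.+1)%N)) ord_max) => //=.
exact: leq_trans (ltnW (ltn_expl m p_gt1)) (leq_pmull _ i_gt0).
Qed.

End Jennings.

(** * Group algebras *)

Local Open Scope ring_scope.

(* The group algebra kG, where G is the whole of the finite group type gT; the
   pointwise product of {ffun gT -> k^o} is not inherited. *)
Definition group_algebra (k : fieldType) (gT : finGroupType) : Type :=
  {ffun gT -> k^o}.

Section GroupAlgebra.

Variables (k : fieldType) (gT : finGroupType).

Local Notation kG := (group_algebra k gT).

HB.instance Definition _ := Vector.copy kG {ffun gT -> k^o}.

Implicit Types x y z : kG.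

Definition ga_one : kG := [ffun g => (g == 1%g)%:R].

Definition ga_mul x y : kG := [ffun g => \sum_h x h * y (h^-1 * g)%g].

Fact ga_mulA : associative ga_mul.
Proof.
move=> x y z; apply/ffunP=> g; rewrite !ffunE.
under [RHS]eq_bigr do rewrite ffunE mulr_suml.
rewrite exchange_big /=; apply: eq_bigr => h _.
rewrite ffunE mulr_sumr (reindex_inj (mulgI h^-1%g)) /=.
by apply: eq_bigr => u _; rewrite mulrA invMg invgK -mulgA mulKVg.
Qed.

Fact ga_mul1 : left_id ga_one ga_mul.
Proof.
move=> x; apply/ffunP=> g; rewrite ffunE (bigD1 1%g) //= ffunE eqxx mul1r.
rewrite invg1 mul1g big1 ?addr0 // => h /negPf nh1.
by rewrite ffunE nh1 mul0r.
Qed.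

Fact ga_mulr1 : right_id ga_one ga_mul.
Proof.
move=> x; apply/ffunP=> g; rewrite ffunE (bigD1 g) //= ffunE mulVg eqxx mulr1.
rewrite big1 ?addr0 // => h /negPf nhg.
by rewrite ffunE -eq_mulVg1 nhg mulr0.
Qed.

Fact ga_mulDl : left_distributive ga_mul +%R.
Proof.
move=> x y z; apply/ffunP=> g; rewrite !ffunE -big_split /=.
by apply: eq_bigr => h _; rewrite ffunE mulrDl.
Qed.

Fact ga_mulDr : right_distributive ga_mul +%R.
Proof.
move=> x y z; apply/ffunP=> g; rewrite !ffunE -big_split /=.
by apply: eq_bigr => h _; rewrite ffunE mulrDr.
Qed.

Fact ga_one_neq0 : ga_one != 0.
Proof.
by apply/eqP=> /ffunP/(_ 1%g)/eqP; rewrite !ffunE eqxx oner_eq0.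
Qed.

HB.instance Definition _ := GRing.Zmodule_isNzRing.Build kG
  ga_mulA ga_mul1 ga_mulr1 ga_mulDl ga_mulDr ga_one_neq0.

Fact ga_scaleAl (a : k) x y : a *: (x * y) = (a *: x) * y.
Proof.
apply/ffunP=> g; rewrite !ffunE scaler_sumr.
by apply: eq_bigr => h _; rewrite ffunE scalerAl.
Qed.

HB.instance Definition _ := GRing.Lmodule_isLalgebra.Build k kG ga_scaleAl.

Fact ga_scaleAr (a : k) x y : a *: (x * y) = x * (a *: y).
Proof.
apply/ffunP=> g; rewrite !ffunE scaler_sumr.
by apply: eq_bigr => h _; rewrite ffunE scalerAr.
Qed.

HB.instance Definition _ := GRing.Lalgebra_isAlgebra.Build k kG ga_scaleAr.
HB.instance Definition _ := Algebra_isFalgebra.Build k kG.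

Definition augmentation x : k^o := \sum_g x g.

Fact augmentation_is_linear : linear augmentation.
Proof.
move=> a x y; rewrite /augmentation scaler_sumr -big_split /=.
by apply: eq_bigr => g _; rewrite !ffunE.
Qed.

HB.instance Definition _ :=
  GRing.isLinear.Build k kG k^o _ augmentation augmentation_is_linear.

Definition aug_ideal : {vspace kG} := lker (linfun augmentation).

Lemma mem_aug_ideal x : (x \in aug_ideal) = (\sum_g x g == 0).
Proof. by rewrite memv_ker lfunE. Qed.

Lemma augmentationM x y :
  augmentation (x * y) = augmentation x * augmentation y.
Proof.
rewrite /augmentation mulr_suml; under eq_bigr do rewrite ffunE.
rewrite exchange_big /=; apply: eq_bigr => h _; rewrite mulr_sumr.
rewrite (reindex_inj (mulgI h)) /=.
by apply: eq_bigr => g _; rewrite mulKg.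
Qed.

Lemma aug_idealMl x y : y \in aug_ideal -> x * y \in aug_ideal.
Proof.
rewrite !mem_aug_ideal => /eqP y0.
by rewrite -/(augmentation _) augmentationM /augmentation y0 mulr0.
Qed.

(** * The non-unital algebras I(kG) / I(kG)^m *)

Local Notation I := (subvs_of aug_ideal).

Definition aug_mul (u v : I) : I := vsproj aug_ideal (vsval u * vsval v).

Lemma aug_mulE u v : vsval (aug_mul u v) = vsval u * vsval v.
Proof. by rewrite vsprojK // aug_idealMl // subvsP. Qed.

Definition aug_pow (m : nat) : {pred I} :=
  fun u => vsval u \in (aug_ideal ^+ m)%VS.

Fact aug_pow_zmod_closed m : zmod_closed (aug_pow m).
Proof.
split=> [|u v]; first exact: mem0v.
rewrite /in_mem /= /aug_pow => Xu Xv.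
exact: memvB.
Qed.

HB.instance Definition _ m :=
  GRing.isZmodClosed.Build I (aug_pow m) (aug_pow_zmod_closed m).

Definition aug_quot (m : nat) : Type := Quotient.quot (aug_pow m).

HB.instance Definition _ m := ZmodQuotient.on (aug_quot m).

Section Quotient.

Variable m : nat.

Local Notation Q := (aug_quot m).
Local Open Scope quotient_scope.

Lemma aug_quotE (u v : I) :
  (u == v %[mod Q]) = (vsval u - vsval v \in (aug_ideal ^+ m)%VS).
Proof. by rewrite -Quotient.idealrBE. Qed.

Lemma pi_augD (u v : I) : \pi_Q (u + v) = \pi_Q u + \pi_Q v.
Proof. exact: Quotient.pi_add. Qed.

Definition aug_quot_scale (a : k) (x : Q) : Q := \pi_Q (a *: repr x).

Definition aug_quot_mul (x y : Q) : Q := \pi_Q (aug_mul (repr x) (repr y)).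

Lemma pi_augZ (a : k) (u : I) : \pi_Q (a *: u) = aug_quot_scale a (\pi_Q u).
Proof.
apply/eqP; rewrite aug_quotE -linearB -scalerBr linearZ memvZ //.
by rewrite linearB -aug_quotE reprK.
Qed.

Lemma sub_expv_aug : (0 < m)%N -> (aug_ideal ^+ m.+1 <= aug_ideal ^+ m)%VS.
Proof.
case: m => // n _; rewrite -[n.+2]/(2 + n)%N expvD [X in (_ <= X)%VS]expvSl.
apply: prodvSl; rewrite expv2; apply/prodvP=> x y _; exact: aug_idealMl.
Qed.

(* The product of classes is the class of the product. *)
Lemma pi_augM (m_gt0 : (0 < m)%N) (u v : I) :
  \pi_Q (aug_mul u v) = aug_quot_mul (\pi_Q u) (\pi_Q v).
Proof.
apply/eqP; rewrite aug_quotE !aug_mulE.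
set u' := repr _; set v' := repr _.
have Du : vsval u - vsval u' \in (aug_ideal ^+ m)%VS.
  by rewrite -aug_quotE reprK.
have Dv : vsval v - vsval v' \in (aug_ideal ^+ m)%VS.
  by rewrite -aug_quotE reprK.
rewrite -(subrK (vsval u' * vsval v) (vsval u * vsval v)) -addrA -mulrBl.
rewrite -mulrBr memvD // (subvP (sub_expv_aug m_gt0)) //.
  by rewrite expvSr memv_mul // subvsP.
by rewrite expvSl memv_mul // subvsP.
Qed.

Fact aug_quot_scaleA (a b : k) (x : Q) :
  aug_quot_scale a (aug_quot_scale b x) = aug_quot_scale (a * b) x.
Proof. by rewrite -[x]reprK -!pi_augZ scalerA reprK. Qed.

Fact aug_quot_scale1 : left_id 1 aug_quot_scale.
Proof. by move=> x; rewrite -[x]reprK -pi_augZ scale1r. Qed.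

Fact aug_quot_scaleDr : right_distributive aug_quot_scale +%R.
Proof.
by move=> a x y; rewrite -[x]reprK -[y]reprK -pi_augD -!pi_augZ scalerDr pi_augD.
Qed.

Fact aug_quot_scaleDl (x : Q) : {morph aug_quot_scale^~ x : a b / a + b}.
Proof.
by move=> a b; rewrite -[x]reprK -!pi_augZ scalerDl pi_augD.
Qed.

HB.instance Definition _ := GRing.Zmodule_isLmodule.Build k Q
  aug_quot_scaleA aug_quot_scale1 aug_quot_scaleDr aug_quot_scaleDl.

End Quotient.

End GroupAlgebra.

(* Isomorphism of k-algebras, without unit: a bijective k-linear map which
   preserves products. *)
Definition aug_quot_isog (k : fieldType) (gT hT : finGroupType) (m : nat) :=
  exists2 f : {linear aug_quot k gT m -> aug_quot k hT m},
    bijective f & {morph f : x y / aug_quot_mul x y}.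

(** * The groups SG(2^8, i) *)

Local Open Scope group_scope.

(* The groups SG(2^8, i) that are needed here, up to isomorphism. There are at
   most 2^8 words a^r b^s c^t with r < 4 and s, t < 8, to which every word
   reduces, and the presentations are consistent: the presented groups are
   semidirect products of the form (<c> : <b>) : <a>, of order 2^8. In the first
   four, G / D_4(G) is SG(2^6, 59) = C4 x (C4 : C4).
   The presentations come from an enumeration of the 6190 groups of order 2^8
   and rank 3 (the indices 542 to 6731) with the p-group generation algorithm,
   which does not fix which group of a pair (i, j) bears which of the two
   indices; D_5 is trivial for both. *)
Definition isSG256 (i : nat) (gT : finGroupType) (G : {set gT}) : Prop :=
  if i == 1272%N then
    G \isog Grp (a : b : c : (a ^+ 4, b ^+ 8, c ^+ 8,
                              b ^ a = b, c ^ a = c ^+ 3, c ^ b = c ^+ 5))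
  else if i == 1273%N then
    G \isog Grp (a : b : c : (a ^+ 4, b ^+ 8, c ^+ 8,
                              b ^ a = b, c ^ a = c ^+ 7, c ^ b = c ^+ 5))
  else if i == 1274%N then
    G \isog Grp (a : b : c : (a ^+ 4, b ^+ 8, c ^+ 8,
                              b ^ a = b ^+ 5, c ^ a = c ^+ 3, c ^ b = c ^+ 5))
  else if i == 1275%N then
    G \isog Grp (a : b : c : (a ^+ 4, b ^+ 8, c ^+ 8,
                              b ^ a = b ^+ 5, c ^ a = c ^+ 7, c ^ b = c ^+ 5))
  else if i == 1778%N then
    G \isog Grp (a : b : c : (a ^+ 4, b ^+ 8, c ^+ 8,
                              b ^ a = b * c ^+ 2, c ^ a = b ^+ 2 * c,
                              c ^ b = c))
  else if i == 1779%N then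
    G \isog Grp (a : b : c : (a ^+ 4, b ^+ 8, c ^+ 8,
                              b ^ a = b * c ^+ 6, c ^ a = b ^+ 2 * c,
                              c ^ b = c))
  else if i == 1780%N then
    G \isog Grp (a : b : c : (a ^+ 4, b ^+ 8, c ^+ 8,
                              b ^ a = b * c ^+ 2, c ^ a = b ^+ 2 * c ^+ 5,
                              c ^ b = c))
  else if i == 1781%N then
    G \isog Grp (a : b : c : (a ^+ 4, b ^+ 8, c ^+ 8,
                              b ^ a = b * c ^+ 6, c ^ a = b ^+ 2 * c ^+ 5,
                              c ^ b = c))
  else False.

(* Main.v *)
(* With x = a - 1, y = b - 1 and z = c - 1, the x^i y^j z^l with i < 4 and j, l < 8 form a basis
   of the group algebra, those with i + j + l >= m a basis of I^m, and the coordinates of a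
   product are computed from those of its factors by tables.

   An isomorphism modulo I^9 is obtained from elements A, B and C of kH with linear parts x, y
   and z which satisfy the relations of G modulo I^9: the map sending the elements
   a^i b^j c^l of G to A^i B^j C^l then preserves leading terms, hence is bijective.

   An isomorphism modulo I^10 would provide A, B and C in kH which satisfy the relations of G
   modulo I^10 and whose linear parts are independent. Every coefficient of a relation is a
   polynomial over F_2 in the coordinates of A, B and C. The terms of low degree determine the
   linear parts, after rescaling or exchanging b and c. Then the coefficients, taken in order of
   degree and modulo an ideal spanned by monomials, are solved one after the other for a
   coordinate that occurs linearly, until one of them becomes 1 = 0.

   D_5 = 1 because the lower central series of G is contained in G, <b^2, c^2>, <b^4, c^4>, 1,
   of exponents 8, 4, 2, 1. Since D_4(H) contains b^4 and c^4 and the presentations of G and H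
   agree modulo 4, G maps onto H / D_4(H), and conversely. *)
Require Import Defs.
From Stdlib Require Import Setoid Morphisms.
From HB Require Import structures.
From mathcomp Require Import all_boot all_order all_algebra.
From mathcomp Require Import all_fingroup all_solvable all_field.
From mathcomp Require Import generic_quotient ring_quotient ring.

Set Implicit Arguments.
Unset Strict Implicit.
Unset Printing Implicit Defensive.

Import GRing.Theory.

(** * Polynomials over F_2 *)

Section PolynomialsF2.

Local Open Scope ring_scope.

(** The structure constants in the basis x^i y^j z^l lie in F_2, but the unknown coordinates of A, B
    and C lie in an arbitrary field k of characteristic 2. The computation is therefore made once,
    with polynomials over F_2, and then evaluated in k. It never divides: a variable is eliminated
    only where it stands alone with coefficient 1. This is why the linear parts are settled by field
    arguments before the elimination starts: they involve inverses, a free scalar, and cube roots of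
    unity if k contains F_4. Once they are known, leading coefficients are 1.

    The second obstacle is size. Modulo I^10 each of A, B and C has more than 128 coordinates, and
    the coefficients of the relations are large polynomials in them. A quotient by a monomial ideal
    that still sees the contradiction keeps far fewer. Likewise the relations are rewritten as short
    words, such as c a c = a for c^a = c^7.

    Certificates only guide the computation. Whatever variables they propose, each substitution is
    an identity between actual coordinates, so what has to be checked at the end is a single
    coefficient. *)

Definition triple : Type := nat * nat * nat.

Definition teq (s t : triple) : bool :=
  [&& eqn s.1.1 t.1.1, eqn s.1.2 t.1.2 & eqn s.2 t.2].

Lemma teqP s t : reflect (s = t) (teq s t).
Proof.
case: s t => [[i j] l] [[i' j'] l'].
by apply: (iffP and3P) => /= [[/eqnP-> /eqnP-> /eqnP->] // | [-> -> ->]]; split; apply/eqnP.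
Qed.

Fixpoint ncmp (m n : nat) : comparison :=
  match m, n with
  | 0, 0 => Eq
  | 0, _ => Lt
  | _, 0 => Gt
  | m'.+1, n'.+1 => ncmp m' n'
  end.

Lemma ncmpE m n : ncmp m n = Eq -> m = n.
Proof. by elim: m n => [|m IHm] [|n] //= /IHm->. Qed.

(* The variable [(a, s)] stands for the coefficient of index [s] of the atom [a]. *)
Definition var : Type := nat * triple.

Definition vcmp (v w : var) : comparison :=
  match ncmp v.2.1.1 w.2.1.1 with Eq =>
    match ncmp v.2.1.2 w.2.1.2 with Eq =>
      match ncmp v.2.2 w.2.2 with Eq => ncmp v.1 w.1 | o => o end
    | o => o end
  | o => o end.

Lemma vcmpE v w : vcmp v w = Eq -> v = w.
Proof.
case: v w => [a [[i j] l]] [a' [[i' j'] l']]; rewrite /vcmp /=.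
case: ncmp (@ncmpE i i') => // -> //; case: ncmp (@ncmpE j j') => // -> //.
by case: ncmp (@ncmpE l l') => // -> // /ncmpE->.
Qed.

Definition veq (v w : var) : bool := eqn v.1 w.1 && teq v.2 w.2.

Lemma veqP v w : veq v w -> v = w.
Proof. by case: v w => [a s] [b t] /andP[/eqnP/= -> /teqP/= ->]. Qed.

(* Polynomials over F_2: a monomial is the sorted list of its variables, a polynomial the
   decreasing list of its monomials. Only the running time depends on this order. *)
Definition mono := seq var.
Definition fpoly := seq mono.

Fixpoint mono_cmp (m n : mono) : comparison :=
  match m, n with
  | [::], [::] => Eq
  | [::], _ => Lt
  | _, [::] => Gt
  | x :: m', y :: n' =>
    match vcmp x y with Eq => mono_cmp m' n' | Lt => Gt | Gt => Lt end
  end.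

(** Repetitions are kept in the merged list: the variables take values in k, where v^2 = v may
    fail. *)
Fixpoint mono_mul (m : mono) : mono -> mono :=
  if m is x :: m' then
    fix aux n := if n is y :: n' then
      if vcmp x y is Gt then y :: aux n' else x :: mono_mul m' n else m
  else fun n => n.

Fixpoint padd (p : fpoly) : fpoly -> fpoly :=
  if p is m :: p' then
    fix aux q := if q is n :: q' then
      match mono_cmp m n with
      | Eq => padd p' q' | Gt => m :: padd p' q | Lt => n :: aux q'
      end else p
  else fun q => q.

Fixpoint padd_pairs (l : seq fpoly) : seq fpoly :=
  if l is p :: q :: l' then padd p q :: padd_pairs l' else l.

(** Adding neighbours in rounds keeps the merges balanced. The fuel 16 is enough for 2^16 summands;
    a longer list ends in a plain fold, so the sum is right whatever the fuel. *)
Fixpoint psum_rec (n : nat) (l : seq fpoly) : fpoly :=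
  match n, l with
  | _, [::] => [::]
  | _, [:: p] => p
  | n'.+1, _ => psum_rec n' (padd_pairs l)
  | 0, _ => foldr padd [::] l
  end.

Definition psum (l : seq fpoly) : fpoly := psum_rec 16 l.

Definition pmul (p q : fpoly) : fpoly := psum [seq map (mono_mul m) q | m <- p].

(** The Frobenius map: cross terms of a square cancel in characteristic 2. [ppow] relies on it for
    the exponents 2 and 4. *)
Definition psq (p : fpoly) : fpoly := [seq mono_mul m m | m <- p].

Fixpoint ppow (p : fpoly) (e : nat) : fpoly :=
  match e with
  | 0 => [:: [::]]
  | 1 => p
  | 2 => psq p
  | 4 => psq (psq p)
  | e'.+1 => pmul p (ppow p e')
  end.

Definition pvar (v : var) : fpoly := [:: [:: v]].

Definition occurs (v : var) (m : mono) : bool := has (veq v) m.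

Definition psubst (v : var) (r p : fpoly) : fpoly :=
  if has (occurs v) p then
    psum ([seq m <- p | ~~ occurs v m] ::
          [seq [seq mono_mul [seq x <- m | ~~ veq v x] n
               | n <- ppow r (count (veq v) m)] | m <- p & occurs v m])
  else p.

Section Eval.

Variables (k : fieldType) (char2 : 2 \in [pchar k]).
Variable env : var -> k.

Definition meval (m : mono) : k := \prod_(x <- m) env x.
Definition peval (p : fpoly) : k := \sum_(m <- p) meval m.

Lemma addxx (x : k) : x + x = 0.
Proof. exact: addrr_pchar2. Qed.

Lemma mevalM m n : meval (mono_mul m n) = meval m * meval n.
Proof.
rewrite /meval; elim: m n => [|x m IHm] n; first by rewrite big_nil mul1r.
elim: n => [|y n IHn]; first by rewrite big_nil mulr1.
rewrite [mono_mul _ _]/=.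
case: vcmp; last by rewrite big_cons IHn !big_cons mulrCA; congr (_ * _); exact: mulrCA.
  by rewrite big_cons IHm !big_cons mulrA.
by rewrite big_cons IHm !big_cons mulrA.
Qed.

Lemma peval_cons m p : peval (m :: p) = meval m + peval p.
Proof. exact: big_cons. Qed.

Lemma peval0 : peval [::] = 0.
Proof. exact: big_nil. Qed.

Lemma pevalX v : peval (pvar v) = env v.
Proof. by rewrite /peval /meval !big_cons !big_nil mulr1 addr0. Qed.

Lemma peval1 : peval [:: [::]] = 1.
Proof. by rewrite peval_cons peval0 /meval big_nil addr0. Qed.

Lemma mono_cmpE m n : mono_cmp m n = Eq -> m = n.
Proof.
elim: m n => [|x m IHm] [|y n] //=; by case: vcmp (@vcmpE x y) => // -> // /IHm ->.
Qed.

Lemma pevalD p q : peval (padd p q) = peval p + peval q.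
Proof.
elim: p q => [|m p IHp] q; first by rewrite peval0 add0r.
elim: q => [|n q IHq]; first by rewrite peval0 addr0.
rewrite [padd _ _]/=; case E: (mono_cmp m n).
- rewrite (mono_cmpE E) IHp !peval_cons addrACA addxx add0r //.
- by rewrite peval_cons IHq !peval_cons addrCA.
- by rewrite peval_cons IHp !peval_cons addrA.
Qed.

Lemma peval_sum l : peval (psum l) = \sum_(p <- l) peval p.
Proof.
have pairsE l' : \sum_(p <- padd_pairs l') peval p = \sum_(p <- l') peval p.
  have [n] := ubnP (size l'); elim: n l' => [|n IHn] [|p [|q l']] //= lt_l.
  by rewrite !big_cons IHn ?pevalD ?addrA // ltnW.
rewrite /psum; move: (X in psum_rec X _) => n.
elim: n l => [|n IHn] [|p [|q l']].
- by rewrite big_nil peval0.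
- by rewrite big_seq1.
- rewrite -[psum_rec _ _]/(foldr padd [::] (p :: q :: l')).
  elim: (p :: q :: l') => [|r s IHs]; first by rewrite big_nil [foldr _ _ _]/= peval0.
  by rewrite [foldr _ _ _]/= pevalD IHs big_cons.
- by rewrite big_nil peval0.
- by rewrite big_seq1.
by rewrite -[psum_rec _ _]/(psum_rec n (padd_pairs (p :: q :: l'))) IHn pairsE.
Qed.

Lemma peval_mapM m q : peval (map (mono_mul m) q) = meval m * peval q.
Proof.
by rewrite /peval big_map mulr_sumr; apply: eq_bigr => n _; apply: mevalM.
Qed.

Lemma pevalM p q : peval (pmul p q) = peval p * peval q.
Proof.
rewrite peval_sum big_map /peval mulr_suml; apply: eq_bigr => m _.
exact: peval_mapM.
Qed.

Lemma peval_sq p : peval (psq p) = peval p ^+ 2.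
Proof.
rewrite /peval big_map -(pFrobenius_autE char2) rmorph_sum /=.
by apply: eq_bigr => m _; rewrite mevalM pFrobenius_autE expr2.
Qed.

Lemma peval_pow p e : peval (ppow p e) = peval p ^+ e.
Proof.
elim: e => [|[|[|[|[|e]]]] IHe]; rewrite ?peval1 ?expr1 //.
- exact: peval_sq.
- by rewrite [ppow _ _]/= pevalM peval_sq -exprS.
- by rewrite [ppow _ _]/= !peval_sq -exprM.
- by rewrite [ppow _ _]/= pevalM IHe -exprS.
Qed.

Lemma meval_split v m :
  meval m = env v ^+ count (veq v) m *
            meval [seq x <- m | ~~ veq v x].
Proof.
rewrite /meval; elim: m => [|x m IHm] /=; first by rewrite mul1r.
case E: (veq v x) => /=; rewrite !big_cons IHm ?add1n ?add0n.
  by rewrite -(veqP E) exprS mulrA.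
by rewrite mulrCA.
Qed.

Lemma peval_subst v r p :
  env v = peval r -> peval (psubst v r p) = peval p.
Proof.
move=> Ev; rewrite /psubst; case: ifP => // _.
rewrite peval_sum big_cons big_map big_filter.
rewrite /peval big_filter [RHS](bigID (occurs v)) /= addrC; congr (_ + _).
apply: eq_bigr => m _.
by rewrite [LHS]peval_mapM peval_pow [RHS](meval_split v) Ev mulrC.
Qed.

End Eval.

End PolynomialsF2.

(** * Coordinates in the group algebra *)

Section Coordinates.

Local Open Scope ring_scope.

Definition box : seq triple :=
  [seq (ij.1, ij.2, l) | ij <- [seq (i, j) | i <- iota 0 4, j <- iota 0 8], l <- iota 0 8].

Definition inbox (s : triple) : bool := [&& s.1.1 < 4, s.1.2 < 8 & s.2 < 8]%N.

Lemma mem_box (s : triple) : (s \in box) = inbox s.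
Proof.
case: s => [[i j] l]; apply/idP/idP => [|/and3P[/= ? ? ?]].
  case/flattenP => s0 /mapP[[i' j'] Hij ->] /mapP[l' Hl] [-> -> ->].
  case/flattenP: Hij => s1 /mapP[i'' Hi ->] /mapP[j'' Hj] [-> ->].
  by move: Hi Hj Hl; rewrite !mem_iota => Hi Hj Hl; apply/and3P.
apply/flattenP; exists [seq (i, j, l') | l' <- iota 0 8].
  apply/mapP; exists (i, j) => //; apply/flattenP.
  by exists [seq (i, j') | j' <- iota 0 8]; apply/mapP; [exists i | exists j]; rewrite ?mem_iota.
by apply/mapP; exists l; rewrite ?mem_iota.
Qed.

Definition deg (s : triple) : nat := (s.1.1 + s.1.2 + s.2)%N.

(* By Lucas, [bsub1 i j] is the parity of ['C(j, i)] for [i, j < 8]: in characteristic 2,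
   [g ^+ j] is the sum of the [(g - 1) ^+ i] with [bsub1 i j]. *)
Definition bsub1 (i j : nat) : bool :=
  [&& odd i ==> odd j, odd i./2 ==> odd j./2 & odd i./2./2 ==> odd j./2./2].

Definition bsub (s t : triple) : bool :=
  [&& bsub1 s.1.1 t.1.1, bsub1 s.1.2 t.1.2 & bsub1 s.2 t.2].

(* The groups < a, b, c > of order 256 with a ^+ 4 = b ^+ 8 = c ^+ 8 = 1 and
   b ^ a = b ^+ p0 * c ^+ p1, c ^ a = b ^+ q0 * c ^+ q1, c ^ b = c ^+ r. *)
Record pres := Pres { p0 : nat; p1 : nat; q0 : nat; q1 : nat; rb : nat }.

(** * Right multiplication by the generators, on exponents and on coordinates *)

Section Tables.

Variable P : pres.

(** Exponents of the conjugate of b^j c^l by a. Linearity in (j, l) supposes that b and c commute or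
    that a normalizes both cyclic groups, the two cases of [nf_split]. *)
Definition conj_exp (t : nat * nat) : nat * nat :=
  ((p0 P * t.1 + q0 P * t.2) %% 8, (p1 P * t.1 + q1 P * t.2) %% 8)%N.

Definition mula (t : triple) : triple :=
  let u := conj_exp (t.1.2, t.2) in (t.1.1.+1 %% 4, u.1, u.2)%N.
Definition mulb (t : triple) : triple :=
  (t.1.1, t.1.2.+1 %% 8, (rb P * t.2) %% 8)%N.
Definition mulc (t : triple) : triple := (t.1.1, t.1.2, t.2.+1 %% 8)%N.

Fixpoint toggle (s : triple) (l : seq triple) : seq triple :=
  if l is t :: l' then if teq s t then l' else t :: toggle s l' else [:: s].

Definition xorl (l1 l2 : seq triple) : seq triple := foldr toggle l2 l1.

Definition plane : seq (nat * nat) :=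
  [seq (j, l) | j <- iota 0 8, l <- iota 0 8].

Definition bsub2 (s t : nat * nat) : bool := bsub1 s.1 t.1 && bsub1 s.2 t.2.

Definition parity (T : Type) (f : T -> bool) (l : seq T) : bool :=
  foldr (fun x b => f x (+) b) false l.

(* With y = b - 1 and z = c - 1, [conja_tab] lists, for each [t] in [plane], the [s] such that
   the expansion of a^-1 y ^ s.1 z ^ s.2 a contains y ^ t.1 z ^ t.2; it is computed by
   Moebius inversion. *)
Definition conja_tab : seq (seq (nat * nat)) :=
  let A := [seq (s, [seq conj_exp u | u <- plane & bsub2 u s]) | s <- plane] in
  [seq [seq su.1 | su <- A & parity (bsub2 t) su.2] | t <- plane].

Definition conjb_tab : seq (seq nat) :=
  let A := [seq (s, [seq ((rb P * u) %% 8)%N | u <- iota 0 8 & bsub1 u s]) | s <- iota 0 8] in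
  [seq [seq su.1 | su <- A & parity (bsub1 t) su.2] | t <- iota 0 8].

Definition dec (R : nat -> seq triple) (i : nat) : seq triple :=
  if i is i'.+1 then R i' else [::].

Variables (EA : seq (seq (nat * nat))) (EB : seq (seq nat)).

(** The coordinate [s] of u (a - 1) is the sum of these coordinates of u. Multiplying by a raises
    one exponent, so Pascal's rule contributes the indices i and i - 1; the table accounts for the
    conjugation of b^j c^l; [toggle s] subtracts u itself. *)
Definition coefa (s : triple) : seq triple :=
  let E := nth [::] EA (8 * s.1.2 + s.2) in
  let f i := [seq (i, t.1, t.2) | t <- E] in
  toggle s (xorl (f s.1.1) (dec f s.1.1)).

Definition coefb (s : triple) : seq triple :=
  let E := nth [::] EB s.2 in
  let f j := [seq (s.1.1, j, l) | l <- E] in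
  toggle s (xorl (f s.1.2) (dec f s.1.2)).

Definition coefc (s : triple) : seq triple :=
  dec (fun l => [:: (s.1.1, s.1.2, l)]) s.2.

(** The identities that the tables must satisfy are tested on all pairs of indices rather than
    derived from Moebius inversion. The last test says that multiplication by x or y raises the
    degree, which makes the powers of I visible on the monomials. *)
Definition tables_ok : bool :=
  [&& all (fun t => let E := nth [::] EA (8 * t.1 + t.2) in
        all (fun u => bsub2 t (conj_exp u) == parity (bsub2^~ u) E) plane) plane,
      all (fun l => let E := nth [::] EB l in
        all (fun u => bsub1 l ((rb P * u) %% 8)%N == parity (bsub1^~ u) E)
          (iota 0 8)) (iota 0 8) &
      all (fun s => all (fun t => inbox t && (deg t < deg s)%N)
                      (coefa s ++ coefb s)) box].

End Tables.

Definition tab3 (T : Type) (f : triple -> T) : seq (seq (seq T)) :=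
  [seq [seq [seq f (i, j, l) | l <- iota 0 8] | j <- iota 0 8] | i <- iota 0 4].

Definition get3 (T : Type) (x : T) (t : seq (seq (seq T))) (s : triple) : T :=
  nth x (nth [::] (nth [::] t s.1.1) s.1.2) s.2.

Lemma get3_tab3 T (x : T) f s : s \in box -> get3 x (tab3 f) s = f s.
Proof.
case: s => [[i j] l]; rewrite mem_box => /and3P[/= lt_i lt_j lt_l]; rewrite /get3 /tab3.
by do 3!rewrite (nth_map 0%N) ?size_iota // nth_iota // add0n.
Qed.

(** Linear extension over F_2: a list stands for the sum of its entries, and equal entries
    cancel. *)
Definition ext (R : triple -> seq triple) (l : seq triple) : seq triple :=
  foldr (fun p acc => xorl (R p) acc) [::] l.

Fixpoint walk (i n : nat) (R : seq triple -> seq triple) (l : seq triple) :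
    seq (nat * seq triple) :=
  if n is n'.+1 then (i, l) :: walk i.+1 n' R (R l) else [::].

Lemma walkE n R l : walk 0 n R l = [seq (i, iter i R l) | i <- iota 0 n].
Proof.
suff E m : walk m n R l = [seq (m + i, iter i R l)%N | i <- iota 0 n] by rewrite E.
elim: n m l => //= n IHn m l; rewrite addn0 IHn (iotaDl 1 0) -map_comp.
by congr (_ :: _); apply: eq_map => i /=; rewrite addSnnS -iterSr.
Qed.

(* The pairs [(q, l)] such that the coordinate [s] of a product [u * v] is the sum of the
   products of the coordinate [q] of [v] with the sum of the coordinates [p \in l] of [u]. *)
Definition mul_row (A B C : triple -> seq triple) (s : triple) :
    seq (triple * seq triple) :=
  [seq e <- flatten [seq flatten [seq
     [seq ((xi.1, yj.1, zl.1), xi.2) | xi <- walk 0 4 (ext A) yj.2]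
     | yj <- walk 0 8 (ext B) zl.2] | zl <- walk 0 8 (ext C) [:: s]]
   | ~~ nilp e.2].

Section Group.

Variables (k : fieldType) (gT : finGroupType).

Local Notation kG := (group_algebra k gT).

Definition ga (g : gT) : kG := [ffun h => (h == g)%:R].

Lemma gaM g h : ga (g * h)%g = ga g * ga h.
Proof.
apply/ffunP=> u; rewrite !ffunE (bigD1 g) //= !ffunE eqxx mul1r.
rewrite big1 ?addr0 => [|v /negPf nvg]; last by rewrite ffunE nvg mul0r.
by rewrite (can2_eq (mulKVg g) (mulKg g)).
Qed.

Lemma ga1 : ga 1%g = 1. Proof. by []. Qed.

Lemma gaX g n : ga (g ^+ n)%g = ga g ^+ n.
Proof. by elim: n => // n IHn; rewrite expgS exprS gaM IHn. Qed.

Lemma gaE (u : kG) : u = \sum_g u g *: ga g.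
Proof.
apply/ffunP=> h; rewrite sum_ffunE (bigD1 h) //= !ffunE eqxx big1 ?addr0 => [|g].
  by rewrite /GRing.scale /= mulr1.
by rewrite !ffunE eq_sym => /negPf->; rewrite scaler0.
Qed.

Lemma mulr_ga (u : kG) g h : (u * ga g) h = u (h * g^-1)%g.
Proof.
rewrite ffunE (bigD1 (h * g^-1)%g) //= !ffunE invMg invgK -mulgA mulVg mulg1 eqxx mulr1.
rewrite big1 ?addr0 // => v nv; rewrite ffunE; case: eqP => [E | _]; last by rewrite mulr0.
by rewrite -E invMg invgK mulKVg eqxx in nv.
Qed.

Lemma mem_aug (u : kG) : (u \in aug_ideal k gT) = (\sum_g u g == 0).
Proof. exact: mem_aug_ideal. Qed.

Lemma ga_aug g : ga g - 1 \in aug_ideal k gT.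
Proof.
rewrite mem_aug -ga1; under eq_bigr do rewrite !ffunE.
rewrite sumrB (bigD1 g) //= eqxx big1 ?addr0 => [|h /negPf-> //].
by rewrite (bigD1 1%g) //= eqxx big1 ?addr0 ?subrr // => h /negPf->.
Qed.

End Group.

Section XorSum.

Variables (k : fieldType) (char2 : 2%N \in [pchar k]).

Lemma natr_addb (x y : bool) : (x (+) y)%:R = x%:R + y%:R :> k.
Proof. by case: x y => [] [] /=; rewrite ?addr0 ?add0r // (addxx char2). Qed.

Lemma natr_parity (T : Type) (f : T -> bool) (l : seq T) :
  (parity f l)%:R = \sum_(x <- l) (f x)%:R :> k.
Proof. by elim: l => [|x l IHl] /=; rewrite ?big_nil // big_cons natr_addb IHl. Qed.

Variable F : triple -> k.

Lemma sum_toggle s l : \sum_(p <- toggle s l) F p = F s + \sum_(p <- l) F p.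
Proof.
elim: l => [|t l IHl] /=; first by rewrite big_seq1 big_nil addr0.
case: teqP => [->|_]; first by rewrite big_cons addrA (addxx char2) add0r.
by rewrite !big_cons IHl addrCA.
Qed.

Lemma sum_xorl l1 l2 :
  \sum_(p <- xorl l1 l2) F p = \sum_(p <- l1) F p + \sum_(p <- l2) F p.
Proof.
elim: l1 => [|s l1 IHl] /=; first by rewrite big_nil add0r.
by rewrite sum_toggle IHl big_cons addrA.
Qed.

Lemma sum_ext R l : \sum_(p <- ext R l) F p = \sum_(p <- l) \sum_(q <- R p) F q.
Proof.
by elim: l => [|p l IHl] /=; rewrite ?big_nil // sum_xorl IHl big_cons.
Qed.

End XorSum.

Lemma mem_toggle s t l : t \in toggle s l -> (t == s) || (t \in l).
Proof.
elim: l => [|u l IHl] /=; first by rewrite inE => ->.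
case: teqP => [->|_]; first by rewrite inE => ->; rewrite !orbT.
by rewrite !inE => /orP[-> | /IHl/orP[] ->]; rewrite ?orbT.
Qed.

Lemma mem_xorl t l1 l2 : t \in xorl l1 l2 -> (t \in l1) || (t \in l2).
Proof.
elim: l1 => //= s l1 IHl /mem_toggle/orP[/eqP-> | /IHl/orP[] tl].
- by rewrite inE eqxx.
- by rewrite inE tl orbT.
- by rewrite tl orbT.
Qed.

Lemma mem_ext R t l : t \in ext R l -> exists2 p, p \in l & t \in R p.
Proof.
elim: l => //= p l IHl /mem_xorl/orP[tR | /IHl[q lq tR]].
  by exists p; rewrite ?inE ?eqxx.
by exists q; rewrite // inE lq orbT.
Qed.

Lemma bsub1_succ4 i t : (i < 4)%N -> (t < 4)%N ->
  bsub1 i (t.+1 %% 4) = bsub1 i t (+) ((0 < i)%N && bsub1 i.-1 t).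
Proof. by case: i => [|[|[|[|i]]]] //; case: t => [|[|[|[|t]]]]. Qed.

Lemma bsub1_succ8 i t : (i < 8)%N -> (t < 8)%N ->
  bsub1 i (t.+1 %% 8) = bsub1 i t (+) ((0 < i)%N && bsub1 i.-1 t).
Proof.
by case: i => [|[|[|[|[|[|[|[|i]]]]]]]] //; case: t => [|[|[|[|[|[|[|[|t]]]]]]]].
Qed.

Lemma mul_row_deg_gen (A B C : triple -> seq triple) (s : triple) e :
  (forall s t, s \in box -> t \in A s -> (t \in box) && (deg t < deg s)%N) ->
  (forall s t, s \in box -> t \in B s -> (t \in box) && (deg t < deg s)%N) ->
  (forall s t, s \in box -> t \in C s -> (t \in box) && (deg t < deg s)%N) ->
  s \in box -> e \in mul_row A B C s ->
  ~~ nilp e.2 /\ forall p, p \in e.2 -> (p \in box) && (deg p + deg e.1 <= deg s)%N.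
Proof.
move=> AP BP CP s_box; rewrite /mul_row mem_filter => /andP[ne2].
case/flattenP => r1 /mapP[zl]; rewrite walkE => /mapP[l _ ->] -> /flattenP[r2].
move=> /mapP[yj]; rewrite walkE => /mapP[j _ ->] ->.
move=> /mapP[xi]; rewrite walkE => /mapP[i _ ->] E; split=> // {ne2}; rewrite {e}E /= => p.
have step (D : triple -> seq triple) n l0 d :
    (forall s t, s \in box -> t \in D s -> (t \in box) && (deg t < deg s)%N) ->
    (forall q, q \in l0 -> (q \in box) && (deg q + d <= deg s)%N) ->
    forall q, q \in iter n (ext D) l0 -> (q \in box) && (deg q + (d + n) <= deg s)%N.
  move=> RP l0P; elim: n => [|n IHn] q /=; first by rewrite addn0; apply: l0P.
  case/mem_ext => p' /IHn/andP[p'_box le_p'] /(RP _ _ p'_box)/andP[-> lt_q] /=.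
  by apply: leq_trans le_p'; rewrite !addnS -addSn leq_add2r.
have s0 q : q \in [:: s] -> (q \in box) && (deg q + 0 <= deg s)%N.
  by rewrite mem_seq1 => /eqP ->; rewrite s_box addn0 leqnn.
have s3 := step A i _ _ AP (step B j _ _ BP (step C l _ _ CP s0)).
have degE : deg (i, j, l) = (0 + l + j + i)%N by rewrite add0n addnC [(l + j)%N]addnC addnA.
by move/s3; rewrite degE.
Qed.

Lemma mem_iota0 m n : (m < n)%N -> m \in iota 0 n.
Proof. by rewrite mem_iota. Qed.

Lemma sum_box (V : nmodType) (F : triple -> V) :
  \sum_(s <- box) F s =
  \sum_(i <- iota 0 4) \sum_(j <- iota 0 8) \sum_(l <- iota 0 8) F (i, j, l).
Proof. by rewrite /box big_allpairs_dep big_allpairs_dep. Qed.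

Lemma big_row (V : nmodType) (F : triple -> seq triple -> V)
    (A B C : triple -> seq triple) (s : triple) :
  (forall q, F q [::] = 0) ->
  \sum_(e <- mul_row A B C s) F e.1 e.2 =
  \sum_(q <- box) F q (iter q.1.1 (ext A) (iter q.1.2 (ext B) (iter q.2 (ext C) [:: s]))).
Proof.
move=> F0; rewrite sum_box [RHS]exchange_big.
under [RHS]eq_bigr do rewrite exchange_big.
rewrite [RHS]exchange_big; rewrite /mul_row big_filter big_mkcond big_flatten big_map walkE big_map.
apply: eq_bigr => l _; rewrite big_flatten big_map walkE big_map.
apply: eq_bigr => j _; rewrite walkE -map_comp big_map.
by apply: eq_bigr => i _ /=; case: nilP => [->|].
Qed.

Record pbw_index (gT : finGroupType) (a b c : gT) (P : pres)
    (tau : gT -> triple) : Prop := PbwIndex {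
  pbw_ok : tables_ok P (conja_tab P) (conjb_tab P);
  pbw_box h : tau h \in box;
  pbw_1 : tau 1%g = (0, 0, 0)%N;
  pbw_a h : tau (h * a)%g = mula P (tau h);
  pbw_b h : tau (h * b)%g = mulb P (tau h);
  pbw_c h : tau (h * c)%g = mulc (tau h);
  pbw_prod h : h = (a ^+ (tau h).1.1 * b ^+ (tau h).1.2 * c ^+ (tau h).2)%g }.

(** * Coordinates of products and the powers of the augmentation ideal *)

Section PBW.

Variables (k : fieldType) (char2 : 2%N \in [pchar k]).
Variables (gT : finGroupType) (a b c : gT).
Variables (P : pres) (tau : gT -> triple).
Hypothesis pbwP : pbw_index a b c P tau.

Local Notation EA := (conja_tab P).
Local Notation EB := (conjb_tab P).

Let tau_box := pbw_box pbwP.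
Let taua := pbw_a pbwP.
Let taub := pbw_b pbwP.
Let tauc := pbw_c pbwP.
Let tauK := pbw_prod pbwP.

Local Notation kG := (group_algebra k gT).
Local Notation I := (aug_ideal k gT).

(** Expanding each group element as (1 + x)^i (1 + y)^j (1 + z)^l, with binomial coefficients read
    modulo 2, gives this formula for the coordinate at the monomial [s]. It is linear by
    construction; [cf_expand] and [cf_mon] show that it is the coordinate. *)
Definition cf (s : triple) (u : kG) : k := \sum_h u h * (bsub s (tau h))%:R.

Lemma cf_is_linear s : linear (cf s : kG -> k^o).
Proof.
move=> z u v; rewrite /cf scaler_sumr -big_split; apply: eq_bigr => h _ /=.
by rewrite !ffunE mulrDl -scalerAl.
Qed.

HB.instance Definition _ s :=
  GRing.isLinear.Build k kG k^o _ (cf s) (cf_is_linear s).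

Lemma cfD s u v : cf s (u + v) = cf s u + cf s v.
Proof. exact: (linearD (cf s : {linear kG -> k^o})). Qed.

Lemma cfZ s z u : cf s (z *: u) = z * cf s u.
Proof. exact: (linearZ_LR (cf s : {linear kG -> k^o})). Qed.

Lemma cf_ga s h : cf s (ga k h) = (bsub s (tau h))%:R.
Proof.
rewrite /cf (bigD1 h) //= ffunE eqxx mul1r big1 ?addr0 // => g /negPf ng.
by rewrite ffunE ng mul0r.
Qed.

Lemma cf_aug u : cf (0, 0, 0)%N u = \sum_h u h.
Proof. by apply: eq_bigr => h _; rewrite mulr1. Qed.

Lemma cf_mul_ga s u g f : (forall h, tau (h * g)%g = f (tau h)) ->
  cf s (u * (ga k g + 1)) =
  \sum_h u h * (bsub s (f (tau h)) (+) bsub s (tau h))%:R.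
Proof.
move=> tau_g; rewrite mulrDr mulr1 linearD /=.
rewrite /cf (reindex_inj (mulIg g)) -big_split; apply: eq_bigr => h _ /=.
by rewrite mulr_ga mulgK tau_g natr_addb // mulrDr.
Qed.

Lemma sum_cf (l : seq triple) u :
  \sum_(p <- l) cf p u = \sum_h u h * \sum_(p <- l) (bsub p (tau h))%:R.
Proof.
rewrite exchange_big; apply: eq_bigr => h _ /=.
by rewrite mulr_sumr.
Qed.

Lemma mem_plane (t : nat * nat) : (t.1 < 8)%N -> (t.2 < 8)%N -> t \in plane.
Proof.
case: t => j l /= lt_j lt_l; apply/flattenP; exists [seq (j, m) | m <- iota 0 8].
  by apply/mapP; exists j; rewrite ?mem_iota.
by apply/mapP; exists l; rewrite ?mem_iota.
Qed.

Lemma cf_mulx s u : s \in box ->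
  cf s (u * (ga k a + 1)) = \sum_(p <- coefa EA s) cf p u.
Proof.
case: s => [[i j] l]; rewrite mem_box => /and3P[/= lt_i lt_j lt_l].
rewrite (cf_mul_ga _ _ taua) sum_cf; apply: eq_bigr => h _; congr (_ * _).
move: (tau_box h); case: (tau h) => [[ti tj] tl].
rewrite mem_box => /and3P[/= lt_ti lt_tj lt_tl].
rewrite /coefa /= sum_toggle // sum_xorl // natr_addb // addrC; congr (_ + _).
set E := nth _ _ _.
have EP i' : (i' < 4)%N -> \sum_(p <- [seq (i', t.1, t.2) | t <- E])
    (bsub p (ti, tj, tl))%:R =
    (bsub1 i' ti && bsub2 (j, l) (conj_exp P (tj, tl)))%:R :> k.
  move=> lt_i'; rewrite big_map.
  have /and3P[/allP okE _ _] := pbw_ok pbwP.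
  have /allP/= {}okE := okE _ (@mem_plane (j, l) lt_j lt_l).
  have /eqP-> := okE _ (@mem_plane (tj, tl) lt_tj lt_tl).
  rewrite -/E -mulnb natrM natr_parity // mulr_sumr; apply: eq_bigr => t _.
  by rewrite -natrM mulnb.
rewrite EP // [in LHS]/bsub /= bsub1_succ4 //.
rewrite -/(bsub2 (j, l) (conj_exp P (tj, tl))).
case: i lt_i => [|i] lt_i /=; first by rewrite big_nil addr0.
rewrite EP ?(ltnW lt_i) // -natr_addb //; congr (_%:R).
by case: bsub1; case: bsub1; case: bsub2.
Qed.

Lemma cf_muly s u : s \in box ->
  cf s (u * (ga k b + 1)) = \sum_(p <- coefb EB s) cf p u.
Proof.
case: s => [[i j] l]; rewrite mem_box => /and3P[/= lt_i lt_j lt_l].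
rewrite (cf_mul_ga _ _ taub) sum_cf; apply: eq_bigr => h _; congr (_ * _).
move: (tau_box h); case: (tau h) => [[ti tj] tl].
rewrite mem_box => /and3P[/= lt_ti lt_tj lt_tl].
rewrite /coefb /= sum_toggle // sum_xorl // natr_addb // addrC; congr (_ + _).
set E := nth _ _ _.
have EP j' : \sum_(p <- [seq (i, j', m) | m <- E]) (bsub p (ti, tj, tl))%:R =
    [&& bsub1 i ti, bsub1 j' tj & bsub1 l ((rb P * tl) %% 8)]%:R :> k.
  rewrite big_map; have /and3P[_ /allP okE _] := pbw_ok pbwP.
  have /allP/= {}okE := okE l (mem_iota0 lt_l).
  have /eqP-> := okE tl (mem_iota0 lt_tl).
  rewrite -/E andbA -mulnb natrM natr_parity // mulr_sumr.
  by apply: eq_bigr => t _; rewrite -natrM mulnb -andbA.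
rewrite EP [in LHS]/bsub /= bsub1_succ8 //.
case: j lt_j => [|j] lt_j /=; first by rewrite big_nil addr0.
rewrite EP -natr_addb //; congr (_%:R).
by case: (bsub1 i ti); case: (bsub1 j.+1 tj); case: (bsub1 j tj); case: bsub1.
Qed.

Lemma cf_mulz s u : s \in box ->
  cf s (u * (ga k c + 1)) = \sum_(p <- coefc s) cf p u.
Proof.
case: s => [[i j] l]; rewrite mem_box => /and3P[/= lt_i lt_j lt_l].
rewrite (cf_mul_ga _ _ tauc) sum_cf; apply: eq_bigr => h _; congr (_ * _).
move: (tau_box h); case: (tau h) => [[ti tj] tl].
rewrite mem_box => /and3P[/= lt_ti lt_tj lt_tl].
rewrite /coefc /mulc /bsub /= bsub1_succ8 //.
case: l lt_l => [|l] lt_l /=; first by rewrite big_nil addbb.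
rewrite big_seq1 /=.
by case: (bsub1 i ti); case: (bsub1 j tj); case: (bsub1 l.+1 tl); case: (bsub1 l tl).
Qed.

Definition mon (s : triple) : kG :=
  (ga k a + 1) ^+ s.1.1 * (ga k b + 1) ^+ s.1.2 * (ga k c + 1) ^+ s.2.

Lemma ga_addxx (u : kG) : u + u = 0.
Proof. by rewrite -[u]scale1r -scalerDl (addxx char2) scale0r. Qed.

Lemma exp_expand (v : kG) n : (n < 8)%N ->
  v ^+ n = \sum_(i <- iota 0 8) (bsub1 i n)%:R *: (v + 1) ^+ i.
Proof.
set x := v + 1; have -> : v = x + 1 by rewrite /x -addrA ga_addxx addr0.
elim: n => [|n IHn] lt_n.
  by rewrite !big_cons big_nil /= scale1r !scale0r !addr0.
rewrite exprSr {}IHn 1?ltnW // mulrDr mulr1 mulr_suml.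
under eq_bigr do rewrite -scalerAl -exprSr.
have -> : iota 0 8 = index_iota 0 8 by [].
rewrite [X in X + _]big_nat_recr //= [X in _ + X]big_nat_recl //=.
rewrite [RHS]big_nat_recl //= [X in X + _]addrC addrACA.
(* The term that would become the eighth power is absent because n + 1 < 8. *)
have -> : bsub1 7 n = false by case: n lt_n => [|[|[|[|[|[|[|n]]]]]]].
rewrite scale0r add0r; congr (_ + _); rewrite -big_split.
apply: eq_big_nat => i /andP[_ lt_i] /=; rewrite -scalerDl -natr_addb //.
congr (_%:R *: _); by rewrite -(modn_small lt_n) (@bsub1_succ8 i.+1 _ lt_i (ltnW lt_n)) addbC.
Qed.

Lemma exp_expand4 (v : kG) n : (n < 4)%N ->
  v ^+ n = \sum_(i <- iota 0 4) (bsub1 i n)%:R *: (v + 1) ^+ i.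
Proof.
move=> lt_n; rewrite (exp_expand _ (ltn_trans lt_n _)) //.
rewrite -[iota 0 8]/(iota 0 4 ++ iota 4 4) big_cat /= addrC big1_seq ?add0r // => m.
rewrite !inE => /or4P im; suff -> : bsub1 m n = false by rewrite scale0r.
by case: n lt_n im => [|[|[|[|i]]]] // _ [] /eqP->.
Qed.

Lemma scale_and3 (A : algType k) (p q r : bool) (x y z : A) :
  p%:R *: x * (q%:R *: y * (r%:R *: z)) = [&& p, q & r]%:R *: (x * y * z).
Proof.
by case: p q r => [] [] []; rewrite ?scale1r ?scale0r ?mul0r ?mulr0 ?mul0r ?mulrA.
Qed.

Lemma ga_expand h : ga k h = \sum_(s <- box) (bsub s (tau h))%:R *: mon s.
Proof.
rewrite [in LHS](tauK h) !gaM !gaX.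
have := tau_box h; rewrite mem_box; case: (tau h) => [[i j] l] /and3P[/= lt_i lt_j lt_l].
rewrite (exp_expand _ lt_j) (exp_expand _ lt_l) (exp_expand4 _ lt_i) sum_box.
rewrite -mulrA mulr_suml; apply: eq_bigr => m _.
rewrite mulr_suml mulr_sumr; apply: eq_bigr => n _.
rewrite mulr_sumr mulr_sumr; apply: eq_bigr => o _.
exact: scale_and3.
Qed.

Lemma cf_expand u : u = \sum_(s <- box) cf s u *: mon s.
Proof.
rewrite [LHS]gaE; under eq_bigr => h _ do rewrite ga_expand scaler_sumr.
rewrite exchange_big; apply: eq_bigr => s _ /=.
by rewrite scaler_suml; apply: eq_bigr => h _; rewrite scalerA.
Qed.

Local Notation A := (get3 [::] (tab3 (coefa EA))).
Local Notation B := (get3 [::] (tab3 (coefb EB))).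

Lemma coef_box s t : s \in box ->
  [|| t \in A s, t \in B s | t \in coefc s] -> (t \in box) && (deg t < deg s)%N.
Proof.
move=> s_box; have /and3P[_ _ /allP/(_ s s_box)/allP okd] := pbw_ok pbwP.
rewrite !get3_tab3 //.
rewrite mem_box; case/or3P => [tA|tB|].
- by apply: okd; rewrite mem_cat tA.
- by apply: okd; rewrite mem_cat tB orbT.
case: s s_box {okd} => [[i j] [|l]] //.
rewrite mem_box inE => /and3P[/= ? ? ?] /eqP->.
by apply/andP; split; [apply/and3P; split => //=; apply: ltnW | rewrite /deg /= addnS].
Qed.

Lemma iter_ext_box (R : triple -> seq triple) n l :
  (forall s t, s \in box -> t \in R s -> t \in box) ->
  {subset l <= box} -> {subset iter n (ext R) l <= box}.
Proof.
move=> R_box; elim: n => //= n IHn l_box t /mem_ext[p].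
by move=> /IHn-/(_ l_box)/R_box; apply.
Qed.

Lemma cf_mul_iter (R : triple -> seq triple) (x : kG) :
  (forall s t, s \in box -> t \in R s -> t \in box) ->
  (forall s u, s \in box -> cf s (u * x) = \sum_(p <- R s) cf p u) ->
  forall n l u, {subset l <= box} ->
  \sum_(p <- l) cf p (u * x ^+ n) = \sum_(p <- iter n (ext R) l) cf p u.
Proof.
move=> R_box Rx; elim=> [|n IHn] l u l_box; first by rewrite mulr1.
rewrite exprSr mulrA iterS; transitivity (\sum_(s <- l) \sum_(p <- R s) cf p (u * x ^+ n)).
  by apply: eq_big_seq => s /l_box s_box; rewrite -Rx.
rewrite -(sum_ext char2 (fun p => cf p (u * x ^+ n))) IHn -?iterSr //.
exact: (iter_ext_box (n := 1)).
Qed.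

(** The factors are stripped from the right, hence [coefc] acts first and the table of a last. *)
Lemma mul_mon s u q : s \in box ->
  cf s (u * mon q) = \sum_(p <- iter q.1.1 (ext A) (iter q.1.2 (ext B)
                                 (iter q.2 (ext coefc) [:: s]))) cf p u.
Proof.
move=> s_box.
have Abox s' t : s' \in box -> t \in A s' -> t \in box.
  by move=> sb tA; have /andP[] : (t \in box) && (deg t < deg s')%N by apply: coef_box => //; rewrite tA.
have Bbox s' t : s' \in box -> t \in B s' -> t \in box.
  by move=> sb tA; have /andP[] : (t \in box) && (deg t < deg s')%N by apply: coef_box => //; rewrite tA orbT.
have Cbox s' t : s' \in box -> t \in coefc s' -> t \in box.
  by move=> sb tA; have /andP[] : (t \in box) && (deg t < deg s')%N by apply: coef_box => //; rewrite tA !orbT.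
have s1 : {subset [:: s] <= box} by move=> t; rewrite inE => /eqP->.
have s2 := iter_ext_box (n := q.2) Cbox s1.
have s3 := iter_ext_box (n := q.1.2) Bbox s2.
transitivity (\sum_(p <- [:: s])
    cf p (u * (ga k a + 1) ^+ q.1.1 * (ga k b + 1) ^+ q.1.2 * (ga k c + 1) ^+ q.2)).
  by rewrite big_seq1 /mon mulrA mulrA.
rewrite (cf_mul_iter Cbox) //; last exact: cf_mulz.
rewrite (cf_mul_iter Bbox) //; last by move=> s' v sb; rewrite get3_tab3 // cf_muly.
rewrite (cf_mul_iter Abox) // => s' v sb.
by rewrite get3_tab3 // cf_mulx.
Qed.

Lemma cf_mul s u v : s \in box -> cf s (u * v) =
  \sum_(e <- mul_row A B coefc s) cf e.1 v * \sum_(p <- e.2) cf p u.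
Proof.
move=> s_box; rewrite (big_row _ _ _ _ (F := fun q l => cf q v * \sum_(p <- l) cf p u)).
  rewrite {1}(cf_expand v) mulr_sumr linear_sum; apply: eq_bigr => q _.
  by rewrite -scalerAr linearZ /= mul_mon.
by move=> q; rewrite big_nil mulr0.
Qed.

Lemma cf_box1 s : s \in box -> cf s 1 = (s == (0, 0, 0)%N)%:R.
Proof.
rewrite mem_box => /and3P[lt_i lt_j lt_l]; rewrite -ga1 cf_ga (pbw_1 pbwP).
case: s lt_i lt_j lt_l => [[i j] l] /= lt_i lt_j lt_l.
have bsub10 n : (n < 8)%N -> bsub1 n 0 = (n == 0%N).
  by case: n => [|[|[|[|[|[|[|[|]]]]]]]].
by rewrite /bsub /= !bsub10 ?(ltn_trans lt_i) // !xpair_eqE -andbA.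
Qed.

Lemma mul_row_deg s e : s \in box -> e \in mul_row A B coefc s ->
  ~~ nilp e.2 /\ forall p, p \in e.2 -> (p \in box) && (deg p + deg e.1 <= deg s)%N.
Proof.
by apply: mul_row_deg_gen => s' t sb tR; apply: coef_box; rewrite // tR ?orbT.
Qed.

(** A coordinate of u w uses coordinates of u and w whose degrees add up to at most its own. Degree
    0 on the side of w gives the augmentation, which vanishes, so the degree on the side of u drops.
    With [expv_cf], I^m is exactly the span of the monomials of degree at least m. *)
Lemma cf_expv m u s : u \in (I ^+ m)%VS -> s \in box -> (deg s < m)%N -> cf s u = 0.
Proof.
elim: m u s => // m IHm u s; rewrite expvSr => Iu s_box; rewrite ltnS => le_s.
suff: u \in lker (linfun (cf s : {linear kG -> k^o})).
  by rewrite memv_ker lfunE => /eqP.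
apply: subvP Iu; apply/prodvP => v w Iv Iw; rewrite memv_ker lfunE /= cf_mul //; apply/eqP.
rewrite big_seq big1 // => e s_e; have [_ dege] := mul_row_deg s_box s_e.
have [e0|e_gt0] := posnP (deg e.1).
  have {e0} -> : e.1 = (0, 0, 0)%N by case: (e.1) e0 => [[[|?] [|?]] [|?]].
  by rewrite cf_aug; move: Iw; rewrite mem_aug_ideal => /eqP->; rewrite mul0r.
rewrite big_seq big1 ?mulr0 // => p /dege/andP[p_box le_p]; apply: IHm => //.
by apply: leq_trans le_s; apply: leq_trans le_p; rewrite -addn1 leq_add2l.
Qed.

Lemma expv_memX m x : x \in I -> x ^+ m \in (I ^+ m)%VS.
Proof.
move=> Ix; elim: m => [|m IHm]; first by rewrite expr0 expv0 memv_line.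
by rewrite exprSr expvSr memv_mul.
Qed.

Lemma sub_expv m n : (0 < m)%N -> (m <= n)%N -> (I ^+ n <= I ^+ m)%VS.
Proof.
move=> m_gt0 /subnK <-; elim: (n - m)%N => [|d IHd] //.
by apply: subv_trans IHd; apply: sub_expv_aug; rewrite addn_gt0 m_gt0 orbT.
Qed.

Lemma ga_aug1 g : ga k g + 1 \in I.
Proof.
have -> : ga k g + 1 = ga k g - 1 by rewrite -[in RHS](addr0 (ga k g)) -(ga_addxx 1) addrA addrK.
exact: ga_aug.
Qed.

Lemma mon_expv s : mon s \in (I ^+ deg s)%VS.
Proof. by rewrite /deg !expvD !memv_mul ?expv_memX ?ga_aug1. Qed.

Lemma expv_cf m u : (0 < m)%N ->
  (forall s, s \in box -> (deg s < m)%N -> cf s u = 0) -> u \in (I ^+ m)%VS.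
Proof.
move=> m_gt0 u0; rewrite (cf_expand u) big_seq memv_suml // => s s_box.
have [lt_s|le_s] := ltnP (deg s) m; first by rewrite u0 // scale0r mem0v.
by rewrite memvZ // (subvP (sub_expv m_gt0 le_s)) ?mon_expv.
Qed.

End PBW.

End Coordinates.

(** * The presentations *)

Section Presentations.

Local Open Scope group_scope.

Definition rels (P : pres) (gT : finGroupType) (a b c : gT) : Prop :=
  [/\ a ^+ 4 = 1, b ^+ 8 = 1 & c ^+ 8 = 1] /\
  [/\ b ^ a = b ^+ p0 P * c ^+ p1 P, c ^ a = b ^+ q0 P * c ^+ q1 P & c ^ b = c ^+ rb P].

(** The two halves of [\isog Grp]: the generators bound the order from above, through normal forms,
    and the universal property bounds it from below, through a model. *)
Definition presents (P : pres) (gT : finGroupType) : Prop :=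
  (exists a b c : gT, rels P a b c /\ <<[set a; b; c]>> = [set: gT]) /\
  forall (rT : finGroupType) (a b c : rT),
    rels P a b c -> <<[set a; b; c]>> \homg [set: gT].

Definition pres_of (i : nat) : pres :=
  if i == 1272%N then Pres 1 0 0 3 5 else if i == 1273%N then Pres 1 0 0 7 5
  else if i == 1274%N then Pres 5 0 0 3 5 else if i == 1275%N then Pres 5 0 0 7 5
  else if i == 1778%N then Pres 1 2 2 1 1 else if i == 1779%N then Pres 1 6 2 1 1
  else if i == 1780%N then Pres 1 2 2 5 1 else Pres 1 6 2 5 1.

Definition indices : seq nat := [:: 1272; 1273; 1274; 1275; 1778; 1779; 1780; 1781].

Lemma gen3E (gT : finGroupType) (a b c : gT) :
  <[a]> <*> <[b]> <*> <[c]> = <<[set a; b; c]>>.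
Proof.
rewrite -[RHS]/(([set a] :|: [set b]) <*> [set c]) -[RHS]joing_idl -[RHS]joing_idr.
by rewrite -[<<_ :|: _>>]/([set a] <*> [set b]) -(joing_idl [set a]) -(joing_idr _ [set b]).
Qed.

Lemma isSG256_presents i (gT : finGroupType) :
  i \in indices -> isSG256 i [set: gT] -> presents (pres_of i) gT.
Proof.
by rewrite !inE => /or4P[|||/or4P[|||/orP[|]]] => /eqP->; rewrite /isSG256 /= => isoG; (split;
  [ have /existsP[[[a b] c] /= /eqP[defG a4 b8 c8 ba ca cb]] := isoGrp_hom isoG;
    exists a, b, c; rewrite -gen3E defG; split=> //; split; split=> //;
    rewrite ?ba ?ca ?cb ?expg0 ?expg1 ?mulg1 ?mul1g
  | move=> rT a b c [[a4 b8 c8] [/= ba ca cb]];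
    move: ba ca cb; rewrite ?expg0 ?expg1 ?mulg1 ?mul1g => ba ca cb;
    rewrite isoG; apply/existsP; exists (a, b, c);
    rewrite /= !xpair_eqE /= -gen3E a4 b8 c8 ba ca cb !eqxx ]).
Qed.

End Presentations.

(** * Normal forms in a monoid modulo a congruence *)

Section NormalForms.

Local Open Scope nat_scope.

Section NormalForm.

Variables (T : Type) (op : T -> T -> T) (e : T) (eqv : T -> T -> Prop).
Hypotheses (opA : associative op) (op1x : left_id e op) (opx1 : right_id e op).
Hypothesis eqv_equiv : Equivalence eqv.
Hypothesis op_proper : Proper (eqv ==> eqv ==> eqv) op.

#[local] Existing Instance eqv_equiv.
#[local] Existing Instance op_proper.

Local Notation "x * y" := (op x y).
Local Notation "x ~ y" := (eqv x y) (at level 70).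

Let eqvxx x : x ~ x. Proof. by reflexivity. Qed.
#[local] Hint Resolve eqvxx : core.

Definition pw (x : T) (n : nat) : T := iter n (op x) e.

Lemma pwS x n : pw x n.+1 = x * pw x n. Proof. by []. Qed.

Lemma pwD x m n : pw x (m + n) = pw x m * pw x n.
Proof. by elim: m => [|m IHm]; rewrite ?op1x // addSn !pwS IHm opA. Qed.

Lemma pw1 x : pw x 1 = x. Proof. by rewrite pwS opx1. Qed.

Lemma pwSr x n : pw x n.+1 = pw x n * x.
Proof. by rewrite -addn1 pwD pw1. Qed.

Lemma pwM x m n : pw x (m * n)%N = pw (pw x m) n.
Proof. by elim: n => [|n IHn]; rewrite ?muln0 // mulnS pwD IHn. Qed.

Lemma pw_mod x m n : pw x m ~ e -> pw x n ~ pw x (n %% m).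
Proof.
move=> xm; rewrite {1}(divn_eq n m) mulnC pwD pwM.
suff -> : pw (pw x m) (n %/ m) ~ e by rewrite op1x.
by elim: (n %/ m) => [|d IHd]; rewrite ?pwS ?IHd ?opx1.
Qed.

Lemma pw_swap x y z n : x * y ~ y * z -> pw x n * y ~ y * pw z n.
Proof.
move=> xy; elim: n => [|n IHn]; first by rewrite opx1 op1x.
by rewrite pwSr -opA xy opA IHn -opA -pwSr.
Qed.

Lemma pw_comm x y m n : x * y ~ y * x -> pw x m * pw y n ~ pw y n * pw x m.
Proof.
by move=> xy; apply: pw_swap; symmetry; apply: pw_swap; symmetry.
Qed.

Variables (P : pres) (a b c : T).

(** Conjugations are written without inverses and equality is a congruence, so that the same
    rewriting serves in the group, with equality, and in the group algebra modulo I^m. The last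
    field makes (b^i c^j)^n = b^(i n) c^(j n) available for the conjugates of b and c. *)
Record nf_rules : Prop := NfRules {
  nf_a : pw a 4 ~ e; nf_b : pw b 8 ~ e; nf_c : pw c 8 ~ e;
  nf_ba : b * a ~ a * (pw b (p0 P) * pw c (p1 P));
  nf_ca : c * a ~ a * (pw b (q0 P) * pw c (q1 P));
  nf_cb : c * b ~ b * pw c (rb P);
  nf_split : rb P = 1 \/ p1 P = 0 /\ q0 P = 0 }.

Hypothesis rules : nf_rules.

Definition nf (t : triple) : T := pw a t.1.1 * pw b t.1.2 * pw c t.2.

Lemma nf_mulc t : nf t * c ~ nf (mulc t).
Proof. by rewrite /nf /mulc /= -opA -pwSr (pw_mod t.2.+1 (nf_c rules)). Qed.

Lemma nf_mulb t : nf t * b ~ nf (mulb P t).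
Proof.
rewrite /nf /mulb /= -opA (pw_swap _ (nf_cb rules)) opA -pwM.
rewrite -(opA _ (pw b _) b) -pwSr.
by rewrite (pw_mod t.1.2.+1 (nf_b rules)) (pw_mod (_ * _)%N (nf_c rules)).
Qed.

Lemma pw_bc i j n :
  rb P = 1 \/ i = 0 \/ j = 0 ->
  pw (pw b i * pw c j) n ~ pw b (i * n)%N * pw c (j * n)%N.
Proof.
case=> [r1|[]->]; rewrite ?mul0n ?op1x ?opx1; last first.
- by rewrite pwM.
- by rewrite pwM.
have cb : c * b ~ b * c by rewrite (nf_cb rules) r1 pw1.
elim: n => [|n IHn]; first by rewrite !muln0 op1x.
rewrite pwS IHn !mulnS !pwD !opA -(opA _ (pw c j)) (pw_comm _ _ cb).
by rewrite !opA.
Qed.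

Lemma nf_mula t : nf t * a ~ nf (mula P t).
Proof.
rewrite /nf /mula /conj_exp /= -opA (pw_swap _ (nf_ca rules)) opA.
rewrite -(opA _ (pw b _) a) (pw_swap _ (nf_ba rules)) opA -pwSr.
rewrite (pw_bc (i := p0 P)); last by case: (nf_split rules) => [|[]]; tauto.
rewrite (pw_bc (i := q0 P)); last by case: (nf_split rules) => [|[]]; tauto.
rewrite (pw_mod t.1.1.+1 (nf_a rules)) -!(pw_mod _ (nf_b rules)) -!(pw_mod _ (nf_c rules)).
rewrite !pwD !opA -(opA _ (pw c _) (pw b _)).
suff -> : pw c (p1 P * t.1.2)%N * pw b (q0 P * t.2)%N ~
          pw b (q0 P * t.2)%N * pw c (p1 P * t.1.2)%N by rewrite !opA.
case: (nf_split rules) => [r1|[-> ->]]; last by rewrite !mul0n.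
by apply: pw_comm; rewrite (nf_cb rules) r1 pw1.
Qed.

End NormalForm.

End NormalForms.

(** * A permutation model, and uniqueness of normal forms *)

Section Models.

Local Open Scope group_scope.

Definition word3 (P : pres) (i j l : nat) (t : triple) : triple :=
  iter l mulc (iter j (mulb P) (iter i (mula P) t)).

(** Permutations compose from left to right, so the word b a acts as [mulb] followed by [mula]. The
    tests on [box] say that the three maps satisfy the relations and that (0, 0, 0) reaches every
    triple: this is the right regular representation on normal forms. *)
Definition pres_ok (P : pres) : bool :=
  [&& (rb P == 1%N) || (p1 P == 0%N) && (q0 P == 0%N),
      all (fun t => [&& inbox (mula P t), inbox (mulb P t), inbox (mulc t),
        teq (word3 P 4 0 0 t) t, teq (word3 P 0 8 0 t) t, teq (word3 P 0 0 8 t) t,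
        teq (mula P (mulb P t)) (word3 P 0 (p0 P) (p1 P) (mula P t)),
        teq (mula P (mulc t)) (word3 P 0 (q0 P) (q1 P) (mula P t)),
        teq (mulb P (mulc t)) (word3 P 0 0 (rb P) (mulb P t)) &
        teq (word3 P t.1.1 t.1.2 t.2 (0, 0, 0)%N) t]) box &
      tables_ok P (conja_tab P) (conjb_tab P)].

Lemma pw_expg (gT : finGroupType) (x : gT) n : pw mulg 1 x n = x ^+ n.
Proof. by elim: n => // n IHn; rewrite expgS -IHn. Qed.

Lemma rels_nf (P : pres) (gT : finGroupType) (a b c : gT) :
  pres_ok P -> rels P a b c -> nf_rules mulg 1 eq P a b c.
Proof.
move=> /and3P[splitP _ _] [[a4 b8 c8] [ba ca cb]].
have mul_conj (x y z : gT) : x ^ y = z -> x * y = y * z by rewrite conjgC => ->.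
split; rewrite ?pw_expg //; try by apply: mul_conj.
by case/orP: splitP => [/eqP|/andP[/eqP ? /eqP ?]]; [left | right].
Qed.

Section Model.

Variable P : pres.
Hypothesis P_ok : pres_ok P.

Local Notation S := (seq_sub box).

Lemma box_ok t : t \in box ->
  [/\ mula P t \in box, mulb P t \in box & mulc t \in box] /\
  [/\ word3 P 4 0 0 t = t, word3 P 0 8 0 t = t & word3 P 0 0 8 t = t] /\
  [/\ mula P (mulb P t) = word3 P 0 (p0 P) (p1 P) (mula P t),
        mula P (mulc t) = word3 P 0 (q0 P) (q1 P) (mula P t),
        mulb P (mulc t) = word3 P 0 0 (rb P) (mulb P t) &
        word3 P t.1.1 t.1.2 t.2 (0, 0, 0)%N = t].
Proof.
case/and3P: P_ok => _ /allP okP _ /okP; rewrite !mem_box.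
case/and5P => -> -> -> /teqP ? /and5P[/teqP ? /teqP ? /teqP ? /teqP ?].
by case/andP => /teqP ? /teqP ?.
Qed.

Lemma mula_box t : t \in box -> mula P t \in box. Proof. by case/box_ok => -[]. Qed.
Lemma mulb_box t : t \in box -> mulb P t \in box. Proof. by case/box_ok => -[]. Qed.
Lemma mulc_box t : t \in box -> mulc t \in box. Proof. by case/box_ok => -[]. Qed.

Definition lift_box (f : triple -> triple) (fP : forall t, t \in box -> f t \in box)
  (s : S) : S := SeqSub (fP _ (ssvalP s)).

Lemma lift_box_inj f fP n :
  (forall t, t \in box -> iter n.+1 f t = t) -> injective (@lift_box f fP).
Proof.
move=> fK s t /(congr1 val)/= E; apply: val_inj => /=.
by rewrite -[ssval s](fK _ (ssvalP s)) -[ssval t](fK _ (ssvalP t)) !iterSr E.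
Qed.

Let mulaK t : t \in box -> iter 4 (mula P) t = t. Proof. by case/box_ok => _ [[]]. Qed.
Let mulbK t : t \in box -> iter 8 (mulb P) t = t. Proof. by case/box_ok => _ [[]]. Qed.
Let mulcK t : t \in box -> iter 8 mulc t = t. Proof. by case/box_ok => _ [[]]. Qed.

Let pa : {perm S} := perm (@lift_box_inj _ mula_box 3 mulaK).
Let pb : {perm S} := perm (@lift_box_inj _ mulb_box 7 mulbK).
Let pc : {perm S} := perm (@lift_box_inj _ mulc_box 7 mulcK).

Lemma val_word i j l s : val ((pa ^+ i * pb ^+ j * pc ^+ l) s) = word3 P i j l (val s).
Proof.
have E f fP n (f_inj : injective (@lift_box f fP)) t :
    val ((perm f_inj ^+ n) t) = iter n f (val t).
  by rewrite permX; elim: n => //= n <-; rewrite permE.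
by rewrite !permM /word3 !E.
Qed.

Lemma model_rels : rels P pa pb pc.
Proof.
have [va vb vc] : [/\ forall s, val (pa s) = mula P (val s),
    forall s, val (pb s) = mulb P (val s) & forall s, val (pc s) = mulc (val s)].
  by split=> s; rewrite permE.
have conjP (x y z : {perm S}) : (forall s, val ((x * y) s) = val ((y * z) s)) -> x ^ y = z.
  move=> xy; rewrite conjgE; apply: (mulgI y); rewrite mulKVg.
  by apply/permP => s; apply: val_inj; rewrite xy.
split; split.
- apply/permP => s; apply: val_inj; have := val_word 4 0 0 s; rewrite !mulg1 => ->.
  by rewrite perm1; case: (box_ok (ssvalP s)) => _ [[]].
- apply/permP => s; apply: val_inj; have := val_word 0 8 0 s; rewrite mul1g mulg1 => ->.
  by rewrite perm1; case: (box_ok (ssvalP s)) => _ [[]].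
- apply/permP => s; apply: val_inj; have := val_word 0 0 8 s; rewrite !mul1g => ->.
  by rewrite perm1; case: (box_ok (ssvalP s)) => _ [[]].
- apply: conjP => s; rewrite [in RHS]permM permM va vb.
  have := val_word 0 (p0 P) (p1 P) (pa s); rewrite mul1g => ->.
  by rewrite va; case: (box_ok (ssvalP s)) => _ [_ []].
- apply: conjP => s; rewrite [in RHS]permM permM va vc.
  have := val_word 0 (q0 P) (q1 P) (pa s); rewrite mul1g => ->.
  by rewrite va; case: (box_ok (ssvalP s)) => _ [_ []].
- apply: conjP => s; rewrite [in RHS]permM permM vb vc.
  have := val_word 0 0 (rb P) (pb s); rewrite !mul1g => ->.
  by rewrite vb; case: (box_ok (ssvalP s)) => _ [_ []].
Qed.

Lemma card_box : #|{: S}| = 256.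
Proof. by rewrite card_seq_sub. Qed.

Lemma model_card : 256 <= #|<<[set pa; pb; pc]>>|.
Proof.
have t0 : (0, 0, 0)%N \in box by [].
have /subset_leq_card: [set: S] \subset [set (x : {perm S}) (SeqSub t0) | x in <<[set pa; pb; pc]>>].
  apply/subsetP => s _; apply/imsetP; exists (pa ^+ (val s).1.1 * pb ^+ (val s).1.2 * pc ^+ (val s).2).
    by rewrite !groupM ?groupX ?mem_gen ?inE ?eqxx ?orbT.
  by apply: val_inj; rewrite val_word /=; case: (box_ok (ssvalP s)) => _ [_ []].
by rewrite cardsT card_box => /leq_trans; apply; apply: leq_imset_card.
Qed.

Variable gT : finGroupType.
Hypothesis gTP : presents P gT.

Lemma presents_card : 256 <= #|gT|.
Proof.
rewrite -cardsT; apply: leq_trans model_card _.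
by apply: leq_homg; apply: gTP.2 model_rels.
Qed.

(** Normal forms exhaust the group because right multiplication by a generator preserves them; there
    are at most 256 of them, and the model shows that the group has at least 256 elements, so each
    element has exactly one. *)
Lemma presents_index : exists (a b c : gT) (tau : gT -> triple),
  [/\ rels P a b c, <<[set a; b; c]>> = [set: gT] & pbw_index a b c P tau].
Proof.
have [a [b [c [abcP gen_abc]]]] := gTP.1.
have nfP := rels_nf P_ok abcP.
pose nfg (s : S) : gT := nf mulg 1 a b c (val s).
have nf1 : nf mulg 1 a b c (0, 0, 0)%N = 1 by rewrite /nf /= !mulg1.
have proper : Morphisms.Proper (Morphisms.respectful eq (Morphisms.respectful eq eq)) (@mulg gT).
  by move=> x _ <- y _ <-.
have na t : nf mulg 1 a b c t * a = nf mulg 1 a b c (mula P t).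
  exact: (nf_mula (@mulgA gT) (@mul1g gT) (@mulg1 gT) _ proper nfP).
have nb t : nf mulg 1 a b c t * b = nf mulg 1 a b c (mulb P t).
  exact: (nf_mulb (@mulgA gT) (@mul1g gT) (@mulg1 gT) _ proper nfP).
have nc t : nf mulg 1 a b c t * c = nf mulg 1 a b c (mulc t).
  exact: (nf_mulc (@mulgA gT) (@mul1g gT) (@mulg1 gT) _ proper nfP).
have nfg_surj g : exists s, nfg s == g.
  pose N := [set nfg s | s : S].
  (* The elements that preserve the set of normal forms on the right form a subgroup. It contains
     the generators, and 1 is a normal form. *)
  have Ngr : group_set [set h | [forall x in N, x * h \in N]].
    apply/group_setP; split=> [|x y]; first by rewrite inE; apply/forall_inP => x; rewrite mulg1.
    rewrite !inE => /forall_inP xN /forall_inP yN; apply/forall_inP => z zN.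
    by rewrite mulgA yN ?xN.
  have : g \in Group Ngr.
    suff /subsetP : [set: gT] \subset Group Ngr by apply; rewrite inE.
    rewrite -gen_abc gen_subG; apply/subsetP => x.
    rewrite !inE -orbA => /or3P[] /eqP->; apply/forall_inP => _ /imsetP[s _ ->].
    - apply/imsetP; exists (lift_box mula_box s) => //; exact: na.
    - apply/imsetP; exists (lift_box mulb_box s) => //; exact: nb.
    - apply/imsetP; exists (lift_box mulc_box s) => //; exact: nc.
  rewrite inE => /forall_inP/(_ 1); rewrite mul1g => gN.
  have t0 : (0, 0, 0)%N \in box by [].
  have /imsetP[s _ ->] : g \in N by apply: gN; apply/imsetP; exists (SeqSub t0).
  by exists s.
pose tau0 g := xchoose (nfg_surj g).
have tau0K g : nfg (tau0 g) = g by apply/eqP/(xchooseP (nfg_surj g)).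
(* [tau0] is injective from a set of at least 256 elements into one of 256, hence bijective, and its
   left inverse is two-sided. *)
have nfgK : cancel nfg tau0.
  have tau_bij : bijective tau0.
    by apply: inj_card_bij; [exact: can_inj tau0K | rewrite card_box presents_card].
  exact/(bij_can_sym tau_bij).
have step x f (f_box : forall t, t \in box -> f t \in box) h :
    (forall t, nf mulg 1 a b c t * x = nf mulg 1 a b c (f t)) ->
    val (tau0 (h * x)) = f (val (tau0 h)).
  move=> nx; rewrite -{1}[h]tau0K [nfg _ * x]nx.
  by rewrite -[nf _ _ _ _ _ _]/(nfg (lift_box f_box (tau0 h))) nfgK.
exists a, b, c, (val \o tau0); split=> //; split.
- by case/and3P: P_ok.
- by move=> h; apply: ssvalP.
- have t0 : (0, 0, 0)%N \in box by [].
  by rewrite /= -nf1 -[nf _ _ _ _ _ _]/(nfg (SeqSub t0)) nfgK.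
- by move=> h; apply: step mula_box _ na.
- by move=> h; apply: step mulb_box _ nb.
- by move=> h; apply: step mulc_box _ nc.
by move=> h; rewrite -{1}[h]tau0K -!pw_expg.
Qed.

End Model.

Lemma indices_ok i : i \in indices -> pres_ok (pres_of i).
Proof.
move=> ii; suff /allP/(_ i ii) : all (fun i => pres_ok (pres_of i)) indices by [].
by vm_cast_no_check (erefl true).
Qed.

End Models.

(** * Isomorphisms of the quotients *)

Section Quotients.

Local Open Scope ring_scope.
Local Open Scope quotient_scope.

Lemma mul_sub1 (R : nzRingType) (x y : R) :
  x * y - 1 = (x - 1) * (y - 1) + ((x - 1) + (y - 1)).
Proof.
rewrite mulrBl mulrBr !mul1r mulr1 [X in _ = _ + X]addrC.
by rewrite [RHS]addrA subrK addrA subrK.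
Qed.

Section Congruence.

Variables (k : fieldType) (gT : finGroupType) (m : nat).
Hypothesis m_gt0 : (0 < m)%N.

Local Notation kG := (group_algebra k gT).
Local Notation I := (aug_ideal k gT).

Lemma aug_idealMr (u v : kG) : u \in I -> u * v \in I.
Proof.
rewrite !mem_aug_ideal => /eqP u0.
by rewrite -/(augmentation _) augmentationM /augmentation u0 mul0r.
Qed.

Lemma expv_mull n (u v : kG) : (0 < n)%N -> v \in (I ^+ n)%VS -> u * v \in (I ^+ n)%VS.
Proof.
case: n => // n _; rewrite expvSl => v_in.
suff: v \in (amull u @^-1: (I * I ^+ n))%VS by rewrite -memv_preim lfunE.
apply: subvP v_in; apply/prodvP => x y Ix Iy; rewrite -memv_preim lfunE /= mulrA.
by rewrite memv_mul // aug_idealMl.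
Qed.

Lemma expv_mulr n (u v : kG) : (0 < n)%N -> u \in (I ^+ n)%VS -> u * v \in (I ^+ n)%VS.
Proof.
case: n => // n _; rewrite expvSr => u_in.
suff: u \in (amulr v @^-1: (I ^+ n * I))%VS by rewrite -memv_preim lfunE.
apply: subvP u_in; apply/prodvP => x y Ix Iy; rewrite -memv_preim lfunE /= -mulrA.
by rewrite memv_mul // aug_idealMr.
Qed.

Definition eqm (u v : kG) : Prop := u - v \in (I ^+ m)%VS.

Lemma eqm_refl u : eqm u u. Proof. by rewrite /eqm subrr mem0v. Qed.

#[global] Instance eqm_equiv : Equivalence eqm.
Proof.
split=> [u | u v | u v w]; first exact: eqm_refl.
  by rewrite /eqm => uv; rewrite -opprB memvN.
by rewrite /eqm => uv vw; rewrite -(subrK v u) -addrA memvD.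
Qed.

#[global] Instance eqm_mul : Proper (eqm ==> eqm ==> eqm) *%R.
Proof.
move=> u u' uu' v v' vv'; rewrite /eqm -(subrK (u' * v) (u * v)) -addrA -mulrBl -mulrBr.
by apply: memvD; [apply: expv_mulr | apply: expv_mull].
Qed.

#[global] Instance eqm_add : Proper (eqm ==> eqm ==> eqm) +%R.
Proof.
by move=> u u' uu' v v' vv'; rewrite /eqm opprD addrACA; apply: memvD.
Qed.

End Congruence.

Section Quotient.

Variables (k : fieldType) (m : nat).
Hypothesis m_gt0 : (0 < m)%N.

Section Pi.

Variable gT : finGroupType.

Local Notation I := (aug_ideal k gT).
Local Notation Q := (aug_quot k gT m).

Definition pia (u : subvs_of I) : Q := \pi_Q u.

Lemma pia_is_linear : linear pia.
Proof. by move=> z u v; rewrite /pia pi_augD pi_augZ. Qed.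

HB.instance Definition _ := GRing.isLinear.Build k _ _ _ pia pia_is_linear.

Lemma pia_eq u v : (pia u == pia v) = (vsval u - vsval v \in (I ^+ m)%VS).
Proof. exact: aug_quotE. Qed.

Lemma pia_repr (x : Q) : pia (repr x) = x. Proof. exact: reprK. Qed.

Lemma piaM u v : pia (aug_mul u v) = aug_quot_mul (pia u) (pia v).
Proof. exact: pi_augM. Qed.

End Pi.

Lemma aug_quot_isog_sym (gT hT : finGroupType) :
  aug_quot_isog k gT hT m -> aug_quot_isog k hT gT m.
Proof.
case=> f [g fK gK] fM.
pose g' : {linear _ -> _} := HB.pack g (GRing.isLinear.Build k _ _ _ g (can2_linear fK gK)).
exists g'; first by exists f.
by move=> x y /=; rewrite -{1}[x]gK -{1}[y]gK -fM fK.
Qed.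

Variables gT hT : finGroupType.

Local Notation kG := (group_algebra k gT).
Local Notation kH := (group_algebra k hT).
Local Notation IG := (aug_ideal k gT).
Local Notation IH := (aug_ideal k hT).

(** A map given on normal forms is multiplicative only modulo I^m. It is kept as a linear map of the
    full group algebras and descends to the quotients here. *)
Lemma aug_quot_isogI (phi : {linear kG -> kH}) :
  (forall u, u \in IG -> phi u \in IH) ->
  (forall u, u \in (IG ^+ m)%VS -> phi u \in (IH ^+ m)%VS) ->
  (forall u v, eqm m (phi (u * v)) (phi u * phi v)) ->
  (forall u, u \in IG -> phi u \in (IH ^+ m)%VS -> u \in (IG ^+ m)%VS) ->
  (forall w, w \in IH -> exists2 u, u \in IG & eqm m w (phi u)) ->
  aug_quot_isog k gT hT m.
Proof.
move=> phiI phiIm phiM phi_inj phi_surj.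
pose f0 (u : subvs_of IG) : subvs_of IH := vsproj IH (phi (vsval u)).
have f0E u : vsval (f0 u) = phi (vsval u) by rewrite vsprojK // phiI // subvsP.
pose f (x : aug_quot k gT m) := pia (f0 (repr x)).
have f_pia u : f (pia u) = pia (f0 u).
  apply/eqP; rewrite pia_eq !f0E -linearB phiIm //.
  by rewrite -pia_eq pia_repr.
have f_lin : linear f.
  move=> z x y; rewrite -[x]pia_repr -[y]pia_repr -linearP !f_pia -linearP; congr pia.
  by apply: subvs_inj; rewrite f0E !linearP /= !f0E.
pose F : {linear _ -> _} := HB.pack f (GRing.isLinear.Build k _ _ _ f f_lin).
have f_surj y : exists u, f (pia u) == y.
  rewrite -[y]pia_repr; have [u Iu phi_u] := phi_surj _ (subvsP (repr y)).
  exists (vsproj IG u); rewrite f_pia eq_sym pia_eq f0E vsprojK //.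
exists F; last first.
  move=> x y; rewrite -[x]pia_repr -[y]pia_repr -piaM /= !f_pia -piaM; apply/eqP.
  by rewrite pia_eq f0E !aug_mulE // !f0E; apply: phiM.
pose g y := pia (xchoose (f_surj y)).
have gK : cancel g f by move=> y; apply/eqP/(xchooseP (f_surj y)).
exists g => //; apply: inj_can_sym gK _ => x y /eqP; rewrite -[x]pia_repr -[y]pia_repr.
rewrite !f_pia !pia_eq !f0E => xy; apply/eqP; rewrite pia_eq.
by apply: phi_inj; rewrite ?memvB ?subvsP // linearB.
Qed.

Definition sub1 (g : gT) : subvs_of IG := vsproj IG (ga k g - 1).

Lemma sub1E g : vsval (sub1 g) = ga k g - 1.
Proof. by rewrite vsprojK // ga_aug. Qed.

Lemma sub1_sum (u : subvs_of IG) : u = \sum_g (vsval u g : k) *: sub1 g.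
Proof.
apply: subvs_inj; rewrite linear_sum /=.
under eq_bigr => g _ do rewrite sub1E scalerBr.
rewrite sumrB -gaE -scaler_suml.
by have := subvsP u; rewrite mem_aug_ideal => /eqP->; rewrite scale0r subr0.
Qed.

(** A g is 1 plus a representative of the image of g - 1. The last clause says that the linear parts
    at a generating set span I/I^2. It follows from surjectivity, because the g - 1 span the
    augmentation ideal. *)
Lemma aug_quot_lift : (1 < m)%N -> aug_quot_isog k gT hT m ->
  exists A : gT -> kH,
  [/\ forall g, A g - 1 \in IH, eqm m (A 1%g) 1, forall g h, eqm m (A (g * h)%g) (A g * A h) &
    forall (L : {linear kH -> k^o}) (S : {set gT}), <<S>>%g = [set: gT] ->
      (forall u, u \in (IH ^+ 2)%VS -> L u = 0) ->
      (forall g, g \in S -> L (A g - 1) = 0) -> forall w, w \in IH -> L w = 0].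
Proof.
move=> m_gt1 [f f_bij fM].
pose X g := repr (f (pia (sub1 g))).
have piaX g : pia (X g) = f (pia (sub1 g)) by rewrite pia_repr.
pose A g : kH := vsval (X g) + 1.
have A_I g : A g - 1 \in IH by rewrite addrK subvsP.
have A1 : eqm m (A 1%g) 1.
  have sub11 : sub1 1%g = 0 by apply: subvs_inj; rewrite sub1E ga1 subrr.
  rewrite /eqm addrK; have := piaX 1%g; rewrite sub11 !linear0 -(linear0 (pia (gT := hT))) => /eqP.
  by rewrite pia_eq subr0.
have AM g h : eqm m (A (g * h)%g) (A g * A h).
  have sub1M : sub1 (g * h)%g = aug_mul (sub1 g) (sub1 h) + (sub1 g + sub1 h).
    by apply: subvs_inj; rewrite !linearD /= aug_mulE !sub1E gaM mul_sub1.
  have /eqP : pia (X (g * h)%g) = pia (aug_mul (X g) (X h) + (X g + X h)).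
    by rewrite piaX sub1M !linearD /= !piaM fM !piaX.
  rewrite pia_eq !linearD /= aug_mulE /eqm => X_in.
  suff -> : A (g * h)%g - A g * A h =
      vsval (X (g * h)%g) + (- (vsval (X g) * vsval (X h)) + (- vsval (X g) - vsval (X h))).
    exact: X_in.
  rewrite /A mulrDl mulrDr mul1r mulr1 -!opprD -!addrA; congr (_ + _).
  by rewrite !addrA opprD addrCA subrr addr0.
exists A; split=> // L S genS L2 LS w Iw.
have LA g : L (A g - 1) = 0.
  have Lm u v : eqm m u v -> L (u - 1) = L (v - 1).
    move=> uv; apply/eqP; rewrite -subr_eq0 -linearB /= opprB addrA subrK; apply/eqP/L2.
    by apply: subvP uv; apply: sub_expv.
  (* (A x - 1)(A y - 1) lies in I^2, where L vanishes, so L (A g - 1) is additive in g and its zeros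
     form a subgroup. *)
  have Ngr : group_set [set h | L (A h - 1) == 0].
    apply/group_setP; split=> [|x y]; first by rewrite inE (Lm _ _ A1) subrr linear0.
    rewrite !inE => /eqP Lx /eqP Ly; rewrite (Lm _ _ (AM x y)).
    by rewrite mul_sub1 linearD [X in _ + X]linearD /= Lx Ly !addr0 L2 ?expv2 ?memv_mul.
  have : g \in Group Ngr.
    suff /subsetP : [set: gT] \subset Group Ngr by apply; rewrite inE.
    by rewrite -genS gen_subG; apply/subsetP => h /LS Lh; rewrite inE Lh.
  by rewrite inE => /eqP.
have [f' _ f'K] := f_bij.
pose u := repr (f' (pia (vsproj IH w))).
have : pia (vsproj IH w) = f (pia u) by rewrite pia_repr f'K.
rewrite (sub1_sum u) !linear_sum => /eqP.
under eq_bigr do rewrite !linearZ /= -piaX -linearZ.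
rewrite -linear_sum pia_eq vsprojK // => w_eq.
have -> : w = w - vsval (\sum_g (vsval u g : k) *: X g) + vsval (\sum_g (vsval u g : k) *: X g).
  by rewrite subrK.
rewrite linearD /= L2 ?add0r; last by apply: subvP w_eq; apply: sub_expv.
rewrite !linear_sum /= big1 // => g _; rewrite !linearZ /=.
by have := LA g; rewrite addrK => ->; rewrite scaler0.
Qed.

End Quotient.

Lemma pw_expr (R : nzRingType) (x : R) n : pw *%R 1 x n = x ^+ n.
Proof. by elim: n => // n IHn; rewrite exprS -IHn. Qed.

Lemma nfE (R : nzRingType) (x y z : R) t :
  nf *%R 1 x y z t = x ^+ t.1.1 * y ^+ t.1.2 * z ^+ t.2.
Proof. by rewrite /nf !pw_expr. Qed.

(** * Duality between coordinates and monomials *)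

Section Dual.

Variables (k : fieldType) (char2 : 2%N \in [pchar k]).
Variables (gT : finGroupType) (a b c : gT) (P : pres) (tau : gT -> triple).
Hypothesis tauP : pbw_index a b c P tau.

Local Notation kG := (group_algebra k gT).

Lemma tau_prod t : t \in box -> tau (a ^+ t.1.1 * b ^+ t.1.2 * c ^+ t.2)%g = t.
Proof.
case: t => [[i j] l]; rewrite mem_box => /and3P[/= lt_i lt_j lt_l].
have ta : tau (a ^+ i)%g = (i, 0, 0)%N.
  elim: i lt_i => [|i IHi] lt_i; first by rewrite (pbw_1 tauP).
  rewrite expgSr (pbw_a tauP) IHi 1?ltnW // /mula /conj_exp /= !muln0.
  by rewrite modn_small.
have tb : tau (a ^+ i * b ^+ j)%g = (i, j, 0)%N.
  elim: j lt_j => [|j IHj] lt_j; first by rewrite mulg1.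
  rewrite expgSr mulgA (pbw_b tauP) IHj 1?ltnW // /mulb /= !muln0.
  by rewrite modn_small.
elim: l lt_l => [|l IHl] lt_l; first by rewrite mulg1.
rewrite expgSr mulgA (pbw_c tauP) IHl 1?ltnW // /mulc /=.
by rewrite modn_small.
Qed.

(** The inclusion matrix of binary digits is its own inverse modulo 2: if i is included in j, the
    number of h between them is a power of 2, odd only when i = j. *)
Lemma bsub1_dual n i j : (n == 4%N) || (n == 8%N) -> (i < n)%N -> (j < n)%N ->
  \sum_(h <- iota 0 n) (bsub1 h j)%:R * (bsub1 i h)%:R = (i == j)%:R :> k.
Proof.
move=> n48 lt_i lt_j; under eq_bigr do rewrite -natrM mulnb.
rewrite -(natr_parity char2); congr (_%:R).
have: all (fun n => all (fun i => all (fun j =>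
   parity (fun h => bsub1 h j && bsub1 i h) (iota 0 n) == (i == j))
   (iota 0 n)) (iota 0 n)) [:: 4; 8]%N by [].
move/allP/(_ n); rewrite !inE => /(_ n48)/allP/(_ i); rewrite mem_iota => /(_ lt_i)/allP/(_ j).
by rewrite mem_iota => /(_ lt_j)/eqP->.
Qed.

Lemma cf_mon s q : s \in box -> q \in box -> cf tau s (mon k a b c q) = (s == q)%:R.
Proof.
case: s q => [[i j] l] [[i' j'] l']; rewrite !mem_box => /and3P[/= lt_i lt_j lt_l].
case/and3P => /= lt_i' lt_j' lt_l'.
pose F (q : triple) : kG := ga k (a ^+ q.1.1 * b ^+ q.1.2 * c ^+ q.2)%g.
have sqr1 (u : kG) : (u + 1) + 1 = u by rewrite -addrA (ga_addxx char2) addr0.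
have -> : mon k a b c (i', j', l') = \sum_(q <- box)
    ((bsub1 q.1.1 i')%:R * (bsub1 q.1.2 j')%:R * (bsub1 q.2 l')%:R) *: F q.
  rewrite /mon (exp_expand4 char2 _ lt_i') !(exp_expand char2 _ lt_j') (exp_expand char2 _ lt_l').
  rewrite sum_box -mulrA mulr_suml; apply: eq_bigr => m _.
  rewrite mulr_suml mulr_sumr; apply: eq_bigr => n _.
  rewrite mulr_sumr mulr_sumr; apply: eq_bigr => o _ /=.
  by rewrite /F !gaM !gaX !sqr1 -!natrM !mulnb -andbA scale_and3.
rewrite (linear_sum (cf tau (i, j, l) : {linear kG -> k^o})) /=.
transitivity (\sum_(m <- iota 0 4) \sum_(n <- iota 0 8) \sum_(o <- iota 0 8)
   ((bsub1 m i')%:R * (bsub1 i m)%:R) *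
   (((bsub1 n j')%:R * (bsub1 j n)%:R) * ((bsub1 o l')%:R * (bsub1 l o)%:R)) : k).
  rewrite -(sum_box (fun q => ((bsub1 q.1.1 i')%:R * (bsub1 i q.1.1)%:R) *
   (((bsub1 q.1.2 j')%:R * (bsub1 j q.1.2)%:R) * ((bsub1 q.2 l')%:R * (bsub1 l q.2)%:R)))).
  apply: eq_big_seq => q q_box; rewrite cfZ /F cf_ga tau_prod // /bsub /=.
  by rewrite -!natrM !mulnb; congr (_%:R); do 6!case: bsub1.
under eq_bigr => m _ do
  under eq_bigr => n _ do (rewrite -mulr_sumr -mulr_sumr bsub1_dual //).
under eq_bigr => m _ do rewrite -mulr_sumr -mulr_suml bsub1_dual //.
rewrite -mulr_suml bsub1_dual // -!natrM !mulnb; congr (_%:R).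
by rewrite !xpair_eqE andbA.
Qed.

End Dual.

Lemma uniq_box : uniq box.
Proof. by []. Qed.

Section Filtration.

Variables (k : fieldType) (gT : finGroupType).

Local Notation kG := (group_algebra k gT).
Local Notation I := (aug_ideal k gT).

(* The powers of the augmentation ideal; [expv] makes [(I ^+ 0)%VS] the line of scalars. *)
Definition filt (n : nat) : {vspace kG} := if n is 0 then fullv else (I ^+ n)%VS.

Lemma filtE n : (0 < n)%N -> filt n = (I ^+ n)%VS. Proof. by case: n. Qed.

Lemma filt_mul p q u v : u \in filt p -> v \in filt q -> u * v \in filt (p + q).
Proof.
case: p q => [|p] [|q] Iu Iv; first exact: memvf.
- exact: expv_mull.
- by rewrite addn0; apply: expv_mulr.
by rewrite /filt addSn -[(p + q.+1).+1]/(p.+1 + q.+1)%N expvD memv_mul.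
Qed.

Lemma filt_sub p q u : (p <= q)%N -> u \in filt q -> u \in filt p.
Proof.
case: p => [|p] le_q Iu; first exact: memvf.
by move: Iu; rewrite filtE ?(leq_trans _ le_q) //; apply/subvP/sub_expv.
Qed.

End Filtration.

(** * Isomorphisms from images of the generators *)

Section Images.

Variables (k : fieldType) (char2 : 2%N \in [pchar k]) (m : nat).
Hypothesis m_gt1 : (1 < m)%N.
Variables (gT : finGroupType) (a b c : gT) (P : pres) (tau : gT -> triple).
Hypothesis tauP : pbw_index a b c P tau.
Variables (hT : finGroupType) (a' b' c' : hT) (P' : pres) (tau' : hT -> triple).
Hypothesis tauP' : pbw_index a' b' c' P' tau'.

Local Notation kG := (group_algebra k gT).
Local Notation kH := (group_algebra k hT).
Local Notation IG := (aug_ideal k gT).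
Local Notation IH := (aug_ideal k hT).
Local Notation monG := (mon k a b c).
Local Notation monH := (mon k a' b' c').

Variables A B C : kH.
Hypotheses (A2 : eqm 2 A (ga k a')) (B2 : eqm 2 B (ga k b')) (C2 : eqm 2 C (ga k c')).
Hypothesis rules : nf_rules *%R 1 (eqm m) P A B C.

Let m_gt0 : (0 < m)%N := ltnW m_gt1.

Let E (g : gT) : kH := nf *%R 1 A B C (tau g).

Definition phi (u : kG) : kH := \sum_g (u g : k) *: E g.

Lemma phi_is_linear : linear phi.
Proof.
move=> z u v; rewrite /phi scaler_sumr -big_split; apply: eq_bigr => g _ /=.
by rewrite !ffunE scalerA -scalerDl.
Qed.

HB.instance Definition _ := GRing.isLinear.Build k kG kH _ phi phi_is_linear.

Lemma phi_ga g : phi (ga k g) = E g.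
Proof.
rewrite /phi (bigD1 g) //= ffunE eqxx scale1r big1 ?addr0 // => h /negPf nh.
by rewrite ffunE nh scale0r.
Qed.

Lemma phi1 : phi 1 = 1.
Proof. by rewrite -ga1 phi_ga /E (pbw_1 tauP) /nf /= !mulr1. Qed.

Let eqv := @eqm_equiv k hT m.
Let prop := @eqm_mul k hT m m_gt0.
Let eqmxx u : eqm m u (u : kH) := eqm_refl m u.
#[local] Hint Resolve eqmxx : core.

(** A, B and C satisfy [nf_rules] modulo I^m, so multiplying a normal form on the right by one of
    them changes the exponents by the same maps that describe [tau]. *)
Lemma E_mul g h : eqm m (E (g * h)%g) (E g * E h).
Proof.
have step x X (f : triple -> triple) n g' : (forall h, tau (h * x)%g = f (tau h)) ->
    (forall t, eqm m (nf *%R 1 A B C t * X) (nf *%R 1 A B C (f t))) ->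
    eqm m (E (g' * x ^+ n)%g) (E g' * X ^+ n).
  move=> fx fX; elim: n => [|n IHn]; first by rewrite mulg1 mulr1.
  rewrite expgSr mulgA exprSr mulrA /E fx; etransitivity; last first.
    by apply: prop; [exact: IHn | exact: eqmxx].
  by symmetry; apply: fX.
have stepA := step _ _ _ _ _ (pbw_a tauP) (nf_mula (@mulrA kH) (@mul1r kH) (@mulr1 kH) eqv prop rules).
have stepB := step _ _ _ _ _ (pbw_b tauP) (nf_mulb (@mulrA kH) (@mul1r kH) (@mulr1 kH) eqv prop rules).
have stepC := step _ _ _ _ _ (pbw_c tauP) (nf_mulc (@mulrA kH) (@mul1r kH) (@mulr1 kH) eqv prop rules).
rewrite {1}(pbw_prod tauP h) [E h]nfE !mulgA !mulrA.
etransitivity; first exact: stepC; apply: prop => //.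
by etransitivity; first exact: stepB; apply: prop.
Qed.

Lemma eqm_sum (I : Type) (r : seq I) (F G : I -> kH) :
  (forall i, eqm m (F i) (G i)) -> eqm m (\sum_(i <- r) F i) (\sum_(i <- r) G i).
Proof.
move=> FG; elim: r => [|i r IHr]; first by rewrite !big_nil.
by rewrite !big_cons; apply: eqm_add.
Qed.

Lemma eqmZ z (u v : kH) : eqm m u v -> eqm m (z *: u) (z *: v).
Proof. by move=> uv; rewrite /eqm -scalerBr memvZ. Qed.

Lemma phi_mul u v : eqm m (phi (u * v)) (phi u * phi v).
Proof.
rewrite {1}(gaE u) mulr_suml linear_sum [phi u]/phi mulr_suml; apply: eqm_sum => g.
rewrite -!scalerAl linearZ /=; apply: eqmZ.
rewrite {1}(gaE v) mulr_sumr linear_sum [phi v]/phi mulr_sumr; apply: eqm_sum => h.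
rewrite -!scalerAr linearZ /=; apply: eqmZ.
by rewrite -gaM phi_ga; apply: E_mul.
Qed.

Lemma phi_add1 (g : gT) (h : hT) (X : kH) : eqm m (E g) X -> eqm 2 X (ga k h) ->
  eqm 2 (phi (ga k g + 1)) (ga k h + 1).
Proof.
move=> EX Xh; rewrite linearD /= phi1 phi_ga; apply: eqm_add; last exact: eqm_refl.
rewrite /eqm -(subrK X (E g)) -addrA memvD //.
by apply: subvP EX; apply: sub_expv.
Qed.

Let Ea : eqm m (E a) A.
Proof. by rewrite /E -[a]mul1g (pbw_a tauP) (pbw_1 tauP) /nf /mula /conj_exp /= !muln0 /= !mulr1. Qed.

Let Eb : eqm m (E b) B.
Proof. by rewrite /E -[b]mul1g (pbw_b tauP) (pbw_1 tauP) /nf /mulb /= !muln0 /= !mulr1 mul1r. Qed.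

Let Ec : eqm m (E c) C.
Proof. by rewrite /E -[c]mul1g (pbw_c tauP) (pbw_1 tauP) /nf /mulc /= !mulr1 !mul1r. Qed.

Lemma sub1_expr (X : kH) n : X - 1 \in IH -> X ^+ n - 1 \in IH.
Proof.
move=> X1; elim: n => [|n IHn]; first by rewrite subrr mem0v.
by rewrite exprS mul_sub1; apply: memvD; [exact: aug_idealMl | exact: memvD].
Qed.

Lemma E_sub1 g : E g - 1 \in IH.
Proof.
have sub1M (X Y : kH) : X - 1 \in IH -> Y - 1 \in IH -> X * Y - 1 \in IH.
  by move=> X1 Y1; rewrite mul_sub1; apply: memvD; [exact: aug_idealMl | exact: memvD].
have sub1 (h : hT) (X : kH) : eqm 2 X (ga k h) -> X - 1 \in IH.
  move=> Xh; rewrite -(subrK (ga k h) X) -addrA memvD ?ga_aug //.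
  by apply: subvP Xh; rewrite -[X in (_ <= X)%VS]expv1; apply: sub_expv.
rewrite /E nfE !sub1M ?sub1_expr //; [exact: sub1 A2 | exact: sub1 B2 | exact: sub1 C2].
Qed.

Lemma phi_aug u : u \in IG -> phi u \in IH.
Proof.
move=> Iu; have /eqP u0 : \sum_g u g == 0 by rewrite -mem_aug_ideal.
have -> : phi u = \sum_g (u g : k) *: (E g - 1).
  under [RHS]eq_bigr do rewrite scalerBr.
  by rewrite sumrB -scaler_suml u0 scale0r subr0.
by apply: memv_suml => g _; rewrite memvZ // E_sub1.
Qed.

Lemma phi_expv n u : (0 < n <= m)%N -> u \in (IG ^+ n)%VS -> phi u \in (IH ^+ n)%VS.
Proof.
case: n => // n /=; elim: n u => [|n IHn] u lt_n; first by rewrite !expv1; exact: phi_aug.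
rewrite expvSr => Iu.
suff: u \in (linfun phi @^-1: (IH ^+ n.+2))%VS by rewrite -memv_preim lfunE.
apply: subvP Iu; apply/prodvP => v w Iv Iw; rewrite -memv_preim lfunE /=.
rewrite -(subrK (phi v * phi w) (phi (v * w))) memvD //.
  by apply: subvP (phi_mul v w); apply: sub_expv.
by rewrite expvSr memv_mul ?phi_aug // IHn // ltnW.
Qed.

(** v is the leading form of the image of u in degree n. On monomials the leading form of an image
    is the monomial with the same exponents, so the associated graded map is the identity in
    coordinates. *)
Definition leading n (u : kG) (v : kH) : Prop :=
  [/\ u \in filt k gT n, v \in filt k hT n & phi u - v \in filt k hT n.+1].

Lemma leadingM n1 n2 u1 u2 v1 v2 : (n1 + n2 < m)%N ->
  leading n1 u1 v1 -> leading n2 u2 v2 -> leading (n1 + n2) (u1 * u2) (v1 * v2).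
Proof.
move=> lt_m [u1I v1I uv1] [u2I v2I uv2]; split; rewrite ?filt_mul //.
rewrite -(subrK (phi u1 * phi u2) (phi (u1 * u2))) -addrA; apply: memvD.
  by apply: subvP (phi_mul u1 u2); apply: sub_expv.
rewrite -(subrK (v1 * phi u2) (phi u1 * phi u2)) -addrA -mulrBl -mulrBr; apply: memvD.
  rewrite -addSn; apply: filt_mul => //; rewrite -(subrK v2 (phi u2)); apply: memvD => //.
  exact: filt_sub uv2.
by rewrite -addnS; apply: filt_mul.
Qed.

Lemma leading1 : leading 0 1 1.
Proof. by split; rewrite ?memvf // phi1 subrr mem0v. Qed.

Lemma leadingX n u v : (n < m)%N -> leading 1 u v -> leading n (u ^+ n) (v ^+ n).
Proof.
move=> lt_m uv; elim: n lt_m => [|n IHn] lt_m; first exact: leading1.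
by rewrite !exprS -add1n; apply: leadingM => //; apply: IHn; apply: ltnW.
Qed.

Lemma leading_mon s : (deg s < m)%N -> leading (deg s) (monG s) (monH s).
Proof.
have gen (g : gT) (h : hT) (X : kH) : eqm m (E g) X -> eqm 2 X (ga k h) ->
    leading 1 (ga k g + 1) (ga k h + 1).
  by move=> EX Xh; split; [exact: ga_aug1 | exact: ga_aug1 | exact: phi_add1 EX Xh].
case: s => [[i j] l]; rewrite /deg /= => lt_m; rewrite /mon /=.
have lt_ij : (i + j < m)%N by apply: leq_ltn_trans lt_m; apply: leq_addr.
apply: leadingM => //; first apply: leadingM => //.
- by apply: leadingX (gen _ _ _ Ea A2); apply: leq_ltn_trans lt_ij; apply: leq_addr.
- by apply: leadingX (gen _ _ _ Eb B2); apply: leq_ltn_trans lt_ij; apply: leq_addl.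
by apply: leadingX (gen _ _ _ Ec C2); apply: leq_ltn_trans lt_m; apply: leq_addl.
Qed.

(** In the lowest degree where u can be nonzero, u and its image have the same coordinates; these
    vanish as long as the degree is below m. *)
Lemma phi_inj u : u \in IG -> phi u \in (IH ^+ m)%VS -> u \in (IG ^+ m)%VS.
Proof.
move=> Iu phi_u; suff Iud d : (d < m)%N -> u \in (IG ^+ d.+1)%VS.
  by rewrite -(prednK m_gt0); apply: Iud; rewrite prednK.
elim: d => [|d IHd] lt_d; first by rewrite expv1.
have {IHd} u_d := IHd (ltnW lt_d).
apply: (expv_cf char2 tauP) => // t t_box; rewrite ltnS leq_eqVlt => /orP[/eqP deg_t | lt_t]; last first.
  exact: (cf_expv char2 tauP u_d).
have cft v : v \in (IH ^+ d.+2)%VS -> cf tau' t v = 0.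
  by move=> Iv; apply: (cf_expv char2 tauP' Iv); rewrite ?deg_t.
have cf_phi s : s \in box -> cf tau' t (phi (cf tau s u *: monG s)) = cf tau s u * (t == s)%:R.
  move=> s_box; rewrite linearZ cfZ /=; have [lt_s|] := ltnP (deg s) d.+1.
    by rewrite (cf_expv char2 tauP u_d) ?mul0r.
  rewrite leq_eqVlt => /orP[/eqP deg_s | lt_s].
    rewrite -(subrK (monH s) (phi (monG s))) cfD (cf_mon char2 tauP') // cft ?add0r //.
    by have [] := leading_mon (s := s); rewrite -deg_s.
  rewrite cft; last by apply: phi_expv => //; apply: subvP (mon_expv char2 _ _ _ s); apply: sub_expv.
  by case: eqP lt_s => [<-|]; rewrite ?deg_t ?ltnn ?mulr0.
have : cf tau' t (phi u) = 0 by apply: cft; apply: subvP phi_u; apply: sub_expv.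
rewrite {1}(cf_expand char2 tauP u) linear_sum (linear_sum (cf tau' t : {linear kH -> k^o})) /=.
rewrite (eq_big_seq _ cf_phi) (bigD1_seq t) ?uniq_box //= eqxx mulr1 big1 ?addr0 // => s ne_s.
by rewrite eq_sym (negPf ne_s) mulr0.
Qed.

(** Successive approximation: the part of degree d of the remainder is cancelled by the image of the
    same combination of monomials, at the price of terms of higher degree. *)
Lemma phi_surj w : w \in IH -> exists2 u, u \in IG & eqm m w (phi u).
Proof.
have step d : (0 < d < m)%N -> forall v, v \in (IH ^+ d)%VS ->
    exists2 u, u \in IG & v - phi u \in (IH ^+ d.+1)%VS.
  move=> d_bd v Iv; have /andP[d_gt0 lt_d] := d_bd.
  exists (\sum_(s <- box | deg s == d) cf tau' s v *: monG s).
    rewrite big_seq_cond; apply: memv_suml => s /andP[_ /eqP deg_s]; apply: memvZ.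
    rewrite -[IG]expv1; apply: subvP (mon_expv char2 _ _ _ s).
    by rewrite deg_s; apply: sub_expv.
  have -> : v - phi (\sum_(s <- box | deg s == d) cf tau' s v *: monG s) =
      \sum_(s <- box | deg s == d) cf tau' s v *: (monH s - phi (monG s)) +
      \sum_(s <- box | deg s != d) cf tau' s v *: monH s.
    rewrite {1}(cf_expand char2 tauP' v) (bigID (fun s => deg s == d)) /= addrAC.
    rewrite (linear_sum (phi : {linear kG -> kH})) -sumrB; congr (_ + _); apply: eq_bigr => s _.
    by rewrite linearZ /= scalerBr.
  rewrite [X in X + _]big_seq_cond [X in _ + X]big_seq_cond.
  apply: memvD; apply: memv_suml => s /andP[s_box deg_s].
    rewrite memvZ // -memvN opprB; have /eqP deg_sd := deg_s.
    by have [] := leading_mon (s := s); rewrite deg_sd.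
  have [lt_s|le_s] := ltnP (deg s) d.
    by rewrite (cf_expv char2 tauP' Iv) // scale0r mem0v.
  rewrite memvZ //; apply: subvP (mon_expv char2 _ _ _ s); apply: sub_expv => //.
  by rewrite ltn_neqAle eq_sym deg_s.
move=> Iw; suff [u Iu wu] : exists2 u, u \in IG & w - phi u \in (IH ^+ m.-1.+1)%VS.
  by exists u => //; rewrite /eqm -(prednK m_gt0).
have: (m.-1 < m)%N by rewrite prednK.
elim: m.-1 => [|d IHd] lt_d; first by exists 0; rewrite ?mem0v // linear0 subr0 expv1.
have [u1 Iu1 wu1] := IHd (ltnW lt_d).
have [//|u2 Iu2 wu2] := step d.+1 _ _ wu1.
exists (u1 + u2); first exact: memvD.
by rewrite linearD opprD addrA.
Qed.

Lemma images_isog : aug_quot_isog k gT hT m.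
Proof.
apply: (aug_quot_isogI m_gt0 (phi := phi)).
- exact: phi_aug.
- by move=> u; apply: phi_expv; rewrite m_gt0 leqnn.
- exact: phi_mul.
- exact: phi_inj.
- exact: phi_surj.
Qed.

End Images.

End Quotients.

(** * The elimination machine *)

Section Elimination.

Local Open Scope ring_scope.

Definition vec : Type := seq (seq (seq fpoly)).
Definition rows : Type := seq (seq (seq (seq (triple * seq triple)))).

Inductive expr : Type :=
  Atom of nat | Scal of var & expr | Add of expr & expr | Mul of expr & expr.

Definition in_keep (keep : seq triple) (s : triple) : bool := has (teq s) keep.

Definition mk_rows (P : pres) (keep : seq triple) : rows :=
  let CA := tab3 (coefa (conja_tab P)) in
  let CB := tab3 (coefb (conjb_tab P)) in
  tab3 (fun s => if in_keep keep s then mul_row (get3 [::] CA) (get3 [::] CB) coefc s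
                 else [::]).

(* The span of the monomials outside [keep] is an ideal. *)
Definition closed_keep (R : rows) (keep : seq triple) : bool :=
  all (fun s => inbox s &&
    all (fun e => in_keep keep e.1 && all (in_keep keep) e.2) (get3 [::] R s)) keep.

Section Machine.

Variables (R : rows) (keep : seq triple).

Definition gather (U V : vec) (s : triple) : fpoly :=
  psum [seq pmul (get3 [::] V e.1) (psum [seq get3 [::] U p | p <- e.2])
       | e <- get3 [::] R s].

(** Degrees add in products, so truncating the factors at degree d loses nothing in the coordinates
    of degree at most d. *)
Definition cut (d : nat) (F : triple -> fpoly) (s : triple) : fpoly :=
  if (deg s <= d)%N && in_keep keep s then F s else [::].

Fixpoint coefs (atoms : seq vec) (d : nat) (e : expr) : triple -> fpoly :=
  match e with
  | Atom n => let U := nth [::] atoms n in get3 [::] U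
  | Scal v f => let F := coefs atoms d f in fun s => pmul (pvar v) (F s)
  | Add f g =>
    let F := coefs atoms d f in let G := coefs atoms d g in
    fun s => padd (F s) (G s)
  | Mul f g =>
    let U := tab3 (cut d (coefs atoms d f)) in
    let V := tab3 (cut d (coefs atoms d g)) in
    gather U V
  end.

Definition vsubst (v : var) (r : fpoly) (U : vec) : vec :=
  [seq [seq [seq psubst v r p | p <- l] | l <- m] | m <- U].

(* In characteristic 2, the equation p = 0 reads v = p + v. *)
Fixpoint solve (eqs : seq fpoly) (vs : seq var) (atoms : seq vec) : seq vec :=
  match eqs, vs with
  | p :: eqs', v :: vs' =>
    let r := padd p (pvar v) in
    solve [seq psubst v r q | q <- eqs'] vs' [seq vsubst v r U | U <- atoms]
  | _, _ => atoms
  end.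

(* [(n, s, v)] uses the coefficient [s] of the relation [n] to eliminate the variable [v]. *)
Definition step : Type := nat * triple * var.

Definition phase (rels : seq expr) (d : nat) (st : seq step) (atoms : seq vec) : seq vec :=
  let fs := [seq cut d (coefs atoms d e) | e <- rels] in
  solve [seq nth (fun _ => [::]) fs s.1.1 s.1.2 | s <- st] [seq s.2 | s <- st] atoms.

Fixpoint run (rels : seq expr) (cert : seq (nat * seq step)) (atoms : seq vec) : seq vec :=
  if cert is (d, st) :: cert' then run rels cert' (phase rels d st atoms) else atoms.

Definition final (rels : seq expr) (cert : seq (nat * seq step)) (n d : nat) (s : triple)
    (atoms : seq vec) : fpoly :=
  cut d (coefs (run rels cert atoms) d (nth (Atom 0) rels n)) s.

(** * Soundness of the elimination *)

Section Sound.

Variables (k : fieldType) (char2 : 2%N \in [pchar k]).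
Variables (gT : finGroupType) (a b c : gT) (P : pres) (tau : gT -> triple).
Hypothesis tauP : pbw_index a b c P tau.
Hypothesis R_def : R = mk_rows P keep.
Hypothesis closed : closed_keep R keep.

Local Notation kG := (group_algebra k gT).
Local Notation cf := (cf (k := k) tau).

Variables (env : var -> k) (us : nat -> kG).

Local Notation eval := (peval env).

Fixpoint den (e : expr) : kG :=
  match e with
  | Atom n => us n
  | Scal v f => env v *: den f
  | Add f g => den f + den g
  | Mul f g => den f * den g
  end.

Definition good (atoms : seq vec) : Prop :=
  forall n s, in_keep keep s -> eval (get3 [::] (nth [::] atoms n) s) = cf s (us n).

Lemma in_keep_box s : in_keep keep s -> s \in box.
Proof.
by case/hasP => t t_keep /teqP->; case/andP: (allP closed _ t_keep); rewrite mem_box.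
Qed.

Lemma eval_gather d U V u v s : in_keep keep s -> (deg s <= d)%N ->
  (forall t, in_keep keep t -> (deg t <= d)%N -> eval (get3 [::] U t) = cf t u) ->
  (forall t, in_keep keep t -> (deg t <= d)%N -> eval (get3 [::] V t) = cf t v) ->
  eval (gather U V s) = cf s (u * v).
Proof.
move=> s_keep le_s EU EV; have s_box := in_keep_box s_keep.
rewrite /gather peval_sum // big_map (cf_mul char2 tauP) //.
have Rs : get3 [::] R s = mul_row (get3 [::] (tab3 (coefa (conja_tab P))))
                           (get3 [::] (tab3 (coefb (conjb_tab P)))) coefc s.
  by rewrite R_def get3_tab3 // s_keep.
rewrite Rs; apply: eq_big_seq => e s_e; rewrite pevalM // peval_sum // big_map.
have [ne2 dege] := mul_row_deg tauP s_box s_e.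
case/hasP: (s_keep) => t t_keep /teqP E; rewrite -{t}E in t_keep.
have /andP[_] := allP closed _ t_keep.
rewrite Rs => /allP/(_ e s_e)/andP[e_keep /allP p_keep].
have le_e : (deg e.1 <= d)%N.
  case: (e.2) ne2 dege => // p l _ /(_ p (mem_head _ _))/andP[_ le_p].
  by apply: leq_trans le_s; apply: leq_trans le_p; apply: leq_addl.
rewrite EV //; congr (_ * _); apply: eq_big_seq => p e_p.
rewrite EU ?p_keep //; have /andP[_ le_p] := dege p e_p.
by apply: leq_trans le_s; apply: leq_trans le_p; apply: leq_addr.
Qed.

Lemma eval_coefs atoms d e s : good atoms -> in_keep keep s -> (deg s <= d)%N ->
  eval (coefs atoms d e s) = cf s (den e).
Proof.
move=> atomsP; elim: e s => [n|v f IHf|f IHf g IHg|f IHf g IHg] s s_keep le_s /=.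
- exact: atomsP.
- by rewrite pevalM // pevalX IHf // cfZ.
- by rewrite pevalD // IHf // IHg // cfD.
apply: (eval_gather (d := d)) => // t t_keep le_t;
  by rewrite get3_tab3 ?in_keep_box // /cut le_t t_keep /= ?IHf ?IHg.
Qed.

Lemma nth_map0 (S T : Type) (x : S) (f : S -> T) l n :
  nth (f x) [seq f y | y <- l] n = f (nth x l n).
Proof. by elim: l n => [|y l IHl] [|n] //=. Qed.

Lemma good_subst atoms v r : env v = eval r -> good atoms ->
  good [seq vsubst v r U | U <- atoms].
Proof.
move=> Ev atomsP n s s_keep; rewrite -atomsP // (nth_map0 [::] (vsubst v r)).
rewrite /get3 /vsubst (nth_map0 [::] (fun m => [seq [seq psubst v r p | p <- l] | l <- m])).
rewrite (nth_map0 [::] (fun l => [seq psubst v r p | p <- l])).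
rewrite (nth_map0 [::] (psubst v r)).
exact: peval_subst.
Qed.

(** v = p + v holds for any variable v once p vanishes. A badly chosen v may fail to disappear, but
    the atoms still evaluate to the true coordinates. *)
Lemma good_solve eqs vs atoms : good atoms -> (forall p, p \in eqs -> eval p = 0) ->
  good (solve eqs vs atoms).
Proof.
elim: vs eqs atoms => [|v vs IHv] [|p eqs] atoms atomsP eqs0 //=.
have Ev : env v = eval (padd p (pvar v)).
  by rewrite pevalD // eqs0 ?mem_head // add0r pevalX.
apply: IHv; first exact: good_subst.
move=> _ /mapP[q eqs_q ->]; rewrite peval_subst //.
by apply: eqs0; rewrite inE eqs_q orbT.
Qed.

Variable rels : seq expr.
Hypothesis relsP : forall n s, (n < size rels)%N -> in_keep keep s ->
  cf s (den (nth (Atom 0) rels n)) = 0.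

Lemma eval_rel atoms n d s : good atoms ->
  eval (nth (fun _ => [::]) [seq cut d (coefs atoms d e) | e <- rels] n s) = 0.
Proof.
move=> atomsP; have [lt_n|le_n] := ltnP n (size rels); last first.
  by rewrite nth_default ?size_map // peval0.
rewrite (nth_map (Atom 0)) // /cut; case: andP => [[le_s s_keep]|_]; last exact: peval0.
by rewrite eval_coefs // relsP.
Qed.

Lemma good_run cert atoms : good atoms -> good (run rels cert atoms).
Proof.
elim: cert atoms => //= -[d st] cert IHc atoms atomsP; apply: IHc.
by apply: good_solve => // _ /mapP[s _ ->]; apply: eval_rel.
Qed.

Lemma final_sound cert n d s atoms : (n < size rels)%N -> good atoms ->
  eval (final rels cert n d s atoms) = 0.
Proof.
move=> lt_n atomsP; rewrite /final.
have := eval_rel n d s (good_run cert atomsP).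
by rewrite (nth_map (Atom 0)).
Qed.

End Sound.

End Machine.

(** Generic coordinates, except those already known, which may be polynomials in the others. *)
Definition init (keep : seq triple) (n : nat) (known : seq (triple * fpoly)) : vec :=
  tab3 (fun s => if in_keep keep s then
    let l := [seq e <- known | teq e.1 s] in
    if l is e :: _ then e.2 else pvar (n, s) else [::]).

End Elimination.

(** * Isomorphism modulo the 9th powers *)

Section Isomorphic.

Local Open Scope ring_scope.

Definition const_vec (S : seq triple) : vec :=
  tab3 (fun s => if has (teq s) S then [:: [::]] else [::]).

Definition keep8 : seq triple := [seq s <- box | deg s <= 8]%N.

(* The atom 3 stands for 1. *)
Definition word (l : seq nat) : expr := foldl (fun e n => Mul e (Atom n)) (Atom 3) l.

Definition word_eq (R : rows) (atoms : seq vec) (l1 l2 : seq nat) : bool :=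
  let F := coefs R keep8 atoms 8 (word l1) in
  let G := coefs R keep8 atoms 8 (word l2) in
  all (fun s => nilp (padd (F s) (G s))) keep8.

Definition images (SA SB SC : seq triple) : seq (seq triple) :=
  [:: (0, 0, 0) :: (1, 0, 0) :: SA; (0, 0, 0) :: (0, 1, 0) :: SB;
      (0, 0, 0) :: (0, 0, 1) :: SC; [:: (0, 0, 0)]]%N.

Definition images_ok (P P' : pres) (SA SB SC : seq triple) : bool :=
  let R := mk_rows P' keep8 in
  let atoms := map const_vec (images SA SB SC) in
  [&& closed_keep R keep8, all (fun s => 1 < deg s)%N (SA ++ SB ++ SC),
      all (fun l => uniq l && all (mem box) l) (images SA SB SC),
      [&& word_eq R atoms (nseq 4 0%N) [::], word_eq R atoms (nseq 8 1%N) [::]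
        & word_eq R atoms (nseq 8 2%N) [::]] &
      [&& word_eq R atoms [:: 1; 0]%N (0 :: nseq (p0 P) 1 ++ nseq (p1 P) 2)%N,
        word_eq R atoms [:: 2; 0]%N (0 :: nseq (q0 P) 1 ++ nseq (q1 P) 2)%N &
        word_eq R atoms [:: 2; 1]%N (1 :: nseq (rb P) 2)%N]].

Section ImagesOk.

Variables (k : fieldType) (char2 : 2%N \in [pchar k]).
Variables (gT : finGroupType) (a b c : gT) (P : pres) (tau : gT -> triple).
Hypothesis tauP : pbw_index a b c P tau.
Variables (hT : finGroupType) (a' b' c' : hT) (P' : pres) (tau' : hT -> triple).
Hypothesis tauP' : pbw_index a' b' c' P' tau'.

Local Notation kH := (group_algebra k hT).
Local Notation monH := (mon k a' b' c').

Definition mon_sum (S : seq triple) : kH := \sum_(q <- S) monH q.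

Lemma const_vecE (S : seq triple) s env : uniq S -> {subset S <= box} -> s \in box ->
  peval env (get3 [::] (const_vec S) s) = cf tau' s (mon_sum S).
Proof.
move=> uS S_box s_box; rewrite get3_tab3 // /mon_sum.
rewrite (linear_sum (cf tau' s : {linear kH -> k^o})) /=.
rewrite (eq_big_seq (fun q => (s == q)%:R)) => [|q /S_box q_box]; last exact: (cf_mon char2 tauP').
have -> : has (teq s) S = (s \in S).
  by rewrite -has_pred1; apply: eq_has => q; apply/teqP/eqP.
have [sS|sS] := boolP (s \in S); last first.
  rewrite peval0 big_seq big1 // => q qS; case: eqP => // sq.
  by rewrite sq qS in sS.
rewrite peval1 (bigD1_seq s) //= eqxx big1 ?addr0 // => q /negPf.
by rewrite eq_sym => ->.
Qed.

Lemma mon_sum_eqm s h (S : seq triple) : monH s = ga k h + 1 -> all (fun s => 1 < deg s)%N S ->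
  eqm 2 (mon_sum ((0, 0, 0)%N :: s :: S)) (ga k h).
Proof.
move=> mon_s S2; rewrite /eqm /mon_sum !big_cons mon_s addrA.
have -> : monH (0, 0, 0)%N = 1 by rewrite /mon !expr0 !mulr1.
rewrite (addrC 1) -(addrA (ga k h)) (ga_addxx char2) addr0 addrAC subrr add0r.
rewrite big_seq; apply: memv_suml => q /(allP S2) q2.
by apply: subvP (mon_expv char2 _ _ _ q); apply: sub_expv.
Qed.

Lemma in_keep8 s : in_keep keep8 s -> s \in box.
Proof. by case/hasP => t; rewrite mem_filter => /andP[_ t_box] /teqP->. Qed.

Lemma good_images (ls : seq (seq triple)) env :
  {in ls, forall l, uniq l && all (mem box) l} ->
  good keep8 tau' env (fun n => mon_sum (nth [::] ls n)) (map const_vec ls).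
Proof.
move=> lsP n s /in_keep8 s_box; have [lt_n|le_n] := ltnP n (size ls).
  rewrite (nth_map [::]) //.
  by have /andP[ul /allP l_box] := lsP _ (mem_nth [::] lt_n); rewrite const_vecE.
rewrite !nth_default ?size_map // /mon_sum big_nil.
by rewrite (linear0 (cf tau' s : {linear kH -> k^o})) /get3 !nth_nil peval0.
Qed.

Section Words.

Variables (R : rows) (atoms : seq vec) (env : var -> k) (us : nat -> kH).
Hypotheses (R_def : R = mk_rows P' keep8) (closed : closed_keep R keep8).
Hypotheses (atomsP : good keep8 tau' env us atoms) (us3 : us 3%N = 1).

Lemma den_word l : den env us (word l) = \prod_(n <- l) us n.
Proof.
suff E e : den env us (foldl (fun e n => Mul e (Atom n)) e l) =
    den env us e * \prod_(n <- l) us n by rewrite /word E /= us3 mul1r.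
elim: l e => [|n l IHl] e /=; first by rewrite big_nil mulr1.
by rewrite IHl /= big_cons mulrA.
Qed.

Lemma word_eqP l1 l2 : word_eq R atoms l1 l2 ->
  eqm 9 (\prod_(n <- l1) us n) (\prod_(n <- l2) us n).
Proof.
move/allP=> E; rewrite -!den_word; apply: (expv_cf char2 tauP') => // s s_box deg_s.
have s8 : s \in keep8 by rewrite mem_filter s_box andbT.
have s_keep : in_keep keep8 s by apply/hasP; exists s => //; apply/teqP.
have := E s s8; move/nilP/(congr1 (peval env)); rewrite pevalD // peval0.
rewrite !(eval_coefs char2 tauP' R_def closed _ atomsP s_keep) // => E0.
by rewrite -scaleN1r cfD cfZ (oppr_pchar2 char2) mul1r.
Qed.

Lemma word_rules :
  [&& word_eq R atoms (nseq 4 0%N) [::], word_eq R atoms (nseq 8 1%N) [::]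
    & word_eq R atoms (nseq 8 2%N) [::]] ->
  [&& word_eq R atoms [:: 1; 0]%N (0 :: nseq (p0 P) 1 ++ nseq (p1 P) 2)%N,
    word_eq R atoms [:: 2; 0]%N (0 :: nseq (q0 P) 1 ++ nseq (q1 P) 2)%N &
    word_eq R atoms [:: 2; 1]%N (1 :: nseq (rb P) 2)%N] ->
  (rb P == 1%N) || (p1 P == 0%N) && (q0 P == 0%N) ->
  nf_rules *%R 1 (eqm 9) P (us 0%N) (us 1%N) (us 2%N).
Proof.
case/and3P => /word_eqP A4 /word_eqP B8 /word_eqP C8.
case/and3P => /word_eqP BA /word_eqP CA /word_eqP CB splitP.
split.
- by move: A4; rewrite big_nseq big_nil.
- by move: B8; rewrite big_nseq big_nil.
- by move: C8; rewrite big_nseq big_nil.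
- by move: BA; rewrite !big_cons big_nil mulr1 big_cat !big_nseq.
- by move: CA; rewrite !big_cons big_nil mulr1 big_cat !big_nseq.
- by move: CB; rewrite !big_cons big_nil mulr1 !big_nseq.
by case/orP: splitP => [/eqP|/andP[/eqP ? /eqP ?]]; [left | right].
Qed.

End Words.

Lemma images_ok_isog SA SB SC : images_ok P P' SA SB SC ->
  (rb P == 1%N) || (p1 P == 0%N) && (q0 P == 0%N) -> aug_quot_isog k gT hT 9.
Proof.
case/and5P => closed deg2 /allP lP rels1 rels2 splitP.
have us3 : mon_sum (nth [::] (images SA SB SC) 3) = 1.
  by rewrite /mon_sum big_seq1 /mon !expr0 !mulr1.
have := word_rules (erefl _) closed (good_images (fun=> 0) lP) us3 rels1 rels2 splitP.
move=> {closed rels1 rels2 lP splitP us3}.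
move: deg2; rewrite !all_cat => /and3P[SA2 SB2 SC2].
apply: (images_isog char2 _ tauP tauP') => //=.
- by apply: mon_sum_eqm; rewrite // /mon expr1 !expr0 !mulr1.
- by apply: mon_sum_eqm; rewrite // /mon expr1 !expr0 mulr1 mul1r.
by apply: mon_sum_eqm; rewrite // /mon expr1 !expr0 !mul1r.
Qed.

End ImagesOk.

(* The terms of degree at least 2 of the images of the generators; they were found by computer. *)
Definition iso_images (i : nat) : seq triple * seq triple * seq triple :=
  if i == 1273%N then ([:: (0, 1, 3); (1, 1, 3); (1, 1, 5)],
 [:: (0, 1, 5); (0, 2, 5)],
 [:: (1, 0, 2); (1, 0, 3); (0, 0, 5); (3, 0, 2); (0, 1, 5); (3, 0, 3); (1, 1, 5)])%N
  else if i == 1275%N then ([:: (0, 1, 3); (1, 1, 3); (1, 1, 5)],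
 [:: (1, 4, 0); (0, 1, 5); (1, 5, 0); (0, 2, 5); (3, 4, 0)],
 [:: (1, 0, 2); (1, 0, 3); (0, 0, 5); (3, 0, 2); (0, 1, 5); (3, 0, 3); (1, 1, 5)])%N
  else if i == 1778%N then ([:: (2, 0, 3); (2, 2, 1); (1, 1, 4); (1, 2, 3); (1, 3, 2); (1, 4, 1);
    (2, 1, 3); (3, 0, 3); (3, 2, 1); (1, 1, 5); (1, 5, 1); (3, 1, 3)],
 [:: (0, 2, 2); (0, 2, 3); (0, 3, 3); (1, 0, 5); (1, 3, 2); (1, 1, 5)],
 [:: (0, 0, 2); (0, 1, 2); (0, 2, 1); (0, 3, 0); (0, 3, 3); (1, 2, 3); (1, 5, 0); (2, 2, 2);
   (0, 3, 4); (0, 5, 2); (1, 5, 1); (2, 1, 4); (2, 2, 3); (2, 4, 1)])%N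
  else ([:: (1, 2, 2); (2, 0, 3); (2, 1, 2); (2, 2, 1); (2, 3, 0); (1, 1, 4); (1, 3, 2); (2, 3, 1);
    (3, 0, 3); (3, 1, 2); (3, 2, 1); (3, 3, 0); (1, 1, 5); (1, 5, 1); (3, 3, 1)],
 [:: (0, 2, 2); (0, 2, 3); (0, 3, 2); (1, 3, 2); (2, 3, 2)],
 [:: (0, 0, 2); (0, 1, 2); (0, 2, 1); (0, 3, 0); (0, 1, 4); (0, 2, 3); (0, 3, 2); (0, 3, 3);
   (1, 5, 0); (2, 2, 2); (1, 2, 4); (1, 5, 1); (2, 1, 4); (2, 4, 1)])%N.

(** Each pair is oriented so that the relations of the first group are tested in the algebra of the
    second, for the isomorphisms and for the obstructions alike. In 1273 and 1275 the relation c^a =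
    c^7 is the short word c a c = a. *)
Definition iso_pairs : seq (nat * nat) := [:: (1273, 1272); (1275, 1274); (1778, 1781); (1779, 1780)]%N.

Lemma iso_images_ok ij : ij \in iso_pairs -> let S := iso_images ij.1 in
  images_ok (pres_of ij.1) (pres_of ij.2) S.1.1 S.1.2 S.2.
Proof.
move=> ijP; suff /allP/(_ ij ijP) : all (fun ij => let S := iso_images ij.1 in
    images_ok (pres_of ij.1) (pres_of ij.2) S.1.1 S.1.2 S.2) iso_pairs by [].
by vm_cast_no_check (erefl true).
Qed.

End Isomorphic.

(** * No isomorphism modulo the 10th powers *)

Section NonIsomorphic.

Local Open Scope ring_scope.

Definition known : Type := seq (seq (triple * fpoly)).

Definition unknowns (keep : seq triple) (kn : known) : seq vec :=
  [seq init keep i (nth [::] kn i) | i <- iota 0 (size kn)].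

(* The variable [(3, (0, 0, 0))] is a scalar parameter. *)
Definition par : var := (3, (0, 0, 0))%N.

Definition cert_ok (P : pres) (keep : seq triple) (rels : seq expr)
    (cert : seq (nat * seq step)) (kn : known) (eqs : seq (nat * triple * fpoly)) : bool :=
  let R := mk_rows P keep in
  [&& closed_keep R keep, all (fun s => deg s < 10)%N keep &
    all (fun e => [&& e.1.1 < size rels & final R keep rels cert e.1.1 9 e.1.2 (unknowns keep kn) == e.2])%N eqs].

Section Certificates.

Variables (k : fieldType) (char2 : 2%N \in [pchar k]).
Variables (hT : finGroupType) (a b c : hT) (P : pres) (tau : hT -> triple).
Hypothesis tauP : pbw_index a b c P tau.

Local Notation kH := (group_algebra k hT).
Local Notation IH := (aug_ideal k hT).
Local Notation cf := (cf (k := k) tau).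

(** The elements are the atoms 0 to 2, which leaves the index 3 to the scalar. *)
Definition env_of (t : k) (us : seq kH) (v : var) : k :=
  if v.1 == 3%N then t else cf v.2 (nth 0 us v.1).

Lemma cf0 s : cf s 0 = 0.
Proof. by rewrite -(scale0r (0 : kH)) cfZ mul0r. Qed.

Lemma good_unknowns keep (kn : known) (env : var -> k) (us : seq kH) :
  size kn = size us ->
  (forall s, in_keep keep s -> s \in box) ->
  (forall i s, (i < size us)%N -> env (i, s) = cf s (nth 0 us i)) ->
  (forall i e, (i < size us)%N -> e \in nth [::] kn i -> peval env e.2 = cf e.1 (nth 0 us i)) ->
  good keep tau env (nth 0 us) (unknowns keep kn).
Proof.
move=> szE keepP envP knP i s s_keep; have [lt_i|le_i] := ltnP i (size us); last first.
  by rewrite !nth_default ?size_map ?size_iota ?szE // /get3 !nth_nil peval0 cf0.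
rewrite (nth_map 0%N) ?size_iota ?szE // nth_iota ?szE // add0n /init get3_tab3 ?keepP //.
rewrite s_keep; case E: [seq _ <- _ | _] => [|e l]; first by rewrite pevalX envP.
have: e \in [seq e <- nth [::] kn i | teq e.1 s] by rewrite E mem_head.
by rewrite mem_filter => /andP[/teqP <- e_kn]; apply: knP.
Qed.

Lemma certP keep rels cert kn eqs t (us : seq kH) :
  cert_ok P keep rels cert kn eqs ->
  size kn = size us -> (size us <= 3)%N ->
  (forall n s, (n < size rels)%N -> s \in box -> (deg s < 10)%N ->
     cf s (den (env_of t us) (nth 0 us) (nth (Atom 0) rels n)) = 0) ->
  (forall i e, (i < size us)%N -> e \in nth [::] kn i ->
     peval (env_of t us) e.2 = cf e.1 (nth 0 us i)) ->
  forall e, e \in eqs -> peval (env_of t us) e.2 = 0.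
Proof.
case/and3P => closed /allP keep10 /allP eqsP szE le3 relsP knP e /eqsP/andP[lt_e /eqP <-].
have keep_box s : in_keep keep s -> s \in box by exact: (in_keep_box closed).
have envP i s : (i < size us)%N -> env_of t us (i, s) = cf s (nth 0 us i).
  by rewrite /env_of /=; case: eqP => // -> /leq_trans/(_ le3).
apply: (final_sound char2 tauP (erefl _) closed (us := nth 0 us)) => //.
  move=> n s lt_n s_keep; apply: relsP; rewrite ?keep_box //.
  by case/hasP: s_keep => u /keep10 ? /teqP->.
exact: good_unknowns.
Qed.

Lemma cf_eqm m s (u v : kH) : eqm m u v -> s \in box -> (deg s < m)%N -> cf s (u + v) = 0.
Proof.
move=> uv s_box lt_s; rewrite -(cf_expv char2 tauP uv s_box lt_s).
by rewrite -scaleN1r !cfD cfZ (oppr_pchar2 char2) mul1r.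
Qed.

End Certificates.

Definition ex : triple := (1, 0, 0)%N.
Definition ey : triple := (0, 1, 0)%N.
Definition ez : triple := (0, 0, 1)%N.

(** * Linear parts of a lifted isomorphism *)

Section Lift.

Variables (k : fieldType) (char2 : 2%N \in [pchar k]).
Variables (hT : finGroupType) (a' b' c' : hT) (P : pres) (tau : hT -> triple).
Hypothesis tauP : pbw_index a' b' c' P tau.

Local Notation kH := (group_algebra k hT).
Local Notation IH := (aug_ideal k hT).
Local Notation cf := (cf (k := k) tau).

Variables (gT : finGroupType) (A : gT -> kH).

(* [A] is the lift of an isomorphism modulo the 10th powers of the augmentation ideals. *)
Record is_lift : Prop := IsLift {
  lift_sub1 g : A g - 1 \in IH;
  lift_1 : eqm 10 (A 1%g) 1;
  lift_M g h : eqm 10 (A (g * h)%g) (A g * A h);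
  lift_sep (L : {linear kH -> k^o}) (S : {set gT}) : <<S>>%g = [set: gT] ->
    (forall u, u \in (IH ^+ 2)%VS -> L u = 0) ->
    (forall g, g \in S -> L (A g - 1) = 0) -> forall w, w \in IH -> L w = 0 }.

Hypothesis A_lift : is_lift.

Lemma lift_mul g h X Y : eqm 10 (A g) X -> eqm 10 (A h) Y -> eqm 10 (A (g * h)%g) (X * Y).
Proof.
move=> gX hY; have [_ symm trans] := @eqm_equiv k hT 10.
by apply: trans (lift_M A_lift g h) _; apply: eqm_mul.
Qed.

Lemma cf_lift0 g : cf (0, 0, 0)%N (A g) = 1.
Proof.
rewrite -(subrK 1 (A g)) cfD (cf_box1 k tauP) // eqxx cf_aug.
by have := lift_sub1 A_lift g; rewrite mem_aug_ideal => /eqP->; rewrite add0r.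
Qed.

Lemma cf_lift_mul s g h : s \in box -> deg s = 1%N ->
  cf s (A (g * h)%g) = cf s (A g) + cf s (A h).
Proof.
move=> s_box deg_s; have cf1 : cf s 1 = 0.
  by rewrite (cf_box1 k tauP) //; case: eqP deg_s => // ->.
have sub1 (u : kH) : cf s (u - 1) = cf s u by rewrite -scaleN1r cfD cfZ cf1 mulr0 addr0.
have := cf_eqm char2 tauP (lift_M A_lift g h) s_box; rewrite deg_s cfD => /(_ isT) E.
rewrite -(sub1 (A g)) -(sub1 (A h)) -cfD.
have -> : cf s (A (g * h)%g) = cf s (A g * A h).
  by apply: (addIr (cf s (A g * A h))); rewrite E (addxx char2).
have gh2 : (A g - 1) * (A h - 1) \in (IH ^+ 2)%VS.
  by rewrite expv2 memv_mul ?(lift_sub1 A_lift).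
by rewrite -(sub1 (A g * A h)) mul_sub1 [LHS]cfD (cf_expv char2 tauP gh2) ?add0r // deg_s.
Qed.

(** A functional on I/I^2 that kills the linear parts of three generators is zero, so the matrix of
    these linear parts has trivial kernel. *)
Lemma lift_nondeg a b c x y z : <<[set a; b; c]>>%g = [set: gT] ->
  (forall g, g \in [set a; b; c] -> x * cf ex (A g) + y * cf ey (A g) + z * cf ez (A g) = 0) ->
  [/\ x = 0, y = 0 & z = 0].
Proof.
move=> gen_abc L0.
pose L (u : kH) : k^o := x * cf ex u + y * cf ey u + z * cf ez u.
have L_lin : linear L.
  by move=> r u v; rewrite /L !cfD !cfZ /GRing.scale /=; ring.
pose F : {linear kH -> k^o} := HB.pack L (GRing.isLinear.Build k _ _ _ L L_lin).
have L_I w : w \in IH -> L w = 0.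
  apply: (lift_sep A_lift (L := F) gen_abc) => [u Iu | g gS].
    by rewrite /= /L !(cf_expv char2 tauP Iu) // !mulr0 !addr0.
  have sub1 s : s \in box -> deg s = 1%N -> cf s (A g - 1) = cf s (A g).
    move=> s_box deg_s; rewrite -scaleN1r cfD cfZ (cf_box1 k tauP) //.
    by case: eqP deg_s => [->|_ _]; rewrite // mulr0 addr0.
  by rewrite /= /L !sub1 // L0.
have LE s : s \in box -> deg s = 1%N ->
    x * (ex == s)%:R + y * (ey == s)%:R + z * (ez == s)%:R = 0.
  move=> s_box deg_s; rewrite -(L_I (mon k a' b' c' s)) ?/L ?(cf_mon char2 tauP) //.
  by rewrite -[IH]expv1 -deg_s; apply: mon_expv.
have := LE ex isT (erefl _); have := LE ey isT (erefl _); have := LE ez isT (erefl _).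
by rewrite /= !mulr1 !mulr0 !add0r !addr0.
Qed.

End Lift.

(* The relations of SG(2^8, 1778) or SG(2^8, 1779) are tested on elements of the
   group algebra of SG(2^8, 1781) or SG(2^8, 1780). *)
Definition rels34 (i : nat) : seq expr :=
  [:: if i == 1778%N then Add (Mul (Atom 1) (Atom 0)) (Mul (Mul (Atom 0) (Atom 1)) (Mul (Atom 2) (Atom 2)))
      else Add (Mul (Mul (Atom 1) (Atom 0)) (Mul (Atom 2) (Atom 2))) (Mul (Atom 0) (Atom 1));
      Add (Mul (Atom 2) (Atom 0)) (Mul (Mul (Atom 0) (Mul (Atom 1) (Atom 1))) (Atom 2));
      Add (Mul (Atom 2) (Atom 1)) (Mul (Atom 1) (Atom 2))].

Definition target34 (i : nat) : nat := if i == 1778%N then 1781 else 1780.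

Definition keep_deg (d : nat) : seq triple := [seq s <- box | deg s <= d]%N.

Definition unit_known : known := nseq 3 [:: ((0, 0, 0)%N, [:: [::]])].

Definition deg3_known : known :=
  [:: [:: ((0, 0, 0), [:: [::]])];
      [:: ((0, 0, 0), [:: [::]]); ((1, 0, 0), [::]); ((0, 0, 1), [::])];
      [:: ((0, 0, 0), [:: [::]]); ((1, 0, 0), [::]); ((0, 1, 0), [::])]]%N.

(* [T] stands for the sum of the coordinates [y^2] and [z^2] of B and C: the certificate 34a gives
   T^2 + T = 0, and the certificates 34b and 34c refute T = 0 and T = 1. *)
Definition unit_linear_known (T : fpoly) : known :=
  [:: [:: ((0, 0, 0), [:: [::]]); ((1, 0, 0), [:: [::]])];
      [:: ((0, 0, 0), [:: [::]]); ((1, 0, 0), [::]); ((0, 1, 0), [:: [::]]); ((0, 0, 1), [::])];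
      [:: ((0, 0, 0), [:: [::]]); ((1, 0, 0), [::]); ((0, 1, 0), [::]); ((0, 0, 1), [:: [::]]);
        ((0, 0, 2), psum [:: pvar (1, (0, 2, 0)); pvar (1, (0, 0, 2)); pvar (2, (0, 2, 0)); T])]]%N.

Definition eqs34_deg2 : seq (nat * triple * fpoly) :=
  [:: (0, (2, 0, 0), [:: [:: (2, (1, 0, 0)); (2, (1, 0, 0))]]);
      (1, (2, 0, 0), [:: [:: (1, (1, 0, 0)); (1, (1, 0, 0))]]);
      (0, (0, 0, 2), [:: [:: (2, (0, 0, 1)); (2, (0, 0, 1))]; [:: (0, (0, 1, 0)); (1, (1, 0, 0))];
        [:: (1, (0, 1, 0)); (0, (1, 0, 0))]; [:: (2, (0, 1, 0)); (2, (1, 0, 0))]]);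
      (0, (0, 2, 0), [:: [:: (0, (0, 0, 1)); (1, (1, 0, 0))]; [:: (1, (0, 0, 1)); (0, (1, 0, 0))];
        [:: (2, (0, 0, 1)); (2, (1, 0, 0))]; [:: (2, (0, 1, 0)); (2, (0, 1, 0))]]);
      (1, (0, 0, 2), [:: [:: (1, (0, 0, 1)); (1, (0, 0, 1))]; [:: (0, (0, 1, 0)); (2, (1, 0, 0))];
        [:: (1, (0, 1, 0)); (1, (1, 0, 0))]; [:: (2, (0, 1, 0)); (0, (1, 0, 0))]]);
      (1, (0, 2, 0), [:: [:: (0, (0, 0, 1)); (2, (1, 0, 0))]; [:: (1, (0, 0, 1)); (1, (1, 0, 0))];
        [:: (2, (0, 0, 1)); (0, (1, 0, 0))]; [:: (1, (0, 1, 0)); (1, (0, 1, 0))]])]%N.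

Definition eqs34_deg3 : seq (nat * triple * fpoly) :=
  [:: (2, (0, 3, 0), [:: [:: (2, (0, 0, 1)); (1, (1, 1, 0))]]);
      (2, (0, 0, 3), [:: [:: (1, (0, 1, 0)); (2, (1, 0, 1))]]);
      (1, (1, 0, 2), [:: [:: (0, (1, 0, 0)); (2, (1, 1, 0))]]);
      (0, (1, 2, 0), [:: [:: (0, (1, 0, 0)); (1, (1, 0, 1))]]);
      (0, (1, 0, 2), [:: [:: (2, (0, 0, 1)); (2, (0, 0, 1)); (0, (1, 0, 0))]; [:: (1, (0, 1, 0));
        (0, (1, 0, 0))]; [:: (0, (1, 0, 0)); (1, (1, 1, 0))]]);
      (1, (1, 2, 0), [:: [:: (2, (0, 0, 1)); (0, (1, 0, 0))]; [:: (1, (0, 1, 0)); (1, (0, 1, 0));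
        (0, (1, 0, 0))]; [:: (0, (1, 0, 0)); (2, (1, 0, 1))]]);
      (0, (0, 3, 0), [:: [:: (0, (0, 0, 1)); (1, (1, 1, 0))]; [:: (2, (0, 0, 1)); (2, (1, 1, 0))];
        [:: (1, (0, 1, 1)); (0, (1, 0, 0))]]);
      (0, (0, 0, 3), [:: [:: (0, (0, 0, 1)); (2, (0, 0, 1)); (2, (0, 0, 1))]; [:: (0, (0, 1, 0));
        (1, (1, 0, 1))]; [:: (1, (0, 1, 0)); (0, (1, 0, 1))]; [:: (1, (0, 1, 1)); (0, (1, 0, 0))]]);
      (1, (0, 2, 1), [:: [:: (0, (0, 0, 1)); (1, (0, 1, 0)); (1, (0, 1, 0))]; [:: (0, (0, 0, 1));
        (2, (1, 0, 1))]; [:: (2, (0, 0, 1)); (1, (0, 1, 0)); (1, (0, 1, 0))]; [:: (2, (0, 0, 1));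
        (0, (1, 0, 0))]; [:: (2, (0, 0, 1)); (0, (1, 0, 1))]])]%N.

Definition keep34a : seq triple := [:: (0, 0, 0); (0, 0, 1); (0, 0, 2); (0, 0, 3); (0, 0, 4);
  (0, 0, 5); (0, 1, 0); (0, 1, 1); (0, 1, 2); (0, 1, 3); (0, 2, 0); (0, 2, 1); (0, 2, 2); (0, 2, 3);
  (0, 3, 0); (0, 3, 1); (0, 3, 2); (0, 4, 0); (0, 4, 1); (0, 5, 0); (1, 0, 0); (1, 0, 1); (1, 0, 2);
  (1, 0, 3); (1, 0, 4); (1, 1, 0); (1, 1, 1); (1, 1, 2); (1, 2, 0); (1, 2, 1); (1, 3, 0); (2, 0, 0);
  (2, 0, 1); (2, 0, 2); (2, 1, 0); (2, 2, 0); (3, 0, 0)]%N.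

Definition cert34a : seq (nat * seq step) :=
 [:: (3, [:: (0, (1, 0, 2), (1, (1, 1, 0))); (0, (1, 2, 0), (1, (1, 0, 1)));
   (0, (0, 2, 1), (2, (1, 0, 1))); (1, (0, 0, 3), (2, (0, 1, 1))); (1, (1, 0, 2), (2, (1, 1, 0)));
   (0, (0, 3, 0), (1, (0, 1, 1))); (0, (0, 0, 3), (0, (1, 0, 1))); (0, (0, 1, 2), (0, (1, 1, 0)))]);
  (4, [:: (0, (1, 0, 3), (1, (1, 1, 1))); (0, (0, 3, 1), (2, (1, 1, 1)));
    (2, (2, 0, 2), (2, (3, 0, 0))); (2, (2, 2, 0), (1, (3, 0, 0))); (0, (2, 2, 0), (1, (2, 0, 1)));
    (1, (2, 0, 2), (2, (2, 1, 0))); (0, (0, 1, 3), (0, (1, 1, 1))); (2, (0, 2, 2), (2, (1, 2, 0)));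
    (2, (0, 0, 4), (2, (1, 0, 2))); (2, (0, 4, 0), (1, (1, 2, 0))); (0, (2, 0, 2), (1, (2, 1, 0)));
    (1, (2, 2, 0), (2, (2, 0, 1))); (0, (0, 4, 0), (1, (0, 2, 1))); (1, (0, 0, 4), (2, (0, 1, 2)));
    (0, (0, 2, 2), (1, (0, 0, 3))); (1, (0, 4, 0), (2, (0, 2, 1))); (1, (0, 2, 2), (2, (0, 0, 3)));
    (0, (0, 0, 4), (1, (0, 1, 2)))]);
  (5, [:: (2, (1, 0, 4), (2, (2, 0, 0))); (1, (1, 0, 4), (2, (1, 1, 2)));
    (2, (0, 0, 5), (2, (1, 0, 3))); (2, (0, 2, 3), (2, (1, 2, 1))); (2, (0, 3, 2), (2, (1, 3, 0)));
    (2, (0, 4, 1), (1, (1, 2, 1))); (2, (0, 5, 0), (1, (1, 3, 0))); (0, (1, 0, 4), (1, (1, 1, 2)));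
    (1, (0, 2, 3), (2, (0, 3, 1))); (0, (0, 5, 0), (1, (0, 3, 1))); (0, (0, 3, 2), (1, (0, 1, 3)));
    (0, (0, 2, 3), (0, (1, 2, 1))); (1, (0, 4, 1), (2, (0, 3, 0)));
    (0, (0, 0, 5), (0, (1, 0, 3)))])]%N.

Definition keep34b : seq triple := [:: (0, 0, 0); (0, 0, 1); (0, 0, 2); (0, 0, 3); (0, 0, 4);
  (0, 0, 5); (0, 0, 6); (0, 0, 7); (0, 1, 0); (0, 1, 1); (0, 1, 2); (0, 1, 3); (0, 1, 4); (0, 1, 5);
  (0, 1, 6); (0, 2, 0); (0, 2, 1); (0, 2, 2); (0, 2, 3); (0, 2, 4); (0, 2, 5); (0, 3, 0); (0, 3, 1);
  (0, 3, 2); (0, 3, 3); (0, 3, 4); (0, 4, 0); (0, 4, 1); (0, 4, 2); (0, 4, 3); (0, 5, 0); (0, 5, 1);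
  (0, 5, 2); (0, 6, 0); (0, 6, 1); (0, 7, 0); (1, 0, 0); (1, 0, 1); (1, 0, 2); (1, 0, 3); (1, 0, 4);
  (1, 0, 5); (1, 1, 0); (1, 1, 1); (1, 1, 2); (1, 1, 3); (1, 1, 4); (1, 2, 0); (1, 2, 1); (1, 2, 2);
  (1, 2, 3); (1, 2, 4); (1, 3, 0); (1, 3, 1); (1, 3, 2); (1, 4, 0); (1, 4, 1); (1, 5, 0); (2, 0, 0);
  (2, 0, 1); (2, 0, 2); (2, 0, 3); (2, 1, 0); (2, 1, 1); (2, 1, 2); (2, 2, 0); (2, 2, 1); (2, 3, 0);
  (2, 4, 0); (3, 0, 0); (3, 0, 1); (3, 1, 0); (3, 2, 0)]%N.

Definition cert34b : seq (nat * seq step) :=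
 [:: (3, [:: (0, (1, 0, 2), (1, (1, 1, 0))); (0, (1, 2, 0), (1, (1, 0, 1)));
   (0, (0, 2, 1), (2, (1, 0, 1))); (1, (0, 0, 3), (2, (0, 1, 1))); (1, (1, 0, 2), (2, (1, 1, 0)));
   (0, (0, 3, 0), (1, (0, 1, 1))); (0, (0, 0, 3), (0, (1, 0, 1))); (0, (0, 1, 2), (0, (1, 1, 0)))]);
  (4, [:: (0, (1, 0, 3), (1, (1, 1, 1))); (0, (0, 3, 1), (2, (1, 1, 1)));
    (2, (2, 0, 2), (2, (3, 0, 0))); (2, (2, 2, 0), (1, (3, 0, 0))); (0, (2, 2, 0), (1, (2, 0, 1)));
    (1, (2, 0, 2), (2, (2, 1, 0))); (0, (0, 1, 3), (0, (1, 1, 1))); (2, (0, 2, 2), (2, (1, 2, 0)));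
    (2, (0, 0, 4), (2, (1, 0, 2))); (2, (0, 4, 0), (1, (1, 2, 0))); (0, (2, 0, 2), (1, (2, 1, 0)));
    (1, (2, 2, 0), (2, (2, 0, 1))); (0, (0, 4, 0), (1, (0, 2, 1))); (1, (0, 0, 4), (2, (0, 1, 2)));
    (0, (0, 2, 2), (1, (0, 0, 3))); (1, (0, 4, 0), (2, (0, 2, 1))); (1, (0, 2, 2), (2, (0, 0, 3)));
    (0, (0, 0, 4), (1, (0, 1, 2)))]);
  (5, [:: (0, (3, 2, 0), (1, (3, 0, 1))); (0, (2, 2, 1), (2, (3, 0, 1)));
    (1, (2, 0, 3), (2, (2, 1, 1))); (2, (2, 1, 2), (2, (3, 1, 0))); (1, (2, 1, 2), (1, (3, 1, 0)));
    (0, (2, 3, 0), (1, (2, 1, 1))); (1, (3, 2, 0), (0, (3, 0, 0))); (2, (0, 1, 4), (2, (1, 1, 2)));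
    (2, (0, 4, 1), (1, (1, 2, 1))); (0, (2, 0, 3), (0, (3, 0, 1))); (0, (2, 1, 2), (0, (3, 1, 0)));
    (2, (1, 0, 4), (2, (2, 0, 0))); (2, (0, 0, 5), (2, (1, 0, 3))); (2, (0, 5, 0), (1, (1, 3, 0)));
    (2, (0, 2, 3), (2, (1, 2, 1))); (2, (0, 3, 2), (2, (1, 3, 0))); (0, (1, 2, 2), (1, (1, 0, 3)));
    (0, (1, 0, 4), (1, (1, 1, 2))); (0, (0, 3, 2), (1, (0, 1, 3))); (1, (0, 2, 3), (2, (0, 3, 1)));
    (0, (0, 4, 1), (1, (0, 3, 0))); (0, (0, 0, 5), (0, (1, 0, 3))); (0, (0, 2, 3), (1, (0, 3, 1)));
    (1, (0, 0, 5), (2, (0, 1, 3))); (1, (0, 1, 4), (2, (0, 3, 0))); (0, (0, 1, 4), (0, (1, 1, 2)));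
    (0, (0, 5, 0), (0, (1, 2, 1)))]);
  (6, [:: (0, (1, 5, 0), (1, (1, 3, 1))); (1, (1, 0, 5), (2, (1, 1, 3)));
    (2, (2, 4, 0), (1, (3, 2, 0))); (2, (0, 3, 3), (2, (1, 3, 1))); (0, (1, 0, 5), (1, (1, 1, 3)));
    (0, (1, 1, 4), (1, (1, 0, 2))); (0, (0, 3, 3), (0, (1, 3, 1))); (0, (0, 5, 1), (0, (2, 1, 1)));
    (0, (0, 1, 5), (0, (1, 1, 3))); (0, (2, 4, 0), (2, (3, 2, 0))); (2, (0, 0, 6), (2, (2, 0, 2)));
    (2, (0, 6, 0), (2, (2, 2, 0))); (2, (0, 2, 4), (2, (1, 2, 2))); (2, (0, 4, 2), (1, (1, 2, 2)));
    (1, (2, 4, 0), (2, (2, 2, 1))); (0, (0, 6, 0), (1, (0, 2, 2))); (1, (0, 0, 6), (2, (0, 2, 2)));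
    (0, (0, 2, 4), (1, (0, 3, 2))); (1, (0, 4, 2), (2, (0, 2, 3))); (0, (0, 0, 6), (0, (2, 0, 2)));
    (1, (0, 2, 4), (2, (0, 3, 2)))]);
  (7, [:: (2, (1, 2, 4), (1, (2, 2, 1))); (2, (0, 6, 1), (0, (3, 2, 0)));
    (2, (0, 1, 6), (2, (2, 1, 2))); (2, (0, 7, 0), (2, (2, 3, 0))); (2, (0, 0, 7), (2, (2, 0, 3)));
    (2, (0, 2, 5), (2, (1, 2, 3))); (2, (0, 5, 2), (1, (1, 3, 2))); (2, (0, 3, 4), (2, (1, 3, 2)));
    (2, (0, 4, 3), (1, (1, 2, 3))); (0, (1, 2, 4), (0, (1, 2, 2))); (0, (0, 6, 1), (1, (0, 2, 3)));
    (1, (0, 3, 4), (0, (2, 3, 0))); (0, (0, 1, 6), (0, (2, 1, 2))); (1, (0, 0, 7), (0, (2, 0, 3)));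
    (0, (0, 3, 4), (0, (1, 3, 2))); (1, (0, 5, 2), (2, (0, 3, 3)));
    (1, (0, 2, 5), (0, (2, 2, 1)))])]%N.

Definition keep34c : seq triple := [:: (0, 0, 0); (0, 0, 1); (0, 0, 2); (0, 0, 3); (0, 0, 4);
  (0, 0, 5); (0, 0, 6); (0, 0, 7); (0, 1, 0); (0, 1, 1); (0, 1, 2); (0, 1, 3); (0, 1, 4); (0, 1, 5);
  (0, 1, 6); (0, 1, 7); (0, 2, 0); (0, 2, 1); (0, 2, 2); (0, 2, 3); (0, 2, 4); (0, 2, 5); (0, 3, 0);
  (0, 3, 1); (0, 3, 2); (0, 3, 3); (0, 3, 4); (1, 0, 0); (1, 0, 1); (1, 0, 2); (1, 0, 3); (1, 0, 4);
  (1, 0, 5); (1, 0, 6); (1, 0, 7); (1, 1, 0); (1, 1, 1); (1, 1, 2); (1, 1, 3); (1, 1, 4); (1, 1, 5);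
  (1, 1, 6); (1, 1, 7); (1, 2, 0); (1, 2, 1); (1, 2, 2); (1, 2, 3); (1, 2, 4); (1, 2, 5); (1, 3, 0);
  (1, 3, 1); (1, 3, 2); (1, 3, 3); (1, 3, 4); (2, 0, 0); (2, 0, 1); (2, 0, 2); (2, 0, 3); (2, 1, 0);
  (2, 1, 1); (2, 1, 2); (2, 1, 3); (2, 2, 0); (2, 2, 1); (2, 3, 0); (3, 0, 0); (3, 0, 1); (3, 0, 2);
  (3, 0, 3); (3, 1, 0); (3, 1, 1); (3, 1, 2); (3, 1, 3); (3, 2, 0); (3, 2, 1); (3, 3, 0)]%N.

Definition cert34c : seq (nat * seq step) :=
 [:: (3, [:: (0, (1, 0, 2), (1, (1, 1, 0))); (0, (1, 2, 0), (1, (1, 0, 1)));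
   (0, (0, 2, 1), (2, (1, 0, 1))); (1, (0, 0, 3), (2, (0, 1, 1))); (1, (1, 0, 2), (2, (1, 1, 0)));
   (0, (0, 3, 0), (1, (0, 1, 1))); (0, (0, 0, 3), (0, (1, 0, 1))); (0, (0, 1, 2), (0, (1, 1, 0)))]);
  (4, [:: (0, (1, 0, 3), (1, (1, 1, 1))); (0, (0, 3, 1), (2, (1, 1, 1)));
    (2, (2, 0, 2), (2, (3, 0, 0))); (2, (2, 2, 0), (1, (3, 0, 0))); (0, (2, 2, 0), (1, (2, 0, 1)));
    (1, (2, 0, 2), (2, (2, 1, 0))); (0, (0, 1, 3), (0, (1, 1, 1))); (2, (0, 2, 2), (2, (1, 2, 0)));
    (2, (0, 0, 4), (2, (1, 0, 2))); (0, (2, 0, 2), (1, (2, 1, 0))); (1, (2, 2, 0), (2, (2, 0, 1)));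
    (0, (0, 2, 2), (1, (0, 0, 3))); (1, (0, 0, 4), (2, (0, 1, 2))); (1, (0, 2, 2), (2, (0, 0, 3)));
    (0, (0, 0, 4), (1, (0, 1, 2)))]);
  (5, [:: (0, (3, 2, 0), (1, (3, 0, 1))); (0, (2, 2, 1), (2, (3, 0, 1)));
    (1, (2, 0, 3), (2, (2, 1, 1))); (1, (3, 0, 2), (2, (3, 1, 0))); (1, (2, 1, 2), (1, (3, 1, 0)));
    (0, (2, 3, 0), (1, (2, 1, 1))); (0, (3, 0, 2), (0, (3, 0, 0))); (2, (0, 1, 4), (2, (1, 1, 2)));
    (0, (2, 0, 3), (0, (3, 0, 1))); (0, (2, 1, 2), (0, (3, 1, 0))); (2, (1, 0, 4), (2, (2, 0, 0)));
    (2, (0, 0, 5), (2, (1, 0, 3))); (2, (0, 2, 3), (2, (1, 2, 1))); (2, (0, 3, 2), (2, (1, 3, 0)));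
    (0, (1, 0, 4), (1, (1, 1, 2))); (0, (1, 2, 2), (1, (1, 0, 3))); (0, (0, 2, 3), (1, (0, 3, 1)));
    (0, (0, 3, 2), (1, (0, 1, 3))); (0, (0, 0, 5), (0, (1, 0, 3))); (1, (0, 3, 2), (2, (0, 1, 3)));
    (1, (0, 0, 5), (0, (1, 1, 2))); (1, (0, 1, 4), (2, (0, 3, 0))); (0, (0, 1, 4), (2, (0, 2, 1)));
    (1, (0, 2, 3), (2, (0, 3, 1)))]);
  (6, [:: (0, (3, 0, 3), (1, (3, 1, 1))); (1, (1, 0, 5), (2, (1, 1, 3)));
    (1, (3, 0, 3), (2, (3, 1, 1))); (0, (2, 1, 3), (0, (3, 1, 1))); (2, (0, 3, 3), (2, (1, 3, 1)));
    (0, (1, 1, 4), (1, (1, 3, 0))); (0, (1, 3, 2), (1, (1, 1, 3))); (0, (1, 0, 5), (1, (1, 2, 1)));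
    (1, (0, 1, 5), (0, (2, 1, 1))); (0, (0, 1, 5), (0, (1, 1, 3))); (2, (0, 0, 6), (2, (2, 0, 2)));
    (0, (1, 2, 3), (1, (1, 3, 1))); (2, (0, 2, 4), (2, (1, 2, 2)))]);
  (7, [:: (2, (1, 2, 4), (2, (3, 2, 0))); (2, (1, 0, 6), (2, (3, 0, 2)));
    (2, (0, 1, 6), (2, (2, 1, 2))); (2, (0, 0, 7), (2, (2, 0, 3))); (0, (1, 0, 6), (1, (1, 2, 2)));
    (1, (1, 2, 4), (2, (1, 3, 2))); (1, (1, 0, 6), (0, (3, 0, 2))); (0, (1, 2, 4), (1, (1, 3, 2)));
    (2, (0, 3, 4), (2, (0, 3, 2))); (2, (0, 2, 5), (2, (1, 2, 3)))]);
  (8, [:: (2, (1, 2, 5), (2, (3, 2, 1))); (2, (1, 3, 4), (2, (3, 3, 0)));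
    (2, (1, 1, 6), (2, (3, 1, 2))); (2, (1, 0, 7), (2, (3, 0, 3))); (2, (0, 1, 7), (2, (2, 1, 3)));
    (0, (1, 2, 5), (1, (1, 3, 3))); (1, (1, 3, 4), (0, (3, 3, 0))); (0, (1, 3, 4), (2, (1, 1, 5)));
    (0, (1, 0, 7), (1, (1, 2, 3))); (1, (1, 1, 6), (0, (3, 1, 2))); (0, (1, 1, 6), (2, (1, 0, 5)));
    (1, (1, 2, 5), (2, (1, 3, 3))); (1, (1, 0, 7), (0, (3, 0, 3)))]);
  (9, [:: (2,(1,1,7),(2,(3,1,3))); (0,(1,1,7),(0,(3,1,3)))])]%N.

(** T = 1 is the branch of the isomorphisms modulo I^9 in [iso_images], where z^2 in C is the only
    one of the four terms present. Its contradiction can thus appear only in degree 9, at x y z^7,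
    whereas T = 0 already fails at z^7. *)
Lemma certs34 i : i \in [:: 1778; 1779]%N -> let P := pres_of (target34 i) in
  [/\ cert_ok P (keep_deg 2) (rels34 i) [::] unit_known eqs34_deg2,
      cert_ok P (keep_deg 3) (rels34 i) [::] deg3_known eqs34_deg3,
      cert_ok P keep34a (rels34 i) cert34a (unit_linear_known [:: [:: par]])
        [:: (1, (0, 5, 0), [:: [:: par; par]; [:: par]])]%N,
      cert_ok P keep34b (rels34 i) cert34b (unit_linear_known [::]) [:: (0, (0, 0, 7), [:: [::]])]%N &
      cert_ok P keep34c (rels34 i) cert34c (unit_linear_known [:: [::]]) [:: (1, (1, 1, 7), [:: [::]])]%N].
Proof. by rewrite !inE => /orP[] /eqP->; split; vm_cast_no_check (erefl true). Qed.

(** * The obstruction for 1778 and 1779 *)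

Section Obstruction34.

Variables (k : fieldType) (char2 : 2%N \in [pchar k]).

Lemma addr_eq0_pchar2 (x y : k) : x + y = 0 -> x = y.
Proof. by move/eqP; rewrite addr_eq0 (oppr_pchar2 char2) => /eqP. Qed.

(** If zy and zz are both nonzero, the equations give each of them the cube x^3. Then x times the
    determinant yy zz + yz zy equals zz^3 + zy^3 = 0, against the independence of the linear
    parts. *)
Lemma linear34_solve (x yy yz zy zz : k) : x != 0 ->
  zz * zz = yy * x -> yz * x = zy * zy -> yz * yz = zy * x -> zz * x = yy * yy ->
  (forall y z, y * yy + z * yz = 0 -> y * zy + z * zz = 0 -> y = 0 /\ z = 0) ->
  (zy = 0 /\ [/\ yz = 0, yy != 0, zz != 0 & x * yy = zz ^+ 2]) \/ [/\ zy != 0, zz = 0 & yy = 0].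
Proof.
move=> x_neq0 e1 e2 e3 e4 sep.
have x0 u : u * x = 0 -> u = 0 by move/eqP; rewrite mulf_eq0 (negPf x_neq0) orbF => /eqP.
have [zy0|zy_neq0] := eqVneq zy 0; [left | right].
  have yz0 : yz = 0 by apply: x0; rewrite e2 zy0 mul0r.
  have zz_neq0 : zz != 0.
    apply/eqP => zz0; have yy0 : yy = 0 by apply: x0; rewrite -e1 zz0 mul0r.
    have [||/eqP] := sep 1 0; rewrite ?yy0 ?yz0 ?zy0 ?zz0 ?mulr0 ?addr0 //.
    by rewrite oner_eq0.
  split=> //; split; rewrite // ?expr2 1?mulrC //.
  by apply: contraNneq zz_neq0 => yy0; rewrite -[zz == 0]orbb -mulf_eq0 e1 yy0 mul0r.
have cube u v : u != 0 -> u * u = v * x -> u * x = v * v -> u ^+ 3 = x ^+ 3.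
  move=> u_neq0 uv vu; apply: (mulIf u_neq0); rewrite -exprSr.
  transitivity ((u * u) ^+ 2); first by rewrite -expr2 -exprM.
  by rewrite uv exprMn [v ^+ 2]expr2 -vu -mulrA -exprS mulrC.
have [zz0|zz_neq0] := eqVneq zz 0.
  by split=> //; apply: x0; rewrite -e1 zz0 mul0r.
have [||/eqP yz0 _] := sep yz yy; first by rewrite mulrC (addxx char2).
  apply: x0; rewrite mulrDl mulrAC e2 [yy * zz * x]mulrAC -e1 -!expr2 -!exprSr.
  by rewrite (cube zy yz) // (cube zz yy) // (addxx char2).
by move: zy_neq0; rewrite -[zy == 0]orbb -mulf_eq0 -e2 (eqP yz0) mul0r eqxx.
Qed.

(** Once the four monomial equations have removed their unknowns, yy = zz^2, zz = yy^2 and x = 1, so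
    zz is a cube root of unity. The last two equations, which share the unknown xxz, give zz^2 = zz
    and exclude the primitive roots, which exist when k contains F_4. *)
Lemma unit_solve (x yy zz xy xz yxy yxz zxy zxz yyz xxz : k) :
  x != 0 -> yy != 0 -> zz != 0 -> x * yy = zz ^+ 2 ->
  zz * yxy = 0 -> yy * zxz = 0 -> x * zxy = 0 -> x * yxz = 0 ->
  zz * (zz * x) + (yy * x + x * yxy) = 0 ->
  zz * x + (yy * (yy * x) + x * zxz) = 0 ->
  xz * yxy + (zz * zxy + yyz * x) = 0 ->
  xz * (zz * zz) + (xy * yxz + (yy * xxz + yyz * x)) = 0 ->
  xz * (yy * yy) + (xz * zxz + (zz * (yy * yy) + (zz * x + zz * xxz))) = 0 ->
  [/\ x = 1, yy = 1 & zz = 1].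
Proof.
move=> x_neq0 yy_neq0 zz_neq0 e1.
have mul0 (u v : k) : u != 0 -> u * v = 0 -> v = 0.
  by move=> u_neq0 /eqP; rewrite mulf_eq0 (negPf u_neq0) => /eqP.
move=> /(mul0 _ _ zz_neq0)-> /(mul0 _ _ yy_neq0)-> /(mul0 _ _ x_neq0)-> /(mul0 _ _ x_neq0)->.
rewrite !mulr0 !addr0 !add0r !mulrA -!mulrDl => /eqP; rewrite mulf_eq0 (negPf x_neq0) orbF.
move=> /eqP/addr_eq0_pchar2 yyE /eqP; rewrite mulf_eq0 (negPf x_neq0) orbF.
move=> /eqP/addr_eq0_pchar2 zzE /eqP; rewrite mulf_eq0 (negPf x_neq0) orbF => /eqP->.
have x1 : x = 1 by apply: (mulIf yy_neq0); rewrite mul1r e1 expr2.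
rewrite mul0r addr0 -mulrA yyE [xz * yy]mulrC -mulrDr => /(mul0 _ _ yy_neq0)/addr_eq0_pchar2 <-.
rewrite mulrAC -zzE -mulrA -zzE x1 mulr1 addrC -!addrA (addxx char2) addr0 => zz1.
have {}zz1 : zz = 1.
  by apply: (mulIf zz_neq0); rewrite mul1r; apply: addr_eq0_pchar2.
by split; rewrite // -yyE zz1 mulr1.
Qed.

Variables (i : nat) (i_in : i \in [:: 1778; 1779]%N).
Variables (hT : finGroupType) (a' b' c' : hT) (tau : hT -> triple).
Hypothesis tauP : pbw_index a' b' c' (pres_of (target34 i)) tau.

Local Notation kH := (group_algebra k hT).
Local Notation cf := (cf (k := k) tau).

Variables (gT : finGroupType) (A : gT -> kH).
Hypothesis A_lift : is_lift A.

Let presE : (pres_of 1778 = Pres 1 2 2 1 1) * (pres_of 1779 = Pres 1 6 2 1 1). Proof. by []. Qed.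
Let ne_i : (1779 == 1778)%N = false. Proof. by []. Qed.

Ltac words := by do !apply: (lift_mul A_lift); apply: eqm_refl.

Lemma rels34_lift (a b c : gT) t n s : rels (pres_of i) a b c ->
  (n < size (rels34 i))%N -> s \in box -> (deg s < 10)%N ->
  cf s (den (env_of tau t [:: A a; A b; A c]) (nth 0 [:: A a; A b; A c]) (nth (Atom 0) (rels34 i)
    n)) = 0.
Proof.
move=> [[a4 b8 c8] [ba ca cb]] lt_n s_box lt_s.

have relP (g h : gT) U V : g = h -> eqm 10 (A g) U -> eqm 10 (A h) V -> cf s (U + V) = 0.
  move=> -> hU hV; apply: (cf_eqm char2 tauP _ s_box lt_s).
  by have [_ symm trans] := @eqm_equiv k hT 10; apply: trans hV; apply: symm.
have [i_eq|i_eq] : i = 1778%N \/ i = 1779%N.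
  by move: i_in; rewrite !inE => /orP[] /eqP; [left | right].
all: rewrite /rels34 i_eq ?presE ?eqxx ?ne_i /= in ba ca cb lt_n *; rewrite ?expg1 in ba ca cb.
all: have cb' : (c * b = b * c)%g by rewrite conjgC cb.
all: case: n lt_n => [|[|[|]]] //= _.
- by apply: (relP (b * a)%g (a * b * (c * c))%g); [rewrite conjgC ba mulgA | words | words].
- apply: (relP (c * a)%g (a * (b * b) * c)%g); [by rewrite conjgC ca mulgA | words | words].
- by apply: (relP (c * b)%g (b * c)%g); [ | words | words].
(* b^a = b c^6 is multiplied by c^2 on the right, which replaces six factors c by two. *)
- apply: (relP (b * a * (c * c))%g (a * b)%g); [ | words | words].
  by rewrite (conjgC b a) ba -[(c * c)%g]/(c ^+ 2)%g -(mulgA a) -(mulgA b) -expgD c8 mulg1.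
- apply: (relP (c * a)%g (a * (b * b) * c)%g); [by rewrite conjgC ca mulgA | words | words].
by apply: (relP (c * b)%g (b * c)%g); [ | words | words].
Qed.

Section Generators.

Variables a b c : gT.
Hypothesis abcP : rels (pres_of i) a b c.
Hypothesis gen_abc : <<[set a; b; c]>>%g = [set: gT].

Local Notation us := [:: A a; A b; A c].

Lemma eqs34 t keep cert kn eqs :
  cert_ok (pres_of (target34 i)) keep (rels34 i) cert kn eqs -> size kn = 3 ->
  (forall j e, (j < 3)%N -> e \in nth [::] kn j -> peval (env_of tau t us) e.2 = cf e.1 (nth 0 us j)) ->
  forall n, (n < size eqs)%N -> peval (env_of tau t us) (nth (0, ex, [::])%N eqs n).2 = 0.
Proof.
move=> ok_cert szE knP n lt_n; apply: (certP char2 tauP ok_cert) => //; last exact: mem_nth.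
by move=> m s lt_m s_box lt_s; apply: rels34_lift abcP _ _ _.
Qed.

Lemma linear34 : [/\ cf ex (A b) = 0, cf ex (A c) = 0, cf ex (A a) != 0 &
  (cf ey (A c) = 0 /\ [/\ cf ez (A b) = 0, cf ey (A b) != 0, cf ez (A c) != 0 &
     cf ex (A a) * cf ey (A b) = cf ez (A c) ^+ 2]) \/
  [/\ cf ey (A c) != 0, cf ez (A c) = 0 & cf ey (A b) = 0]].
Proof.
have known1 j e : (j < 3)%N -> e \in nth [::] unit_known j ->
    peval (env_of tau 0 us) e.2 = cf e.1 (nth 0 us j).
  rewrite nth_nseq => lt_j; rewrite lt_j inE => /eqP-> /=; rewrite peval1.
  by case: j lt_j => [|[|[|]]] //= _; rewrite (cf_lift0 tauP A_lift).
have [ok2 _ _ _ _] := certs34 i_in.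
have {ok2 known1} E := eqs34 ok2 (erefl _) known1.
have sq0 (x : k) : x * x = 0 -> x = 0 by move/eqP; rewrite mulf_eq0 orbb => /eqP.
have Zx : cf ex (A c) = 0.
  apply: sq0; have := E 0%N isT.
  by rewrite /= /peval /meval !big_cons !big_nil !mulr1 !addr0.
have Yx : cf ex (A b) = 0.
  apply: sq0; have := E 1%N isT.
  by rewrite /= /peval /meval !big_cons !big_nil !mulr1 !addr0.
have := E 2%N isT; have := E 3%N isT; have := E 4%N isT; have := E 5%N isT.
rewrite /= /peval /meval !big_cons !big_nil !mulr1 !addr0 /env_of /=.
rewrite -[(1, 0, 0)%N]/ex -[(0, 1, 0)%N]/ey -[(0, 0, 1)%N]/ez.
rewrite Zx Yx !mulr0 !addr0 !add0r => /addr_eq0_pchar2 e4 /addr_eq0_pchar2 e3.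
move=> /addr_eq0_pchar2 e2 /addr_eq0_pchar2 e1.
set x := cf ex (A a) in e1 e2 e3 e4 *; set yy := cf ey (A b) in e1 e2 e3 e4 *.
set yz := cf ez (A b) in e1 e2 e3 e4 *; set zy := cf ey (A c) in e1 e2 e3 e4 *.
set zz := cf ez (A c) in e1 e2 e3 e4 *.
have x_neq0 : x != 0.
  apply/eqP => x0; have [g|/eqP] := lift_nondeg char2 tauP A_lift (x := 1) (y := 0) (z := 0) gen_abc.
    by rewrite !inE !mul0r !addr0 mul1r -orbA => /or3P[] /eqP->.
  by rewrite oner_eq0.
split=> //; apply: (linear34_solve x_neq0 e1 e2 e3 e4) => y z Y0 Z0.
(* The coefficient of x is chosen so that the functional vanishes at A; since B and C have no x in
   their linear parts, only their 2 by 2 block remains. *)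
pose w := - (y * cf ey (A a) + z * cf ez (A a)) / x.
have [g|_ -> ->] := lift_nondeg char2 tauP A_lift (x := w) (y := y) (z := z) gen_abc => //.
rewrite !inE -orbA => /or3P[] /eqP->; rewrite -addrA.
- by rewrite -/x /w divfK // addNr.
- by rewrite Yx mulr0 add0r.
- by rewrite Zx mulr0 add0r.
Qed.

Lemma unit_linear34 : cf ey (A c) = 0 ->
  [/\ cf ex (A a) = 1, [/\ cf ex (A b) = 0, cf ey (A b) = 1 & cf ez (A b) = 0] &
    [/\ cf ex (A c) = 0, cf ey (A c) = 0 & cf ez (A c) = 1]].
Proof.
move=> Zy; have [Yx Zx Xx_neq0] := linear34.
case=> [[_ [Yz Yy_neq0 Zz_neq0 e1]]|[]]; last by rewrite Zy eqxx.
have known3 j e : (j < 3)%N -> e \in nth [::] deg3_known j ->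
    peval (env_of tau 0 us) e.2 = cf e.1 (nth 0 us j).
  case: j => [|[|[|]]] //= _; rewrite !inE.
  - by move/eqP->; rewrite peval1 (cf_lift0 tauP A_lift).
  - by case/or3P => /eqP->; rewrite ?peval1 ?peval0 ?(cf_lift0 tauP A_lift).
  - by case/or3P => /eqP->; rewrite ?peval1 ?peval0 ?(cf_lift0 tauP A_lift).
have [_ ok3 _ _ _] := certs34 i_in.
have {ok3 known3} E := eqs34 ok3 (erefl _) known3.
have Yxy := E 0%N isT; have Zxz := E 1%N isT; have Zxy := E 2%N isT; have Yxz := E 3%N isT.
have ba102 := E 4%N isT; have ca120 := E 5%N isT; have ba030 := E 6%N isT.
have ba003 := E 7%N isT; have ca021 := E 8%N isT; move: {E} Yxy Zxz Zxy Yxz ba102 ca120 ba030 ba003 ca021.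
rewrite /= /peval /meval !big_cons !big_nil !mulr1 !addr0 /env_of /=.
rewrite -[(1, 0, 0)%N]/ex -[(0, 1, 0)%N]/ey -[(0, 0, 1)%N]/ez.
move=> h1 h2 h3 h4 h5 h6 h7 h8 h9.
by have [-> -> ->] := unit_solve Xx_neq0 Yy_neq0 Zz_neq0 e1 h1 h2 h3 h4 h5 h6 h7 h8 h9.
Qed.

Lemma obstruction34_gen : cf ey (A c) != 0.
Proof.
apply/eqP => Zy; have [Xx [Yx Yy Yz] [Zx _ Zz]] := unit_linear34 Zy.
pose t := cf (0, 2, 0)%N (A b) + cf (0, 0, 2)%N (A b) + cf (0, 2, 0)%N (A c) + cf (0, 0, 2)%N (A c).
have knownP T j e : peval (env_of tau t us) T = t -> (j < 3)%N ->
    e \in nth [::] (unit_linear_known T) j -> peval (env_of tau t us) e.2 = cf e.1 (nth 0 us j).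
  move=> T_t; have A0 := cf_lift0 tauP A_lift; have p1 := peval1 (env_of tau t us).
  have p0 := peval0 (env_of tau t us).
  case: j => [|[|[|]]] //= _; rewrite !inE.
  - by case/orP => /eqP->; rewrite p1 ?A0 ?Xx.
  - by case/or4P => /eqP->; rewrite ?p1 ?p0 ?A0 ?Yx ?Yy ?Yz.
  - case/or4P => [/eqP->|/eqP->|/eqP->|/orP[]/eqP->]; rewrite ?p1 ?p0 ?A0 ?Zx ?Zy ?Zz //.
    rewrite peval_sum // !big_cons big_nil !pevalX T_t /t /env_of /= addr0.
    by rewrite [LHS]addrA [LHS]addrA [LHS]addrA (addxx char2) add0r.
have [_ _ oka okb okc] := certs34 i_in.
have knowna : peval (env_of tau t us) [:: [:: par]] = t.
  by rewrite -[[:: [:: par]]]/(pvar par) pevalX.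
have := eqs34 oka (erefl _) (fun j e => @knownP _ j e knowna) (n := 0) isT.
rewrite /= /peval /meval !big_cons !big_nil !mulr1 !addr0 /env_of /= -[X in _ + X]mulr1 -mulrDr.
move/eqP; rewrite mulf_eq0 => /orP[]/eqP t_eq.
  have known0 : peval (env_of tau t us) [::] = t by rewrite peval0 t_eq.
  have /eqP := eqs34 okb (erefl _) (fun j e => @knownP _ j e known0) (n := 0) isT.
  by rewrite [nth _ _ _]/= peval1 oner_eq0.
have known1 : peval (env_of tau t us) [:: [::]] = t.
  by rewrite peval1; apply/esym/addr_eq0_pchar2.
have /eqP := eqs34 okc (erefl _) (fun j e => @knownP _ j e known1) (n := 0) isT.
by rewrite [nth _ _ _]/= peval1 oner_eq0.
Qed.

End Generators.

(* The automorphism (a, b, c) -> (a, c, b ^+ e) exchanges the roles of b and c. *)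
Lemma rels34_swap (a b c : gT) : rels (pres_of i) a b c ->
  exists2 e, odd e & rels (pres_of i) a c (b ^+ e)%g.
Proof.
move=> [[a4 b8 c8] [ba ca cb]].
have [i_eq|i_eq] : i = 1778%N \/ i = 1779%N.
  by move: i_in; rewrite !inE => /orP[] /eqP; [left | right].
all: rewrite /rels i_eq ?presE /= in ba ca cb *; rewrite ?expg1 in ba ca cb *.
all: have bc : commute b c by apply/esym; rewrite /commute conjgC cb.
  exists 1%N => //; rewrite expg1; split; split=> //.
  - by rewrite ca; apply: (commuteX2 2 1 bc).
  - by rewrite ba; apply: (commuteX2 1 2 bc).
  by rewrite conjgE bc mulKg.
exists 3 => //; split; split=> //.
- by rewrite -expgM mulnC expgM b8 expg1n.
- rewrite ca -expgM -[(3 * 6)%N]/(8 + 8 + 2)%N !expgD b8 !mul1g.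
  exact: (commuteX2 2 1 bc).
- rewrite conjXg ba expgMn; last exact: (commuteX2 1 6 bc).
  rewrite -expgM -[(6 * 3)%N]/(8 + 8 + 2)%N !expgD c8 !mul1g.
  exact: (commuteX2 3 2 bc).
by rewrite conjXg conjgE bc mulKg.
Qed.

(** The linear part of C involves y for every generating triple that satisfies the relations. After
    the exchange the third generator is b^e, whose coordinate at y is e times that of b, and this is
    0 in the remaining case of [linear34]. *)
Lemma obstruction34 : presents (pres_of i) gT -> False.
Proof.
case=> [[a [b [c [abcP gen_abc]]]] _].
have Zy := obstruction34_gen abcP gen_abc.
have [_ _ _ [[Zy0]|[_ _ Yy]]] := linear34 abcP gen_abc; first by rewrite Zy0 eqxx in Zy.
have [e odd_e acbP] := rels34_swap abcP.
have : <<[set a; c; b ^+ e]>>%g = [set: gT].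
  apply/eqP; rewrite eqEsubset subsetT -gen_abc gen_subG; apply/subsetP => g.
  have b_gen : b \in <<[set a; c; b ^+ e]>>%g.
    have : coprime #[b]%g e.
      apply: (@coprime_dvdl _ 8); first by rewrite order_dvdn; case: abcP => [[_ -> _] _].
      by rewrite (coprimeXl 3 (_ : coprime 2 e)) // coprime2n.
    rewrite -generator_coprime /generator => /eqP b_e.
    have: b \in <[b ^+ e]>%g by rewrite -b_e cycle_id.
    by apply: subsetP; rewrite cycle_subG mem_gen // !inE eqxx orbT.
  by rewrite !inE -orbA => /or3P[] /eqP-> //; rewrite mem_gen // !inE eqxx ?orbT.
move=> gen_acb; have := obstruction34_gen acbP gen_acb; apply/negP; rewrite negbK; apply/eqP.
have cfX n : cf ey (A (b ^+ n)%g) = cf ey (A b) *+ n.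
  elim: n => [|n IHn]; last by rewrite expgS (cf_lift_mul char2 tauP A_lift) // IHn mulrS.
  have := cf_eqm char2 tauP (lift_1 A_lift) (s := ey) isT isT.
  by rewrite cfD (cf_box1 k tauP) // addr0.
by rewrite cfX Yy mul0rn.
Qed.

End Obstruction34.

(** c a c = a is c^a = c^7. The relation a^4 = 1 is written a^5 = a, in terms of the three atoms
    alone. *)
Definition rels12 : seq expr :=
  [:: Add (Mul (Mul (Atom 2) (Atom 0)) (Atom 2)) (Atom 0);
      Add (Mul (Mul (Mul (Mul (Atom 0) (Atom 0)) (Atom 0)) (Atom 0)) (Atom 0)) (Atom 0)].

(* [CAC = A] in terms of x = t^-1 (A - 1) and z = t^-1 (C - 1), up to the factor t ^+ 2. *)
Definition scaled12 : seq expr :=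
  [:: Add (Mul (Atom 1) (Atom 0)) (Add (Mul (Atom 0) (Atom 1)) (Add (Mul (Atom 1) (Atom 1))
        (Scal par (Mul (Mul (Atom 1) (Atom 0)) (Atom 1)))))].

Definition scaled_known : known :=
  [:: [:: ((0, 0, 0), [::]); ((1, 0, 0), [:: [::]]); ((0, 1, 0), [::])];
      [:: ((0, 0, 0), [::]); ((1, 0, 0), [::]); ((0, 1, 0), [::]); ((0, 0, 1), [:: [::]])]]%N.

Definition keep_xy4 : seq triple := [seq s <- box | (deg s <= 4) && (s.2 == 0)]%N.

Definition eqs12_deg2 : seq (nat * triple * fpoly) :=
  [:: (0, (2, 0, 0), [:: [:: (2, (1, 0, 0)); (2, (1, 0, 0))]]);
      (0, (0, 2, 0), [:: [:: (2, (0, 1, 0)); (2, (0, 1, 0))]]);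
      (0, (0, 0, 2), [:: [:: (0, (0, 0, 1)); (2, (1, 0, 0))]; [:: (2, (0, 0, 1)); (2, (0, 0, 1))];
        [:: (2, (0, 0, 1)); (0, (1, 0, 0))]; [:: (2, (0, 0, 1)); (2, (1, 0, 0))]])]%N.

(** A^5 + A = A (A - 1)^4, whose coefficient at y^4 is the fourth power of the coordinate of A at y.
    This is how a^4 = 1 excludes y from the linear part of A. *)
Definition eqs12_y4 : seq (nat * triple * fpoly) :=
  [:: (1, (0, 4, 0), [:: [:: (0, (0, 1, 0)); (0, (0, 1, 0)); (0, (0, 1, 0)); (0, (0, 1, 0))]])]%N.

Definition keep12 : seq triple := [:: (0, 0, 0); (0, 0, 1); (0, 0, 2); (0, 0, 3); (0, 0, 4);
  (0, 0, 5); (0, 0, 6); (0, 0, 7); (0, 1, 0); (0, 1, 1); (0, 1, 2); (0, 1, 3); (0, 1, 4); (0, 1, 5);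
  (0, 1, 6); (0, 1, 7); (1, 0, 0); (1, 0, 1); (1, 0, 2); (1, 0, 3); (1, 0, 4); (1, 0, 5); (1, 0, 6);
  (1, 0, 7); (1, 1, 0); (1, 1, 1); (1, 1, 2); (1, 1, 3); (1, 1, 4); (1, 1, 5); (1, 1, 6);
  (1, 1, 7)]%N.

Definition cert12 : seq (nat * seq step) :=
 [:: (3, [:: (0,(1,0,2),(1,(1,0,1))); (0,(0,0,3),(0,(1,0,1))); (0,(0,1,2),(1,(0,1,1)))]);
  (4, [:: (0,(1,1,2),(1,(1,1,1))); (0,(0,1,3),(0,(1,1,1))); (0,(0,0,4),(1,(0,0,3)))]);
  (5, [:: (0,(1,0,4),(1,(1,0,3))); (0,(0,0,5),(0,(1,0,3))); (0,(0,1,4),(1,(0,1,3)))]);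
  (6, [:: (0, (1, 0, 5), (0, (0, 1, 1))); (0, (1, 1, 4), (1, (1, 1, 3)));
    (0, (0, 1, 5), (0, (1, 1, 3))); (0, (0, 0, 6), (1, (0, 0, 5)))]);
  (7, [:: (0,(1,0,6),(1,(1,0,5))); (0,(0,0,7),(0,(1,0,5))); (0,(0,1,6),(1,(0,1,5)))]);
  (8, [:: (0,(1,0,7),(0,(0,1,3))); (0,(1,1,6),(1,(1,1,5))); (0,(0,1,7),(0,(1,1,5)))])]%N.

Lemma certs12 i : i \in [:: 1272; 1274]%N -> let P := pres_of i in
  [/\ cert_ok P (keep_deg 2) rels12 [::] unit_known eqs12_deg2,
      cert_ok P keep_xy4 rels12 [::] unit_known eqs12_y4 &
      cert_ok P keep12 scaled12 cert12 scaled_known [:: (0, (1, 1, 7), [:: [::]])]%N].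
Proof. by rewrite !inE => /orP[] /eqP->; split; vm_cast_no_check (erefl true). Qed.

Lemma cac_expand (R : nzRingType) (u v a c : R) : (forall w : R, w + w = 0) ->
  c = v + 1 -> a = u + 1 -> v * u + (u * v + (v * v + v * u * v)) = c * a * c + a.
Proof.
move=> ch -> ->; rewrite [(v + 1) * (u + 1)]mulrDl mul1r mulrDr mulr1.
rewrite mulrDr mulr1 !mulrDl mul1r -!addrA (addrA u 1) ch addr0 !addrA.
rewrite [RHS]addrAC -(addrA _ v v) ch addr0 [LHS]addrC.
by rewrite [_ + v * v]addrC [v * u + _]addrC !addrA.
Qed.

(** * The obstruction for 1273 and 1275 *)

Section Obstruction12.

Variables (k : fieldType) (char2 : 2%N \in [pchar k]).
Variables (i j : nat) (j_in : j \in [:: 1272; 1274]%N).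
Hypothesis i_def : i = j.+1.
Variables (hT : finGroupType) (a' b' c' : hT) (tau : hT -> triple).
Hypothesis tauP : pbw_index a' b' c' (pres_of j) tau.

Local Notation kH := (group_algebra k hT).
Local Notation cf := (cf (k := k) tau).

Variables (gT : finGroupType) (A : gT -> kH).
Hypothesis A_lift : is_lift A.

Variables a b c : gT.
Hypothesis abcP : rels (pres_of i) a b c.
Hypothesis gen_abc : <<[set a; b; c]>>%g = [set: gT].

Local Notation us := [:: A a; A b; A c].

Lemma cac : eqm 10 (A c * A a * A c) (A a).
Proof.
have [_ symm trans] := @eqm_equiv k hT 10.
have cacE : (c * a * c)%g = a.
  have [[_ _ c8] [_ ca _]] := abcP.
  have {}ca : (c ^ a = c ^+ 7)%g.
    rewrite ca i_def; move: j_in; rewrite !inE => /orP[] /eqP-> /=; exact: mul1g.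
  by rewrite (conjgC c a) ca -mulgA -expgSr c8 mulg1.
rewrite -{2}cacE; apply: symm; do !apply: (lift_mul A_lift); apply: eqm_refl.
Qed.

Lemma rels12_lift t n s : (n < 2)%N -> s \in box -> (deg s < 10)%N ->
  cf s (den (env_of tau t us) (nth 0 us) (nth (Atom 0) rels12 n)) = 0.
Proof.
case: n => [|[|]] //= _ s_box lt_s; first exact: (cf_eqm char2 tauP cac).
have [_ symm trans] := @eqm_equiv k hT 10.
apply: (cf_eqm char2 tauP _ s_box lt_s).
have a5 : (a * a * a * a * a)%g = a.
  have [[a4 _ _] _] := abcP.
  by rewrite -[RHS]mul1g -a4 !expgS expg0 mulg1 !mulgA.
rewrite -{6}a5; apply: symm; do !apply: (lift_mul A_lift); apply: eqm_refl.
Qed.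

Lemma linear12 : [/\ cf ex (A c) = 0, cf ey (A c) = 0, cf ey (A a) = 0,
  cf ez (A c) != 0 & cf ez (A c) = cf ex (A a)].
Proof.
have known1 n e : (n < 3)%N -> e \in nth [::] unit_known n ->
    peval (env_of tau 0 us) e.2 = cf e.1 (nth 0 us n).
  rewrite nth_nseq => lt_n; rewrite lt_n inE => /eqP-> /=; rewrite peval1.
  by case: n lt_n => [|[|[|]]] //= _; rewrite (cf_lift0 tauP A_lift).
have [ok2 ok4 _] := certs12 j_in.
have E2 := certP (us := us) char2 tauP ok2 (erefl _) isT (rels12_lift 0) known1.
have E4 := certP (us := us) char2 tauP ok4 (erefl _) isT (rels12_lift 0) known1.
have {}E2 n : (n < 3)%N -> peval (env_of tau 0 us) (nth (0%N, ex, [::]) eqs12_deg2 n).2 = 0.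
  by move=> lt_n; apply/E2/mem_nth.
have {}E4 n : (n < 1)%N -> peval (env_of tau 0 us) (nth (0%N, ex, [::]) eqs12_y4 n).2 = 0.
  by move=> lt_n; apply/E4/mem_nth.
move=> {ok2 ok4 known1}.
have := E2 0%N isT; have := E2 1%N isT; have := E2 2%N isT; have := E4 0%N isT.
rewrite /= /peval /meval !big_cons !big_nil !mulr1 !addr0 /env_of /=.
rewrite -[(1, 0, 0)%N]/ex -[(0, 1, 0)%N]/ey -[(0, 0, 1)%N]/ez.
move/eqP; rewrite !mulf_eq0 !orbb => /eqP Xy e3 /eqP; rewrite mulf_eq0 orbb => /eqP Zy.
move/eqP; rewrite mulf_eq0 orbb => /eqP Zx; move: e3.
rewrite Zx !mulr0 add0r addr0 -mulrDr => /eqP; rewrite mulf_eq0 => Zz.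
have sep := lift_nondeg char2 tauP A_lift gen_abc.
have Zz_neq0 : cf ez (A c) != 0.
  apply/eqP => Zz0.
  have Z0 s : s \in [:: ex; ey; ez] -> cf s (A c) = 0.
    by rewrite !inE => /or3P[] /eqP->.
  have sep' x y z : x * cf ex (A a) + z * cf ez (A a) = 0 ->
      x * cf ex (A b) + y * cf ey (A b) + z * cf ez (A b) = 0 -> [/\ x = 0, y = 0 & z = 0].
    move=> Xe Ye; apply: sep => g; rewrite !inE -orbA => /or3P[] /eqP->.
    - by rewrite Xy mulr0 addr0.
    - exact: Ye.
    - by rewrite Zx Zy Zz0 !mulr0 !addr0.
  (* If the linear part of C is zero, those of A and B would have to span dimension 3. The
     functional is, up to sign, their cross product, which kills both and so must vanish; the
     degenerate cases follow. *)
  have [||xzy _ /eqP xxy] := sep' (cf ez (A a) * cf ey (A b))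
    (cf ex (A a) * cf ez (A b) - cf ez (A a) * cf ex (A b)) (- (cf ex (A a) * cf ey (A b))).
  - by ring.
  - by ring.
  move: xxy xzy; rewrite oppr_eq0 mulf_eq0 => xxy /eqP; rewrite mulf_eq0 => xzy.
  have [Yy|Yy] := eqVneq (cf ey (A b)) 0.
    have [||_ /eqP] := sep' 0 1 0; last by rewrite oner_eq0.
      by rewrite !mul0r addr0.
    by rewrite !mul0r add0r addr0 mul1r.
  move: xxy xzy; rewrite (negPf Yy) !orbF => /eqP Xx /eqP Xz.
  have [||/eqP] := sep' (cf ey (A b)) (- cf ex (A b)) 0; last by rewrite (negPf Yy).
    by rewrite Xx mulr0 mul0r addr0.
  by ring.
split=> //; move: Zz; rewrite (negPf Zz_neq0) => /eqP.
exact: (addr_eq0_pchar2 char2).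
Qed.

Local Notation t := (cf ez (A c)).
Local Notation X := (t^-1 *: (A a + 1)).
Local Notation Z := (t^-1 *: (A c + 1)).

Lemma scaled12_lift n s : (n < 1)%N -> s \in box -> (deg s < 10)%N ->
  cf s (den (env_of tau t [:: X; Z]) (nth 0 [:: X; Z]) (nth (Atom 0) scaled12 n)) = 0.
Proof.
case: n => //= _ s_box lt_s; have [_ _ _ t_neq0 _] := linear12.
rewrite /env_of /=; set U := A a + 1; set V := A c + 1.
have -> : Z * X + (X * Z + (Z * Z + t *: (Z * X * Z))) =
    (t^-1 * t^-1) *: (V * U + (U * V + (V * V + V * U * V))).
  rewrite -!scalerAl -!scalerAr -!scalerAl !scalerA divff // mul1r.
  by rewrite -!scalerDr.
rewrite cfZ; apply/eqP; rewrite mulf_eq0; apply/orP; right; apply/eqP.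
rewrite -(cf_eqm char2 tauP cac s_box lt_s); congr (cf s _).
have [AE CE] : A a = U + 1 /\ A c = V + 1.
  by rewrite /U /V -!addrA (ga_addxx char2) !addr0.
exact: (@cac_expand kH U V (A a) (A c) (ga_addxx char2 (gT := hT)) CE AE).
Qed.

(** Division by t makes the coordinate of X at x and that of Z at z equal to 1, so the elimination
    has unit pivots; t survives only in the cubic term of the relation. *)
Lemma obstruction12_gen : False.
Proof.
have [Zx Zy Xy t_neq0 tE] := linear12.
have cf_scale g s : s \in box ->
    cf s (t^-1 *: (A g + 1)) = t^-1 * (cf s (A g) + (s == (0, 0, 0)%N)%:R).
  by move=> s_box; rewrite cfZ cfD (cf_box1 k tauP).
have A0 := cf_lift0 tauP A_lift.
have knP n e : (n < 2)%N -> e \in nth [::] scaled_known n ->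
    peval (env_of tau t [:: X; Z]) e.2 = cf e.1 (nth 0 [:: X; Z] n).
  have p1 := peval1 (env_of tau t [:: X; Z]); have p0 := peval0 (env_of tau t [:: X; Z]).
  case: n => [|[|]] //= _; rewrite !inE.
    case/or3P => /eqP->; rewrite ?p1 ?p0 cf_scale //= ?A0 ?Xy ?(addxx char2) ?addr0 ?mulr0 //.
    by rewrite tE mulVf // -tE.
  case/or4P => /eqP->; rewrite ?p1 ?p0 cf_scale //= ?A0 ?Zx ?Zy ?(addxx char2) ?addr0 ?mulr0 //.
  by rewrite mulVf.
have [_ _ ok12] := certs12 j_in.
have := certP (us := [:: X; Z]) char2 tauP ok12 (erefl _) isT scaled12_lift knP (mem_head _ _).
by move/eqP; rewrite [_.2]/= peval1 oner_eq0.
Qed.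

End Obstruction12.

End NonIsomorphic.

(** * The Jennings series *)

Section JenningsSeries.

Local Open Scope group_scope.

Lemma morphim_power_subgroup (gT rT : finGroupType) (G : {group gT}) (f : {morphism G >-> rT})
    n (A : {set gT}) : A \subset G ->
  f @* power_subgroup n A = power_subgroup n (f @* A) :> {set rT}.
Proof.
move=> sAG; have sXG : [set x ^+ n | x in A] \subset G.
  by apply/subsetP => _ /imsetP[x Ax ->]; rewrite groupX // (subsetP sAG).
rewrite /= morphim_gen //; congr <<_>>; apply/setP => y; apply/idP/imsetP.
  case/morphimP => z _ /imsetP[x Ax ->] ->; exists (f x); last by rewrite morphX // (subsetP sAG).
  by rewrite mem_morphim // (subsetP sAG).
case=> _ /morphimP[x Gx Ax ->] ->; rewrite -morphX // mem_morphim ?groupX //.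
by apply/imsetP; exists x.
Qed.

Lemma morphim_jennings (p m : nat) (gT rT : finGroupType) (G : {group gT}) (f : {morphism G >-> rT}) :
  f @* jennings p G m = jennings p (f @* G) m :> {set rT}.
Proof.
pose good (K : {group gT}) (L : {group rT}) := K \subset G /\ f @* K = L :> {set rT}.
have good1 : good 1%G 1%G by split; [exact: sub1G | exact: morphim1].
have goodM K1 L1 K2 L2 : good K1 L1 -> good K2 L2 -> good (K1 * K2)%G (L1 * L2)%G.
  by move=> [sK1 fK1] [sK2 fK2]; split; rewrite /= ?join_subG ?sK1 // morphimY // fK1 fK2.
suff [] : good (jennings p G m) (jennings p (f @* G) m) by [].
apply: big_ind2 => // i _; apply: big_ind2 => // j _; split.
  exact: subset_trans (power_subgroup_sub _ _) (lcn_sub _ _).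
by rewrite morphim_power_subgroup ?lcn_sub // morphim_lcn.
Qed.

Lemma jennings_norm (p m : nat) (gT : finGroupType) (G : {group gT}) :
  G \subset 'N(jennings p G m).
Proof.
apply: (big_ind (fun K : {group gT} => G \subset 'N(K))) => [|K L|i _]; first exact: norms1.
  exact: normsY.
apply: (big_ind (fun K : {group gT} => G \subset 'N(K))) => [|K L|j _]; first exact: norms1.
  exact: normsY.
apply: norms_gen; apply/subsetP => g Gg; rewrite inE; apply/subsetP => _ /imsetP[_ /imsetP[x Lx ->] ->].
by rewrite conjXg; apply/imset_f; rewrite memJ_norm // (subsetP (lcn_norm _ _)).
Qed.

Lemma power_subgroup1 (gT : finGroupType) (A : {set gT}) n :
  (forall x, x \in A -> x ^+ n = 1) -> power_subgroup n A = 1%G.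
Proof.
move=> A1; apply: val_inj; apply/trivgP; rewrite /= gen_subG.
by apply/subsetP => _ /imsetP[x /A1-> ->]; rewrite inE.
Qed.

(** * Maps between the quotients by D_4 *)

Section Homg.

Variables (m : nat) (gT hT : finGroupType) (P Q : pres).
Local Notation G := [set: gT]%G.
Local Notation H := [set: hT]%G.
Hypothesis gP : presents P gT.
Hypothesis hQ : presents Q hT.
Hypothesis PQ4 : [/\ p0 P = p0 Q %[mod 4], p1 P = p1 Q %[mod 4], q0 P = q0 Q %[mod 4],
  q1 P = q1 Q %[mod 4] & rb P = rb Q %[mod 4]].

Lemma jennings_quotient_homg :
  H / jennings 2 H 4 \homg G / jennings 2 G 4.
Proof.
set D := jennings 2 H 4; have nDH : H \subset 'N(D) := jennings_norm 2 4 H.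
have [[a [b [c [[[a4 _ _] [ba ca cb]] gen_abc]]]] _] := hQ.
have inN x : x \in 'N(D) by rewrite (subsetP nDH) ?inE.
have pow4 x : coset D x ^+ 4 = 1.
  rewrite -morphX //= coset_id //.
  apply: (subsetP (@sub_jennings 2 _ H 4 1 2 isT isT isT isT)).
  by apply: mem_gen; apply/imsetP; exists x; rewrite // lcn1 inE.
have pow_mod x n1 n2 : n1 = n2 %[mod 4] -> coset D x ^+ n1 = coset D x ^+ n2.
  by move=> E; rewrite -(expg_mod n1 (pow4 x)) E expg_mod ?pow4.
have relsD : rels P (coset D a) (coset D b) (coset D c).
  have [E1 E2 E3 E4 E5] := PQ4; split; split; rewrite ?pow4 //.
  - by rewrite -[8]/(4 * 2)%N expgM pow4 expg1n.
  - by rewrite -[8]/(4 * 2)%N expgM pow4 expg1n.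
  - by rewrite -morphJ // ba morphM ?morphX // (pow_mod b _ _ E1) (pow_mod c _ _ E2).
  - by rewrite -morphJ // ca morphM ?morphX // (pow_mod b _ _ E3) (pow_mod c _ _ E4).
  by rewrite -morphJ // cb morphX // (pow_mod c _ _ E5).
have /homgP[f fG] := gP.2 _ _ _ _ relsD.
have genD : <<[set coset D a; coset D b; coset D c]>> = H / D.
  have -> : [set coset D a; coset D b; coset D c] = [set a; b; c] / D.
    by rewrite !quotientU !quotient_set1.
  by rewrite -quotient_gen ?gen_abc // (subset_trans (subsetT _)).
have {fG} fG : f @* G = H / D by rewrite -genD.
(* The Jennings series is compatible with homomorphic images, so f maps D_4(G) onto D_4 of H /
   D_4(H), which is trivial; hence f factors through G / D_4(G). *)
have fD : f @* jennings 2 G 4 = 1.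
  have -> : f @* jennings 2 G 4 = jennings 2 (f @* G)%G 4 by apply: morphim_jennings.
  have -> : (f @* G)%G = (restrm nDH (coset D) @* H)%G.
    by apply: val_inj; rewrite /= fG morphim_restrm setIid.
  by rewrite -morphim_jennings morphim_restrm (setIidPr _) ?subsetT //; exact: trivg_quotient.
have sDK : 'ker (coset (jennings 2 G 4)) \subset 'ker f.
  by rewrite ker_coset -sub_morphim_pre ?subsetT // fD.
have nDG : G \subset 'N(jennings 2 G 4) := jennings_norm 2 4 G.
apply/homgP; exists [morphism of factm sDK nDG].
by rewrite /= morphim_factm fG.
Qed.

End Homg.

(** * Central series tested on generators *)

Section CentralSeries.

Variables (gT : finGroupType) (S : {set gT}) (N : nat -> {group gT}).
Hypotheses (genS : <<S>> = [set: gT]) (N0 : N 0 = [set: gT] :> {set gT}).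
Hypothesis sN : forall n, N n.+1 \subset N n.
Hypothesis N_comm : forall n x g, x \in N n -> g \in S -> [~ x, g] \in N n.+1.

Lemma series_norm n : [set: gT] \subset 'N(N n).
Proof.
rewrite -genS gen_subG; apply/subsetP => g Sg; rewrite inE; apply/subsetP => _ /imsetP[x Nx ->].
by rewrite conjg_mulR groupM // (subsetP (sN n)) // N_comm.
Qed.

(** Modulo the normal subgroup N (n + 1), the elements of N n commute with the generators, hence
    with the whole group. The indices are shifted by one because the lower central series starts at
    1. *)
Lemma series_lcn n : 'L_n.+1([set: gT]) \subset N n.
Proof.
elim: n => [|n IHn]; first by rewrite N0 subsetT.
rewrite lcnSn; apply: subset_trans (commSg _ IHn) _.
have nN (B : {set gT}) : B \subset 'N(N n.+1) by apply: subset_trans (subsetT B) (series_norm _).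
rewrite commGC -quotient_cents2 // -genS quotient_gen // gen_subG.
rewrite quotient_cents2 // commGC gen_subG; apply/subsetP => _ /imset2P[x g Nx Sg ->].
exact: N_comm.
Qed.

End CentralSeries.

(* [mul3] and [pow3] are the product and the powers of [gT] read through [tau]. *)
Definition mul3 (P : pres) (t s : triple) : triple := word3 P s.1.1 s.1.2 s.2 t.

Definition pow3 (P : pres) (n : nat) (t : triple) : triple := iter n (mul3 P t) (0, 0, 0)%N.

Definition layer (n : nat) (t : triple) : bool :=
  match n with
  | 0 => true
  | 1 => [&& t.1.1 == 0, ~~ odd t.1.2 & ~~ odd t.2]
  | 2 => [&& t.1.1 == 0, 4 %| t.1.2 & 4 %| t.2]
  | _ => t == (0, 0, 0)
  end%N.

(** The commutator [t, g] is recognized without inverses as the u with g t u = t g. The last test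
    bounds the exponents of the layers by 8, 4 and 2. *)
Definition series_ok (P : pres) : bool :=
  let l n := [seq t <- box | layer n t] in
  [&& all (fun n => all (fun s => all (fun t => layer n (mul3 P t s)) (l n)) (l n)) [:: 1; 2; 3],
      all (fun n => all (fun t => all (fun g =>
        has (fun u => teq (mul3 P (mul3 P g t) u) (mul3 P t g)) (l n.+1))
        [:: (1, 0, 0); (0, 1, 0); (0, 0, 1)]) (l n)) [:: 0; 1; 2] &
      all (fun n => all (fun t => teq (pow3 P (2 ^ (3 - n)) t) (0, 0, 0)) (l n)) [:: 0; 1; 2]]%N.

Lemma indices_series_ok i : i \in indices -> series_ok (pres_of i).
Proof.
move=> ii; suff /allP/(_ i ii) : all (fun i => series_ok (pres_of i)) indices by [].
by vm_cast_no_check (erefl true).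
Qed.

Section Jennings5.

Variables (gT : finGroupType) (a b c : gT) (P : pres) (tau : gT -> triple).
Hypotheses (tauP : pbw_index a b c P tau) (gen_abc : <<[set a; b; c]>> = [set: gT]).
Hypothesis serP : series_ok P.

Let tau_inj : injective tau.
Proof. by move=> g h E; rewrite (pbw_prod tauP g) E -(pbw_prod tauP h). Qed.

Lemma tau_mul g h : tau (g * h) = mul3 P (tau g) (tau h).
Proof.
have tauX x f n u : (forall h, tau (h * x) = f (tau h)) -> tau (u * x ^+ n) = iter n f (tau u).
  by move=> fx; elim: n => [|n IHn]; rewrite ?mulg1 // expgSr mulgA fx IHn.
rewrite {1}(pbw_prod tauP h) !mulgA (tauX _ _ _ _ (pbw_c tauP)).
by rewrite (tauX _ _ _ _ (pbw_b tauP)) (tauX _ _ _ _ (pbw_a tauP)).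
Qed.

Lemma tau_exp g n : tau (g ^+ n) = pow3 P n (tau g).
Proof. by elim: n => [|n IHn]; rewrite ?(pbw_1 tauP) // expgS tau_mul IHn. Qed.

Lemma tau_gen : [/\ tau a = (1, 0, 0), tau b = (0, 1, 0) & tau c = (0, 0, 1)]%N.
Proof.
rewrite -[a]mul1g -[b]mul1g -[c]mul1g (pbw_a tauP) (pbw_b tauP) (pbw_c tauP) (pbw_1 tauP).
by rewrite /mula /mulb /mulc /conj_exp /= !muln0.
Qed.

Lemma layer_group n : group_set [set h | layer n (tau h)].
Proof.
have layer3 m t : layer m.+3 t = layer 3 t by [].
have mem_l m h : layer m (tau h) -> tau h \in [seq t <- box | layer m t].
  by move=> lh; rewrite mem_filter lh (pbw_box tauP).
apply/group_setP; split=> [|g h]; rewrite !inE ?(pbw_1 tauP); first by case: n => [|[|[|n]]].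
case/and3P: serP => /allP okM _ _ gn hn; rewrite tau_mul.
case: n gn hn => [|[|[|n]]] gn hn //.
- by apply: (allP (allP (okM 1%N isT) _ (mem_l _ _ hn)) _ (mem_l _ _ gn)).
- by apply: (allP (allP (okM 2 isT) _ (mem_l _ _ hn)) _ (mem_l _ _ gn)).
by apply: (allP (allP (okM 3 isT) _ (mem_l 3 _ hn)) _ (mem_l 3 _ gn)).
Qed.

Definition series n : {group gT} := Group (layer_group n).

Lemma series_sub n : series n.+1 \subset series n.
Proof.
apply/subsetP => h; rewrite !inE; case: n => [|[|n]] //=.
  case/and3P => -> j4 l4.
  have even m : (4 %| m)%N -> ~~ odd m.
    by move=> m4; rewrite -dvdn2; apply: dvdn_trans m4.
  by rewrite !even.
by case: n => [|n] /eqP->.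
Qed.

Lemma series_comm n x g : x \in series n -> g \in [set a; b; c] -> [~ x, g] \in series n.+1.
Proof.
have [le_n|lt_n] := leqP n 2; last first.
  case: n lt_n => [|[|[|n]]] // _; rewrite !inE /= -(pbw_1 tauP) => /eqP/tau_inj-> _.
  by rewrite comm1g.
rewrite inE => xn gS; have [ta tb tc] := tau_gen.
have tg : tau g \in [:: (1, 0, 0); (0, 1, 0); (0, 0, 1)]%N.
  by move: gS; rewrite !inE -orbA => /or3P[] /eqP->; rewrite ?ta ?tb ?tc eqxx ?orbT.
case/and3P: serP => _ /allP okC _.
have n3 : n \in [:: 0; 1; 2]%N by case: n le_n {xn} => [|[|[|]]].
have xl : tau x \in [seq t <- box | layer n t] by rewrite mem_filter xn (pbw_box tauP).
have /hasP[u] := allP (allP (okC n n3) _ xl) _ tg.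
rewrite mem_filter => /andP[un u_box] /teqP.
have [v uE] : exists v, u = tau v.
  by exists (a ^+ u.1.1 * b ^+ u.1.2 * c ^+ u.2); rewrite (tau_prod tauP).
rewrite {}uE -!tau_mul in un * => /tau_inj E.
suff -> : [~ x, g] = v by rewrite inE.
by apply: (mulgI (g * x)); rewrite E commgEl -mulgA mulKVg -conjgC.
Qed.

Lemma jennings5 : jennings 2 [set: gT]%G 5 = 1%G.
Proof.
have L n : 'L_n.+1([set: gT]) \subset series n.
  apply: (series_lcn gen_abc) => [|m|m x g]; [|exact: series_sub|exact: series_comm].
  by apply/setP => h; rewrite !inE.
have exp_layer n h : (n <= 2)%N -> h \in series n -> h ^+ (2 ^ (3 - n)) = 1.
  move=> le_n; rewrite inE => hn; apply: tau_inj; rewrite tau_exp (pbw_1 tauP).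
  case/and3P: serP => _ _ /allP okE.
  have n3 : n \in [:: 0; 1; 2]%N by case: n le_n {hn} => [|[|[|]]].
  by apply/teqP/(allP (okE n n3)); rewrite mem_filter hn (pbw_box tauP).
apply: (big_ind (fun K => K = 1%G)) => [|K M -> ->|i i_gt0] //.
  by apply: val_inj; rewrite /= joing1G.
apply: (big_ind (fun K => K = 1%G)) => [|K M -> ->|j le_ij] //.
  by apply: val_inj; rewrite /= joing1G.
apply: power_subgroup1 => x Lx; case: {i}(nat_of_ord i) i_gt0 le_ij Lx => // i _ le_ij Lx.
have {Lx L} xi : x \in series i by apply: (subsetP (L i)).
have [le_i|lt_i] := leqP i 2; last first.
  case: i lt_i xi {le_ij} => [|[|[|i]]] // _; rewrite inE /= -(pbw_1 tauP) => /eqP/tau_inj->.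
  exact: expg1n.
(* With i shifted by one, 5 <= (i + 1) 2^j forces j >= 3 - i for i = 0, 1, 2, so 2^j is a multiple
   of the exponent of the layer. *)
suff /dvdnP[d ->] : (2 ^ (3 - i) %| 2 ^ j)%N by rewrite mulnC expgM exp_layer // expg1n.
apply: dvdn_exp2l; case: i le_i le_ij {xi} => [|[|[|]]] // _.
- by case: (nat_of_ord j) => [|[|[|]]].
- by case: (nat_of_ord j) => [|[|]].
by case: (nat_of_ord j).
Qed.

End Jennings5.

End JenningsSeries.

(** * The main theorem *)

Local Open Scope ring_scope.

Lemma iso_pairs_indices ij : ij \in iso_pairs -> ij.1 \in indices /\ ij.2 \in indices.
Proof.
move=> ijP; apply/andP; move: ij ijP; apply/allP; by vm_cast_no_check (erefl true).
Qed.

Lemma iso_pairs_mod4 ij : ij \in iso_pairs ->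
  let P := pres_of ij.1 in let Q := pres_of ij.2 in
  [/\ p0 P = p0 Q %[mod 4], p1 P = p1 Q %[mod 4], q0 P = q0 Q %[mod 4],
    q1 P = q1 Q %[mod 4] & rb P = rb Q %[mod 4]].
Proof.
move=> ijP P Q; suff : [&& p0 P == p0 Q %[mod 4], p1 P == p1 Q %[mod 4], q0 P == q0 Q %[mod 4],
    q1 P == q1 Q %[mod 4] & rb P == rb Q %[mod 4]]%N.
  by case/and5P => /eqP ? /eqP ? /eqP ? /eqP ? /eqP ?.
by rewrite {}/P {}/Q; move: ij ijP; apply/allP; vm_compute.
Qed.

(** Surjections in both directions between finite groups force equal orders. *)
Lemma jennings_quotient_isog (gT hT : finGroupType) (i j : nat) :
  (i, j) \in iso_pairs -> presents (pres_of i) gT -> presents (pres_of j) hT ->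
  ([set: gT] / jennings 2 [set: gT]%G 4)%g \isog ([set: hT] / jennings 2 [set: hT]%G 4)%g.
Proof.
move=> ijP gP hP.
have eq4 := iso_pairs_mod4 ijP.
have homHG := jennings_quotient_homg gP hP eq4.
have homGH := jennings_quotient_homg hP gP (let: And5 e1 e2 e3 e4 e5 := eq4 in
  And5 (esym e1) (esym e2) (esym e3) (esym e4) (esym e5)).
by rewrite isogEcard homGH leq_homg.
Qed.

Lemma iso_pairs_isog (k : fieldType) (gT hT : finGroupType) (i j : nat) :
  2%N \in [pchar k] -> (i, j) \in iso_pairs ->
  presents (pres_of i) gT -> presents (pres_of j) hT -> aug_quot_isog k gT hT 9.
Proof.
move=> char2 ijP gP hP.
have [/= i_in j_in] := iso_pairs_indices ijP.
have [a [b [c [tau [_ _ tauP]]]]] := presents_index (indices_ok i_in) gP.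
have [a' [b' [c' [tau' [_ _ tauP']]]]] := presents_index (indices_ok j_in) hP.
apply: (images_ok_isog char2 tauP tauP' (iso_images_ok ijP)).
by case/and3P: (indices_ok i_in).
Qed.

Lemma iso_pairs_not_isog (k : fieldType) (gT hT : finGroupType) (i j : nat) :
  2%N \in [pchar k] -> (i, j) \in iso_pairs ->
  presents (pres_of i) gT -> presents (pres_of j) hT -> ~ aug_quot_isog k gT hT 10.
Proof.
move=> char2 ijP gP hP isoGH.
have [/= _ j_in] := iso_pairs_indices ijP.
have [a' [b' [c' [tau [_ _ tauP]]]]] := presents_index (indices_ok j_in) hP.
have [A [A1 A2 A3 A4]] := @aug_quot_lift k 10 isT gT hT isT isoGH.
have A_lift : is_lift A by split.
have [[a [b [c [abcP gen_abc]]]] _] := gP.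
have [[i_def j12]|[i34 j_def]] : (i = j.+1 /\ j \in [:: 1272; 1274]%N) \/
    (i \in [:: 1778; 1779]%N /\ j = target34 i).
  by move: ijP; rewrite !inE => /or4P[] /eqP[-> ->]; [left|left|right|right].
  exact: (obstruction12_gen char2 j12 i_def tauP A_lift abcP gen_abc).
by rewrite j_def in tauP; apply: (obstruction34 char2 i34 tauP A_lift gP).
Qed.

Lemma jennings5_eq1 (gT : finGroupType) (i : nat) :
  i \in indices -> presents (pres_of i) gT -> jennings 2 [set: gT]%G 5 = 1%G.
Proof.
move=> i_in gP; have [a [b [c [tau [_ gen_abc tauP]]]]] := presents_index (indices_ok i_in) gP.
exact: jennings5 tauP gen_abc (indices_series_ok i_in).
Qed.

Theorem proposition5p1 (k : fieldType) (i j : nat) (gT hT : finGroupType) :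
  2%N \in [pchar k] ->
  (i, j) \in [:: (1272%N, 1273%N); (1274%N, 1275%N);
                 (1778%N, 1781%N); (1779%N, 1780%N)] ->
  isSG256 i [set: gT] -> isSG256 j [set: hT] ->
  let G := [set: gT]%G in
  let H := [set: hT]%G in
  [/\ jennings 2 G 5 = 1%G,
      (G / jennings 2 G 4)%g \isog (H / jennings 2 H 4)%g,
      aug_quot_isog k gT hT 9 &
      ~ aug_quot_isog k gT hT 10].
Proof.
move=> char2 ij_in gP hP G H.
(* The first two pairs of the theorem occur reversed in [iso_pairs]; symmetry of the conclusions
   takes care of them. *)
have [ijP|jiP] : (i, j) \in iso_pairs \/ (j, i) \in iso_pairs.
  by move: ij_in; rewrite !inE => /or4P[] /eqP[-> ->]; [right|right|left|left].
  have [/= i_in j_in] := iso_pairs_indices ijP.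
  have {}gP := isSG256_presents i_in gP; have {}hP := isSG256_presents j_in hP.
  split; [exact: jennings5_eq1 i_in gP | exact: jennings_quotient_isog ijP gP hP
    | exact: iso_pairs_isog char2 ijP gP hP | exact: iso_pairs_not_isog char2 ijP gP hP].
have [/= j_in i_in] := iso_pairs_indices jiP.
have {}gP := isSG256_presents i_in gP; have {}hP := isSG256_presents j_in hP.
split; [exact: jennings5_eq1 i_in gP | | |].
- by rewrite isog_sym; apply: jennings_quotient_isog jiP hP gP.
- by apply: aug_quot_isog_sym; apply: iso_pairs_isog char2 jiP hP gP.
by move=> isoGH; apply: (iso_pairs_not_isog char2 jiP hP gP); apply: aug_quot_isog_sym.
Qed.
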